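(* Let $a,b,c,d$ be positive integers with $d<b\le c$ and $b\equiv c \pmod 2$. Then, as the positive integer $N\to\infty$, $$\frac{M(H_{2aN,bN,cN;dN})}{M(H_{2aN,bN,cN})}\sim \frac{2^{7/24}e^{1/8}}{A^{3/2}N^{1/8}}\,K_1\,K_2^{N/2}\,K_3^{N^2/2}$$ and $$\frac{M(H_{2aN+1,bN,cN;dN})}{M(H_{2aN+1,bN,cN})}\sim \frac{e^{1/8}}{2^{5/24}A^{3/2}N^{1/8}}\,L_1\,L_2^{N/2}\,K_3^{N^2/2},$$ where, writing $s=\tfrac12 b+\tfrac12 c$, $$K_1=\Big[\tfrac{a+d}{ad}\Big]^{1/8}\Big[\tfrac{bc(a+b-d)(a+c-d)}{(a+b)(a+c)(b-d)(c-d)}\Big]^{1/12}\Big[\tfrac{(a+s)(s-d)}{s(a+s-d)}\Big]^{1/24},$$ $$K_2=\frac{a^{a}d^{d}s^{s}(a+s-d)^{a+s-d}}{(a+d)^{a+d}(a+s)^{a+s}(s-d)^{s-d}},$$ $$K_3=\frac{s^{2s^2}}{b^{b^2}c^{c^2}}\cdot\frac{(a+s-d)^{2(a+s-d)^2}}{(a+b-d)^{(a+b-d)^2}(a+c-d)^{(a+c-d)^2}}\cdot\frac{(b-d)^{(b-d)^2}(c-d)^{(c-d)^2}}{(s-d)^{2(s-d)^2}}\cdot\frac{(a+b)^{(a+b)^2}(a+c)^{(a+c)^2}}{(a+s)^{2(a+s)^2}},$$ $$L_1=\Big[\tfrac{a+s-d}{a+s}\Big]^{11/24}\Big[\tfrac{(a+b)(a+c)}{(a+b-d)(a+c-d)}\Big]^{5/12}\Big[\tfrac{a+d}{ad}\Big]^{1/8}\Big[\tfrac{bc}{(b-d)(c-d)}\Big]^{1/12}\Big[\tfrac{s-d}{s}\Big]^{1/24},$$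 $$L_2=\Big[\frac{(a+d)^{a+d}}{a^{a}d^{d}}\cdot\frac{(a+s)^{a+s}(s-d)^{s-d}}{(a+s-d)^{a+s-d}s^{s}}\Big]\cdot\Big[\frac{1}{4^{d}}\cdot\frac{(a+b)^{a+b}(a+c)^{a+c}}{(a+s)^{2(a+s)}}\cdot\frac{(a+s-d)^{2(a+s-d)}}{(a+b-d)^{a+b-d}(a+c-d)^{a+c-d}}\Big]^{2}.$$
   Context: Work on the triangular lattice of unit equilateral triangles in which one family of lattice lines is vertical. For nonnegative integers $p,b,c$, $H_{p,b,c}$ denotes the hexagon on this lattice whose side lengths, listed clockwise starting from the (vertical) left side, are $p,b,c,p,b,c$. For nonnegative integers $p,b,c,d$ with $d\le\min(b,c)$, let $\ell$ be the perpendicular bisector (a horizontal line) of the left side of $H_{p,b,c}$, label the unit triangles of $H_{p,b,c}$ whose interiors meet $\ell$ by $1,2,3,\dots$ from left to right, and let $H_{p,b,c;d}$ be the region obtained from $H_{p,b,c}$ by deleting the unit triangles labeled $1,2,\dots,2d$ (so $H_{p,b,c;0}=H_{p,b,c}$). For a region $R$, $M(R)$ denotes the number of lozenge tilings of $R$. $f(N)\sim g(N)$ means $f(N)/g(N)\to1$. $A$ is the Glaisher–Kinkelin constant, $A=\lim_{n\to\infty}\frac{(2\pi)^{n/2}n^{\frac12 n^2-\frac1{12}}e^{-\frac34 n^2+\frac1{12}}}{G(n+1)}=1.2824\ldots$, where $G$ is the Barnes $G$-function, $G(n)=\prod_{i=0}^{n-2}i!$ for positive integers $n$. *)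

(* Defs.v *)
From mathcomp Require Import all_boot all_order all_algebra.
Set Implicit Arguments. Unset Strict Implicit. Unset Printing Implicit Defensive.
Import GRing.Theory Num.Theory.

(* Triangular lattice with one family of lattice lines vertical.
   Lattice points are  i*e1 + j*e2  (i j : int), with e2 the vertical unit
   vector and e1 the unit vector at angle 30 degrees; Euclidean coordinates
   of (i,j) are (i*sqrt3/2, i/2 + j).  The three line directions are
   e2 (vertical), e1 (30 deg) and e1 - e2 (-30 deg).
   Unit triangles: for a lattice point P = (i,j)
     (i,j,true)  = right-pointing triangle with vertices P, P+e1, P+e2
     (i,j,false) = left-pointing triangle with vertices P+e1, P+e2, P+e1+e2. *)
Definition tri := (int * int * bool)%type.

(* Two unit triangles share an edge: the right-pointing triangle (i,j)
   shares its edges with the left-pointing triangles (i,j) (diagonal edge),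
   (i-1,j) (vertical edge) and (i,j-1) (edge along e1). *)
Definition adj (r l : tri) : bool :=
  let: (i, j, o) := r in
  let: (i', j', o') := l in
  [&& o, ~~ o' & [|| (i' == i) && (j' == j),
                     (i' == (i - 1)%R) && (j' == j) |
                     (i' == i) && (j' == (j - 1)%R)]].

(* A region is given by the (duplicate-free) list of its unit triangles.
   A lozenge is a pair of edge-adjacent unit triangles of the region. *)
Definition lozenges (R : seq tri) : seq (tri * tri) :=
  [seq rl <- [seq (r, l) | r <- R, l <- R] | adj rl.1 rl.2].

Definition loz_default : tri * tri := ((Posz 0, Posz 0, true), (Posz 0, Posz 0, false)).

Definition M (R : seq tri) : nat :=
  #|[set S : {set 'I_(size (lozenges R))} |
      all (fun t => #|[set k in S |
                         (t == (nth loz_default (lozenges R) k).1)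
                         || (t == (nth loz_default (lozenges R) k).2)]| == 1%N) R]|.

(* The hexagon H_{p,b,c}: vertices (in (i,j) coordinates)
     (0,0) -> (0,p) -> (b,p) -> (b+c,p-c) -> (b+c,-c) -> (c,-c) -> (0,0),
   i.e. sides p (vertical, left), b, c, p, b, c clockwise from the left side.
   As a region of the plane it is
     { x e1 + y e2 : 0 <= x <= b+c, -c <= y <= p, 0 <= x+y <= b+p },
   and a unit triangle lies in it iff its three vertices do. *)
Definition in_hex (p b c : nat) (t : tri) : bool :=
  let: (i, j, o) := t in
  let P := Posz p in let B := Posz b in let C := Posz c in
  if o then (* vertices (i,j), (i+1,j), (i,j+1) *)
    [&& 0 <= i, i + 1 <= B + C, - C <= j, j + 1 <= P,
        0 <= i + j & i + j + 1 <= B + P]%R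
  else (* vertices (i+1,j), (i,j+1), (i+1,j+1) *)
    [&& 0 <= i, i + 1 <= B + C, - C <= j, j + 1 <= P,
        0 <= i + j + 1 & i + j + 2 <= B + P]%R.

(* all unit triangles with 0 <= i < b+c and -c <= j < p (this box contains
   every triangle of the hexagon) *)
Definition box (p b c : nat) : seq tri :=
  [seq (ij.1, ij.2, o) | ij <- [seq (Posz i, (Posz k - Posz c)%R)
                                  | i <- iota 0 (b + c), k <- iota 0 (p + c)],
                         o <- [:: true; false]].

Definition hex (p b c : nat) : seq tri := [seq t <- box p b c | in_hex p b c t].

(* The horizontal line l at height p/2 (perpendicular bisector of the left
   side).  In doubled height units, the interior of the right-pointing
   triangle (i,j,true) meets l iff  i+2j < p < i+2j+2, and that of the
   left-pointing triangle (i,j,false) iff  i+2j+1 < p < i+2j+3. *)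
Definition meets_l (p : nat) (t : tri) : bool :=
  let: (i, j, o) := t in
  if o then ((i + 2 * j) < Posz p < (i + 2 * j + 2))%R
  else ((i + 2 * j + 1) < Posz p < (i + 2 * j + 3))%R.

(* Exactly one unit triangle of each column 0 <= i < b+c meets l; the
   triangles of H_{p,b,c} meeting l are thus labeled 1,2,3,... by column,
   the triangle in column i getting label i+1.  Those labeled 1..2d are the
   ones meeting l in columns i < 2d. *)
Definition removed (p d : nat) (t : tri) : bool :=
  let: (i, j, o) := t in meets_l p t && (i < Posz (2 * d))%R.

Definition hexd (p b c d : nat) : seq tri :=
  [seq t <- hex p b c | ~~ removed p d t].

From Stdlib Require Import Reals.
From Coquelicot Require Import Coquelicot.

(* G(n+1) = prod_{i=0}^{n-1} i!  (Barnes G-function at positive integers) *)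
Fixpoint barnesG_succ (n : nat) : nat :=
  match n with
  | O => 1%nat
  | S m => (barnesG_succ m * Factorial.fact m)%nat
  end.

Definition Glaisher : R :=
  real (Lim_seq (fun n : nat =>
    (Rpower (2 * PI) (INR n / 2) * Rpower (INR n) (INR n ^ 2 / 2 - 1 / 12)
     * exp (- (3 / 4) * INR n ^ 2 + 1 / 12) / INR (barnesG_succ n))%R)).

Local Open Scope R_scope.

Definition pp (x : R) : R := Rpower x x.
Definition qq (x : R) : R := Rpower x (x ^ 2).

Section Consts.
Variables a b c d : R.
Let s := b / 2 + c / 2.

Definition K1 : R :=
  Rpower ((a + d) / (a * d)) (1 / 8)
  * Rpower (b * c * (a + b - d) * (a + c - d)
            / ((a + b) * (a + c) * (b - d) * (c - d))) (1 / 12)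
  * Rpower ((a + s) * (s - d) / (s * (a + s - d))) (1 / 24).

Definition K2 : R :=
  pp a * pp d * pp s * pp (a + s - d)
  / (pp (a + d) * pp (a + s) * pp (s - d)).

Definition K3 : R :=
  Rpower s (2 * s ^ 2) / (qq b * qq c)
  * (Rpower (a + s - d) (2 * (a + s - d) ^ 2) / (qq (a + b - d) * qq (a + c - d)))
  * (qq (b - d) * qq (c - d) / Rpower (s - d) (2 * (s - d) ^ 2))
  * (qq (a + b) * qq (a + c) / Rpower (a + s) (2 * (a + s) ^ 2)).

Definition L1 : R :=
  Rpower ((a + s - d) / (a + s)) (11 / 24)
  * Rpower ((a + b) * (a + c) / ((a + b - d) * (a + c - d))) (5 / 12)
  * Rpower ((a + d) / (a * d)) (1 / 8)
  * Rpower (b * c / ((b - d) * (c - d))) (1 / 12)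
  * Rpower ((s - d) / s) (1 / 24).

Definition L2 : R :=
  (pp (a + d) / (pp a * pp d) * (pp (a + s) * pp (s - d) / (pp (a + s - d) * pp s)))
  * ((1 / Rpower 4 d)
     * (pp (a + b) * pp (a + c) / Rpower (a + s) (2 * (a + s)))
     * (Rpower (a + s - d) (2 * (a + s - d)) / (pp (a + b - d) * pp (a + c - d)))) ^ 2.
End Consts.

(* Main.v *)
(** Cutting the region along its vertical lattice lines turns a tiling into a
    family of [p] nonintersecting lattice paths.  The deleted triangles form a
    wall that the paths have to avoid during their first [2 d] steps; when [p]
    is odd an extra path starts at the tip of the wall.  Crossing one column at
    a time, multilinearity of the determinant turns the number of tilings into
    [det (n_i (b + j))], where [n_i (z) z! (b + c + p - 1 - z)!] is a polynomial
    in [z] that depends on [b] and [c] only through [N = b + c].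

    For fixed [N] the determinant is thus, up to factorials, a polynomial in [b].
    The paths above the wall (and, symmetrically, below it) cannot reach some of
    the ends, which forces the divisor
    [prod_{i < ceil(p/2), l < d} (b + i - l) (c + i - l)].  By the reflection
    principle, the antisymmetric combinations of the rows do not see the wall,
    and this bounds the degree of the determinant by the degree of that divisor.
    The remaining constant is found at [c = d], where the matrix is block
    triangular and both blocks reduce, by reflection again, to Vandermonde
    determinants in the squares of the heights.  The resulting product formula
    contains MacMahon's as the case [d = 0]; the asymptotics follow from
    Stirling's formula and its analogue for superfactorials. *)

Require Import Defs.
From mathcomp Require all_boot all_order all_algebra all_fingroup zify ring.
From Stdlib Require Factorial.

(** Two constants are never computed; each is eliminated by comparing two values. For fixed [N] the
    determinants at [b] and at the corner [b = N - d] are in a known ratio. The corner blocks are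
    Vandermonde determinants times the determinant of an unspecified coefficient matrix; that factor
    does not depend on the point of evaluation, and moving on to [c = 0], where the matrix of
    reflected path counts is triangular, removes it. The degree [2 d ceil(p/2)] comes from parity.
    Centred at the fixed point of the reflection, the [floor(p/2)] antisymmetric combinations are
    odd polynomials of degree below [p], and the [ceil(p/2)] symmetric ones are even of degree below
    [p + 2 d]. Exponents used within one parity class must differ, so only the symmetric rows
    contribute an excess, [2 d] each. In the asymptotics, the product of the [(2 j + 1)!] is the
    square root of a superfactorial up to elementary factors; this is where the half-integral
    weights arise. *)

Module LozengeTilings.
Import all_boot all_order all_algebra all_fingroup zify ring.
Import Order.TTheory GRing.Theory Num.Theory.
Set Implicit Arguments. Unset Strict Implicit. Unset Printing Implicit Defensive.

(** * Perfect matchings *)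

Section PerfectMatchings.
Variables (F : finType) (e : rel F) (col : pred F).
Hypothesis e_col : forall x y, e x y -> col x && ~~ col y.

Definition edges (A : {set F}) : {set F * F} :=
  [set xy | [&& xy.1 \in A, xy.2 \in A & e xy.1 xy.2]].

Definition incident (t : F) (xy : F * F) := (t == xy.1) || (t == xy.2).

Definition matchings (A : {set F}) : {set {set F * F}} :=
  [set E : {set F * F} | (E \subset edges A)
     && [forall t in A, #|[set xy in E | incident t xy]| == 1]].

Definition num_matchings (A : {set F}) : nat := #|matchings A|.

Lemma num_matchings0 : num_matchings set0 = 1.
Proof.
rewrite /num_matchings (_ : matchings set0 = [set set0]) ?cards1 //.
apply/setP => E; rewrite !inE; apply/andP/eqP => [[sE _]|->].
  by apply/eqP; rewrite -subset0; apply: subset_trans sE _; apply/subsetP => xy; rewrite !inE.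
by rewrite sub0set; split => //; apply/forall_inP => t; rewrite inE.
Qed.

Lemma matchingP (A : {set F}) (E : {set F * F}) :
  reflect ((forall xy, xy \in E -> xy \in edges A) /\
           (forall t, t \in A -> exists2 xy, xy \in E /\ incident t xy &
              forall xy', xy' \in E -> incident t xy' -> xy' = xy))
          (E \in matchings A).
Proof.
rewrite inE; apply: (iffP andP) => [[/subsetP sE /forall_inP h]|[sE h]].
  split=> // t tA; have /cards1P[xy exy] := h t tA.
  have := set11 xy; rewrite -exy inE => /andP[xyE txy].
  exists xy => // xy' xyE' txy'; apply/set1P; rewrite -exy inE xyE'; exact: txy'.
split; first exact/subsetP.
apply/forall_inP => t tA; have [xy [xyE txy] uxy] := h t tA.
apply/cards1P; exists xy; apply/setP => xy'; rewrite !inE.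
by apply/andP/eqP => [[]|->] //; apply: uxy.
Qed.

(** Removing the edge [xy] and adding it back are inverse operations: the other edges of a matching
    through [xy] avoid both of its ends, and [e_col] makes these ends distinct. *)
Lemma matchings_through A xy : xy \in edges A ->
  #|[set E in matchings A | xy \in E]| = num_matchings (A :\ xy.1 :\ xy.2).
Proof.
case: xy => x y /=; rewrite inE /= => /and3P[xA yA exy].
have neq_xy : x != y by apply/eqP => xEy; move: (e_col exy); rewrite xEy andbN.
have notin (E : {set F * F}) : E \in matchings (A :\ x :\ y) -> (x, y) \notin E.
  by case/matchingP=> sE _; apply/negP => /sE; rewrite !inE /= eqxx andbF.
have injE : {in matchings (A :\ x :\ y) &, injective (fun E => (x, y) |: E)}.
  by move=> E1 E2 /notin n1 /notin n2 eE; rewrite -[E1](setU1K n1) eE setU1K.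
rewrite /num_matchings -(card_in_imset injE).
apply: eq_card => E; apply/idP/imsetP => [|[E' E'M ->]].
- rewrite inE => /andP[/matchingP[sE hE] xyE].
  exists (E :\ (x, y)); last by rewrite setD1K.
  have uniq_at t : t \in A -> incident t (x, y) ->
      forall xy', xy' \in E -> incident t xy' -> xy' = (x, y).
    move=> tA txy xy' xy'E txy'; have [z _ uz] := hE t tA.
    by rewrite (uz _ xy'E txy') (uz _ xyE txy).
  have ux := uniq_at x xA; have uy := uniq_at y yA.
  rewrite /incident /= eqxx in ux; rewrite /incident /= eqxx orbT in uy.
  apply/matchingP; split=> [[x' y']|t].
    rewrite !inE => /andP[ne' E']; have := sE _ E'; rewrite inE /= => /and3P[-> -> ->].
    rewrite !andbT -andbA; apply/and4P.
    split; apply/negP => /eqP eq'; case/negP: ne'; apply/eqP.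
    + by apply: uy => //; rewrite eq' eqxx.
    + by apply: ux => //; rewrite eq' eqxx.
    + by apply: uy => //; rewrite eq' eqxx orbT.
    + by apply: ux => //; rewrite eq' eqxx orbT.
  rewrite !inE => /and3P[ty tx tA]; have [z [zE tz] uz] := hE t tA.
  exists z => [|z']; last by rewrite inE => /andP[_]; exact: uz.
  rewrite !inE zE andbT; split=> //; apply/negP => /eqP ez.
  by move: tz; rewrite ez /incident /= (negPf ty) (negPf tx).
- have := notin _ E'M; case/matchingP: E'M => sE hE nE.
  rewrite inE setU11 andbT; apply/matchingP; split=> [xy|t tA].
    case/setU1P=> [-> | /sE]; first by rewrite inE /= xA yA.
    by rewrite !inE => /and3P[/and3P[_ _ ->] /and3P[_ _ ->] ->].
  have avoid xy : xy \in E' -> (x != xy.1) && (x != xy.2) && ((y != xy.1) && (y != xy.2)).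
    move/sE; rewrite !inE !(eq_sym x) !(eq_sym y).
    by case/and3P=> /and3P[-> -> _] /and3P[-> -> _] _.
  case: (boolP (incident t (x, y))) => [txy|ntxy].
    exists (x, y) => [|xy']; first by rewrite setU11.
    case/setU1P=> // /avoid; case: xy' => x' y' /= /andP[/andP[/negPf a1 /negPf a2] /andP[/negPf a3 /negPf a4]].
    by case/orP: txy => /eqP-> /=; rewrite /incident /= ?a1 ?a2 ?a3 ?a4.
  have /andP[tx ty] : (t != x) && (t != y) by rewrite -negb_or.
  have [|z [zE tz] uz] := hE t; first by rewrite !inE tx ty.
  exists z => [|z' /setU1P[-> |]]; first by rewrite setU1r.
    by rewrite (negPf ntxy).
  exact: uz.
Qed.

Lemma num_matchings_expand (A : {set F}) t : t \in A ->
  num_matchings A = \sum_(xy in edges A | incident t xy) num_matchings (A :\ xy.1 :\ xy.2).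
Proof.
move=> tA; rewrite /num_matchings.
(* The matchings are sorted by the edge that covers [t]. Every matching has one, so the default
   [(t, t)] is never returned. *)
rewrite -sum1_card (partition_big (fun E : {set F * F} => odflt (t, t) [pick xy in E | incident t xy])
  (fun xy => (xy \in edges A) && incident t xy)) /=; last first.
  move=> E /matchingP[sE /(_ t tA)[xy [xyE txy] uxy]].
  by case: pickP => [z /andP[zE tz]|/(_ xy)] /=; [rewrite sE | rewrite xyE txy].
apply: eq_bigr => xy /andP[xyA txy]; rewrite -[RHS]/(num_matchings _) -(matchings_through xyA) -sum1_card.
apply: eq_bigl => E; rewrite [RHS]inE; case EM: (E \in matchings A) => //=.
case/matchingP: EM => sE /(_ t tA)[z [zE tz] uz].
case: pickP => [w /andP[wE tw]|/(_ z)]; last by rewrite zE tz.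
rewrite /= (uz _ wE tw); apply/eqP/idP => [<- //|xyE]; exact/esym/uz.
Qed.
End PerfectMatchings.

(** [M] counts sets of positions in the list [lozenges R]. This list is duplicate-free, so decoding
    a position to an edge ([dec]) is a bijection and induces one between the sets. *)
Lemma M_num_matchings (F : finType) (enc : F -> tri) (A : {set F}) (R : seq tri) :
  injective enc -> uniq R -> R =i [seq enc x | x in A] ->
  M R = num_matchings (fun x y => adj (enc x) (enc y)) A.
Proof.
move=> enc_inj uR RE.
pose encP (xy : F * F) := (enc xy.1, enc xy.2).
have encP_inj : injective encP by case=> [x y] [x' y'] [/enc_inj -> /enc_inj ->].
have RP x : (enc x \in R) = (x \in A) by rewrite RE mem_image.
set L := lozenges R.
have uL : uniq L by apply/filter_uniq/allpairs_uniq => // -[? ?] [? ?] _ _ [-> ->].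
have LP rl : rl \in L = [&& rl.1 \in R, rl.2 \in R & adj rl.1 rl.2].
  case: rl => r l; rewrite mem_filter.
  apply/andP/and3P => [[rl /allpairsP[[u v] /= [uR' vR [eu ev]]]]|[rR lR rl]].
    by rewrite eu ev in rl *.
  by split=> //; apply/allpairsP; exists (r, l).
have decS (k : 'I_(size L)) : {xy : F * F | encP xy == nth loz_default L k}.
  apply: sigW; have := mem_nth loz_default (ltn_ord k).
  case: (nth _ _ _) => r l; rewrite LP /= !RE => /and3P[/mapP[x _ ->] /mapP[y _ ->] _].
  by exists (x, y).
pose dec k := sval (decS k); have decK k : encP (dec k) = nth loz_default L k by apply/eqP: (svalP (decS k)).
have dec_inj : injective dec.
  move=> k1 k2 /(congr1 encP); rewrite !decK => /eqP; rewrite nth_uniq // => /eqP; exact: val_inj.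
have decE k : dec k \in edges (fun x y => adj (enc x) (enc y)) A.
  by have := mem_nth loz_default (ltn_ord k); rewrite -decK LP !inE /= !RP.
have dec_onto xy : xy \in edges (fun x y => adj (enc x) (enc y)) A -> exists k, dec k = xy.
  rewrite inE -!RP => xyA; have : encP xy \in L by rewrite LP.
  move=> xyL; exists (Ordinal (etrans (index_mem _ _) xyL)); apply: encP_inj.
  by rewrite decK /= nth_index.
have cardE (S : {set 'I_(size L)}) x :
    #|[set k in S | (enc x == (nth loz_default L k).1) || (enc x == (nth loz_default L k).2)]|
    = #|[set xy in dec @: S | incident x xy]|.
  rewrite -(card_imset _ dec_inj); apply: eq_card => xy.
  rewrite [RHS]inE; apply/imsetP/andP => [[k]|[/imsetP[k kS ->] inc]].
    by rewrite inE -decK /= !(inj_eq enc_inj) => /andP[kS inc] ->; rewrite imset_f.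
  by exists k; rewrite // inE kS -decK /= !(inj_eq enc_inj).
rewrite /M /num_matchings -(card_imset _ (imset_inj dec_inj)); apply: eq_card => E.
apply/imsetP/idP => [[S]|].
  rewrite !inE => /allP hS ->; apply/andP; split.
    by apply/subsetP => xy /imsetP[k _ ->].
  by apply/forall_inP => x xA; rewrite -cardE; apply: hS; rewrite RP.
rewrite inE => /andP[/subsetP sE /forall_inP hE].
have eE : E = dec @: (dec @^-1: E).
  apply/setP => xy; apply/idP/imsetP => [xyE|[k]]; last by rewrite inE => kE ->.
  by have [k ek] := dec_onto _ (sE _ xyE); exists k; rewrite // inE ek.
exists (dec @^-1: E) => //; rewrite inE; apply/allP => t; rewrite RE => /mapP[x xA ->].
by rewrite cardE -eE; apply: hE; rewrite mem_enum in xA.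
Qed.

(** * Crossing the region column by column *)

Section Strip.
Variables X T : nat.
Local Notation cell := ('I_X.+1 * 'I_T.+1 * bool)%type.

(* The cell [(x, t, true)] is the right-pointing triangle whose vertical side is
   the unit edge [t] of the line [x], and [(x, t, false)] the left-pointing one;
   in lattice coordinates that edge starts at [(x, t - x)]. *)
Definition cell_adj (r l : cell) : bool :=
  [&& r.2, ~~ l.2 &
      ((l.1.1 == r.1.1.+1 :> nat) && ((l.1.2 == r.1.2 :> nat) || (l.1.2 == r.1.2.+1 :> nat)))
      || ((l.1.1 == r.1.1 :> nat) && (l.1.2 == r.1.2 :> nat))].

Definition cell_set (P : nat -> nat -> bool -> bool) : {set cell} :=
  [set f : cell | P f.1.1 f.1.2 f.2].
Definition num_tilings P := num_matchings cell_adj (cell_set P).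
Definition cell_at (x t : nat) (o : bool) : cell := (inord x, inord t, o).
Definition bounded (P : nat -> nat -> bool -> bool) :=
  forall x t o, P x t o -> (x < X) && (t < T).
Definition del_pair (P : nat -> nat -> bool -> bool) x t x' t' : nat -> nat -> bool -> bool :=
  fun y u o => P y u o && ~~ (if o then (y == x) && (u == t) else (y == x') && (u == t')).

Lemma cell_adj_color r l : cell_adj r l -> r.2 && ~~ l.2.
Proof. by case/and3P=> -> ->. Qed.

Lemma eq_num_tilings P Q : (forall x t o, P x t o = Q x t o) -> num_tilings P = num_tilings Q.
Proof. by move=> PQ; congr (num_matchings _ _); apply/setP => f; rewrite !inE PQ. Qed.

Lemma cell_eq (f : cell) x t o : x <= X -> t <= T ->
  (f == cell_at x t o) = [&& f.1.1 == x :> nat, f.1.2 == t :> nat & f.2 == o].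
Proof.
by case: f => [[y u] o'] xX tT; rewrite /cell_at !xpair_eqE /= -!val_eqE /= !inordK ?ltnS // andbA.
Qed.

Lemma cell_at_set P x t o : x <= X -> t <= T -> (cell_at x t o \in cell_set P) = P x t o.
Proof. by move=> xX tT; rewrite inE /= !inordK. Qed.

Lemma cell_set_del P x t x' t' : x <= X -> t <= T -> x' <= X -> t' <= T ->
  cell_set P :\ cell_at x t true :\ cell_at x' t' false = cell_set (del_pair P x t x' t').
Proof.
move=> xX tT xX' tT'; apply/setP => f; rewrite !inE !cell_eq // /del_pair.
by case: f => [[y u] []] /=; rewrite ?(eqxx, andbF, andbT, andTb) /= andbC.
Qed.

(** This is the step of a lattice path: with its neighbour across the vertical side gone, a
    right-pointing triangle can only be paired inside its own column. *)
Lemma num_tilings_right P x t : bounded P -> P x t true -> ~~ P x t false ->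
  num_tilings P = (if P x.+1 t false then num_tilings (del_pair P x t x.+1 t) else 0)
        + (if P x.+1 t.+1 false then num_tilings (del_pair P x t x.+1 t.+1) else 0).
Proof.
move=> bP Pr nl; have /andP[xX tT] := bP _ _ _ Pr.
have [xX' tT'] := (ltnW xX, ltnW tT).
rewrite /num_tilings (num_matchings_expand cell_adj_color (t := cell_at x t true)); last by rewrite cell_at_set.
have -> (F1 : cell * cell -> nat) :
  \sum_(xy in edges cell_adj (cell_set P) | incident (cell_at x t true) xy) F1 xy =
  (if P x.+1 t false then F1 (cell_at x t true, cell_at x.+1 t false) else 0)
  + (if P x.+1 t.+1 false then F1 (cell_at x t true, cell_at x.+1 t.+1 false) else 0); last first.
  by rewrite !cell_set_del.
have memE xy : (xy \in edges cell_adj (cell_set P)) && incident (cell_at x t true) xy =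
   ((xy == (cell_at x t true, cell_at x.+1 t false)) && P x.+1 t false) ||
   ((xy == (cell_at x t true, cell_at x.+1 t.+1 false)) && P x.+1 t.+1 false).
  case: xy => r l; rewrite inE /= /incident !(eq_sym (cell_at _ _ _)) !xpair_eqE !cell_eq //=.
  apply/idP/idP.
    case/andP=> /and3P[]; rewrite !inE => Pr' Pl' /and3P[r2 /negPf l2].
    rewrite r2 l2 !andbF orbF /= in Pr' Pl' *.
    move=> adjs /and3P[/eqP rx /eqP rt _]; rewrite rx rt !eqxx /= in Pl' adjs *.
    case/orP: adjs => /andP[/eqP e1]; last first.
      by move=> /eqP e2; rewrite e1 e2 (negPf nl) in Pl'.
    by case/orP=> /eqP e2; rewrite e1 e2 in Pl' *; rewrite !eqxx Pl' /= ?orbT.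
  case/orP=> /andP[/andP[/and3P[/eqP rx /eqP rt /eqP ro] /and3P[/eqP lx /eqP lt /eqP lo]] Pl];
  by rewrite !inE /cell_adj rx rt ro lx lt lo Pr Pl /= !eqxx ?orbT.
rewrite (eq_bigl _ _ memE) (bigID (fun xy => xy == (cell_at x t true, cell_at x.+1 t false))) /=.
have ne12 : (cell_at x t true, cell_at x.+1 t.+1 false) != (cell_at x t true, cell_at x.+1 t false).
  by apply/eqP => /(congr1 (fun rl : cell * cell => nat_of_ord rl.2.1.2)) /=; rewrite !inordK //; lia.
congr (_ + _).
  case: (boolP (P x.+1 t false)) => P1; [apply: big_pred1 | apply: big_pred0] => xy /=.
    by case: (boolP (xy == _)) => [/eqP -> | //]; rewrite ?andbF ?andbT //= ?orbF.
  case: eqP => [-> | _]; rewrite ?andbF //= andbT eq_sym (negPf ne12) //.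
case: (boolP (P x.+1 t.+1 false)) => P1; [apply: big_pred1 | apply: big_pred0] => xy /=.
  rewrite andbT; case: (xy =P (_, cell_at x.+1 t.+1 _)) => [-> | _]; first by rewrite orbT.
  by rewrite orbF; case: eqP; rewrite ?andbF.
by rewrite andbF orbF; case: eqP; rewrite ?andbF.
Qed.

(** With no right-pointing triangle remaining in the column to its left, a left-pointing triangle
    must be paired across its vertical side: a forced horizontal lozenge. *)
Lemma num_tilings_left P x t : bounded P -> P x t false -> P x t true ->
  (forall u, ~~ P x.-1 u true || (x == 0)) ->
  num_tilings P = num_tilings (del_pair P x t x t).
Proof.
move=> bP Pl Pr np; have /andP[xX tT] := bP _ _ _ Pr.
have [xX' tT'] := (ltnW xX, ltnW tT).
rewrite /num_tilings (num_matchings_expand cell_adj_color (t := cell_at x t false)); last by rewrite cell_at_set.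
rewrite (big_pred1 (cell_at x t true, cell_at x t false)) ?cell_set_del // => -[r l].
rewrite inE /= /incident !(eq_sym (cell_at _ _ _)) !xpair_eqE !cell_eq //=.
apply/idP/idP.
  case/andP=> /and3P[]; rewrite !inE => Pr' Pl' /and3P[r2 /negPf l2].
  rewrite r2 l2 !andbF /= in Pr' Pl' *.
  move=> adjs /and3P[/eqP lx /eqP lt _]; rewrite lx lt !eqxx ?andbT /= in Pl' adjs *.
  case/orP: adjs => /andP[/eqP e1]; last by rewrite e1 eqxx eq_sym => ->.
  by have := np r.1.2; rewrite e1 /= Pr'.
case/andP=> /and3P[/eqP rx /eqP rt /eqP ro] /and3P[/eqP lx /eqP lt /eqP lo].
by rewrite !inE /cell_adj rx rt ro lx lt lo Pr Pl /= !eqxx ?orbT.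
Qed.
End Strip.

Lemma num_tilings_lefts X T P x s : bounded X T P -> uniq s ->
  (forall u, u \in s -> P x.+1 u false && P x.+1 u true) ->
  (forall u, ~~ P x u true) ->
  num_tilings X T P = num_tilings X T (fun y u o => P y u o && ~~ ((y == x.+1) && (u \in s))).
Proof.
elim: s P => [|v s IHs] P bP /= us hs hx.
  by apply: eq_num_tilings => y u o; rewrite in_nil andbF andbT.
case/andP: us => nvs us; have /andP[Pf Pt] := hs v (mem_head _ _).
rewrite (num_tilings_left bP Pf Pt) => [|u]; last by rewrite /= hx.
rewrite IHs //.
- apply: eq_num_tilings => y u o; rewrite /del_pair in_cons.
  by case: (P y u o) => //=; case: o; case: (y == _); case: (u == v).
- by move=> y u o /andP[/bP].
- move=> u us'; have /andP[a1 a2] := hs u (mem_behead (s := v :: s) us').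
  by rewrite /del_pair a1 a2 eqxx; case: eqP us' => [->|]; rewrite ?(negPf nvs).
- by move=> u; rewrite /del_pair (negPf (hx u)).
Qed.

(** * Lattice paths and the frontier of a partial tiling *)

Section Paths.
Variables p N b d : nat.
(* The middle of the edge [t] of the line [x] lies on [l]. *)
Definition slit x t := p + x == t.*2.+1.
Definition blocked x t := (x <= d.*2) && slit x t.
(* Number of paths from the edge [t] of the line [N - r] to the edge [b + j] of the
   line [N]; a step either keeps the index of the edge or increases it by one. *)
Fixpoint npaths r t j : nat :=
  if r is r'.+1 then
    (if blocked (N - r') t then 0 else npaths r' t j)
    + (if blocked (N - r') t.+1 then 0 else npaths r' t.+1 j)
  else t == b + j.

Lemma npaths_out r t j : (b + j < t) || (t + r < b + j) -> npaths r t j = 0.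
Proof.
elim: r t => [|r IHr] t /= out; first by case: eqP => // e; lia.
by rewrite !IHr ?if_same //; lia.
Qed.
End Paths.

Section Region.
Variables p b c d : nat.
Let N := b + c.
Let m := p./2.
Hypothesis dN : d.*2 < N.
Hypothesis db : d <= b.
Hypothesis dc : d <= c.

Definition in_strip x t := [&& x <= t + c, t < p + x & t < b + p].
(** A left-pointing triangle lies in the column before its vertical side, so its deletion test
    includes the line [2 d], while that of a right-pointing one stops before it. For odd [p] this
    leaves a right-pointing triangle without partner at the tip of the wall. *)
Definition in_region x t (o : bool) :=
  if o then [&& x < N, in_strip x t & ~~ (slit p x t && (x < d.*2))]
  else [&& 0 < x, x <= N, in_strip x t & ~~ blocked p d x t].
Arguments in_region : simpl never.
(* When [p] is odd, the last deleted triangle turns the edge [tip] of the line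
   [2 d] into the start of path [m]; before that line, its row is frozen. *)
Definition is_tip (x i : nat) := [&& odd p, x < d.*2 & i == m].
Let tip := d + m.

(* What is left to tile once the first [k] paths have crossed the column between
   the lines [x] and [x + 1]; [w i] is the edge reached by path [i]. *)
Definition front x k (w : 'I_p -> nat) y u (o : bool) :=
  if o then
    if y == x then [exists i : 'I_p, [&& k <= i, ~~ is_tip x i & w i == u]]
    else (x < y) && in_region y u true
  else
    if y == x.+1 then in_region y u false && ~~ [exists i : 'I_p, [&& i < k, ~~ is_tip x i & w i == u]]
    else (x.+1 < y) && in_region y u false.

Definition front_row x k (w : 'I_p -> nat) (i : 'I_p) (j : nat) : nat :=
  if is_tip x i then npaths p N b d (N - d.*2) tip j
  else if i < k then npaths p N b d (N - x.+1) (w i) j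
  else npaths p N b d (N - x) (w i) j.

Definition front_mx x k w : 'M[rat]_p := (\matrix_(i, j) (front_row x k w i j)%:R)%R.

(** The order is strict except between a path that has crossed ([i < k], index on the line [x.+1])
    and one that has not: a step up may reach the index that the other is about to leave. For odd
    [p] the last field keeps the paths [i < m] below the wall and the paths [m < i] above it, so
    that the tip can enter as path [m]. *)
Record admissible x k (w : 'I_p -> nat) : Prop := Admissible {
  admissible_inc : forall i j : 'I_p, i < j -> ~~ is_tip x i -> ~~ is_tip x j ->
    w i + ~~ ((i < k) && (k <= j)) <= w j;
  admissible_in : forall i : 'I_p, ~~ is_tip x i -> if i < k then in_region x.+1 (w i) false else in_region x (w i) true;
  admissible_tip : forall i : 'I_p, odd p -> x < d.*2 ->
    [/\ i = m :> nat -> w i = tip, i < m -> (w i).*2.+1 < p + x + (i < k)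
      & m < i -> p + x + (i < k) < (w i).*2.+1] }.

Lemma front_bounded x k w : x < N -> k <= p -> admissible x k w -> bounded N.+1 (b + p) (front x k w).
Proof.
move=> xN kp [_ I2 _] y u o; rewrite /front; case: o.
  case: eqP => [-> /existsP[i /and3P[ki vi /eqP <-]]|_].
    by have := I2 i vi; rewrite ltnNge ki /= /in_region /in_strip => /and3P[? /and3P[]]; lia.
  by rewrite /in_region /in_strip; case/and4P=> ? ? /and3P[]; lia.
have E t y' : in_region y' t false -> (y' < N.+1) && (t < b + p).
  by rewrite /in_region /in_strip => /and4P[? ? /and3P[]]; lia.
by case: eqP => [-> /andP[/E]|_ /andP[_ /E]].
Qed.

Lemma tip_slit x u : slit p x u -> x = d.*2 -> odd p /\ u = tip.
Proof. rewrite /slit /tip /m; lia. Qed.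

(** Left-pointing triangles on the line [x.+1] that no path has reached are paired across that line.
    What remains there are the edges reached by paths and, when [x.+1 = 2 d] and [p] is odd, the
    tip. *)
Lemma num_tilings_forced x w : x.+1 < N -> admissible x p w ->
  num_tilings N.+1 (b + p) (front x p w) = num_tilings N.+1 (b + p) (front x.+1 0 w).
Proof.
move=> xN [I1 I2 I3].
pose used u := [exists i : 'I_p, [&& i < p, ~~ is_tip x i & w i == u]].
pose s := [seq u <- iota 0 (b + p) | in_region x.+1 u false && ~~ used u].
have sP u : (u \in s) = in_region x.+1 u false && ~~ used u.
  rewrite mem_filter mem_iota /= add0n; case: (boolP (in_region x.+1 u false)) => //= R1.
  by case: (used u) => //=; move: R1; rewrite /in_region /in_strip => /and4P[_ _ /and3P[]].
have RgFT u : in_region x.+1 u false -> in_region x.+1 u true.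
  rewrite /in_region /blocked xN /= => /and3P[_ -> nk] /=.
  by apply: contra nk => /andP[-> /ltnW ->].
rewrite (@num_tilings_lefts _ _ _ x s).
- apply: eq_num_tilings => y u o; rewrite sP /front.
  case: o; last first.
    case: (y =P x.+1) => [-> | _]; first by rewrite /= andbN; case: ifP => [|_]; last rewrite ltnNge leqnSn; lia.
    by rewrite /= andbT; case: (y =P x.+2) => [->|]; last lia; rewrite ltnSn; apply/esym/andb_idr => _; apply/existsPn.
  case: (y =P x) => [-> | nx].
    have -> : x == x.+1 = false by lia.
    rewrite ltnNge leqnSn /= andbT; by apply/existsP => -[i]; rewrite leqNgt ltn_ord.
  case: (y =P x.+1) => [-> | ny]; last by rewrite andbT; congr (_ && _); lia.
  rewrite ltnSn /=; apply/idP/existsP => [/andP[RT nn]|[i /andP[vi /eqP <-]]].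
    case: (boolP (used u)) => [/existsP[i /and3P[_ vi wi]]|nu].
      by exists i; rewrite wi andbT; apply: contra vi => /and3P[o1 o2 o3]; rewrite /is_tip o1 o3; lia.
    rewrite nu andbT in nn; move: RT nn; rewrite /in_region /blocked => /and3P[_ iE nk].
    rewrite iE (ltnW xN) /= negbK => /andP[x2 sl]; rewrite sl /= in nk.
    have xd : x.+1 = d.*2 by lia.
    have [op ->] := tip_slit sl xd.
    have mp : m < p by rewrite /m; lia.
    exists (Ordinal mp); have [-> // _ _] := I3 (Ordinal mp) op ltac:(lia).
    by rewrite eqxx andbT /is_tip /= xd ltnn andbF.
  case: (boolP (is_tip x i)) => vx; last first.
    have uw : used (w i) by apply/existsP; exists i; rewrite ltn_ord vx /=.
    by have := I2 i vx; rewrite ltn_ord uw andbF andbT => /RgFT.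
  have /and3P[op xd /eqP im] := vx.
  have xd' : x.+1 = d.*2 by move: vi; rewrite /is_tip op im eqxx; lia.
  have [-> // _ _] := I3 i op xd.
  have kd : blocked p d x.+1 tip by rewrite /blocked /slit /tip /m; lia.
  rewrite [in_region _ _ false]/in_region kd !andbF /= andbT /in_region xN xd' ltnn andbF andbT /in_strip /tip /m; lia.
- apply: front_bounded => //; lia.
- by rewrite filter_uniq // iota_uniq.
- move=> u; rewrite sP => /andP[R1 nu]; rewrite /front eqxx R1 nu /=.
  have -> : x.+1 == x = false by lia.
  by rewrite ltnSn RgFT.
- by move=> u; rewrite /front eqxx; apply/existsPn => i; rewrite leqNgt ltn_ord.
Qed.

Definition update (w : 'I_p -> nat) (k : 'I_p) v (i : 'I_p) := if i == k then v else w i.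

Definition free_at x k (w : 'I_p -> nat) v :=
  in_region x.+1 v false && ~~ [exists i : 'I_p, [&& i < k, ~~ is_tip x i & w i == v]].

Lemma front_update x (k : 'I_p) w v y u o : admissible x k w -> ~~ is_tip x k ->
  del_pair (front x k w) x (w k) x.+1 v y u o = front x k.+1 (update w k v) y u o.
Proof.
move=> [I1 _ _] vk; rewrite /del_pair /front; case: o.
  case: (y =P x) => _; last by rewrite andbT.
  apply/andP/existsP => [[/existsP[i /and3P[ki vi /eqP <-]] /= nw]|[i /and3P[ki vi]]].
    have nik : i != k by apply: contra nw => /eqP->.
    have nik' : i <> k :> nat by move=> e; case/eqP: nik; apply: val_inj.
    by exists i; rewrite vi /update (negPf nik) eqxx !andbT; lia.
  have nik : i != k by rewrite -val_eqE /=; lia.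
  rewrite /update (negPf nik) => /eqP <-; split.
    by apply/existsP; exists i; rewrite vi eqxx (ltnW ki).
  by have := I1 _ _ ki vk vi; rewrite ltnn /= addn1 => lt_w; rewrite neq_ltn lt_w orbT.
case: (y =P x.+1) => [-> | _]; last by rewrite andbT.
rewrite -andbA; congr (_ && _); rewrite -negb_or; congr (~~ _).
apply/orP/existsP => [[/existsP[i /and3P[ki vi wi]]|/eqP ->]|[i /and3P[ki vi]]].
- have nik : i != k by rewrite -val_eqE /=; lia.
  by exists i; rewrite vi /update (negPf nik) wi ltnS (ltnW ki).
- by exists k; rewrite vk /update !eqxx ltnSn.
- rewrite /update; case: (i =P k) => [_ /eqP -> | nik wi]; [by right; rewrite eqxx | left].
  have nik' : i <> k :> nat by move=> e; apply/nik/val_inj.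
  by apply/existsP; exists i; rewrite vi wi !andbT; lia.
Qed.

Lemma admissible_update x (k : 'I_p) w v : admissible x k w -> ~~ is_tip x k ->
  w k <= v <= (w k).+1 -> free_at x k w v -> admissible x k.+1 (update w k v).
Proof.
move=> [I1 I2 I3] vk vw /andP[Rv /existsPn nv]; split=> [i j ij vi vj|i vi|i op xd].
- rewrite /update; case: (i =P k) => [ik|nik].
    have jk : j == k = false by apply/eqP => jk; move: ij; rewrite ik jk ltnn.
    rewrite jk; have := I1 _ _ ij vi vj; rewrite ik in ij *; rewrite ltnn /=; lia.
  have nik' : i <> k :> nat by move=> e; apply/nik/val_inj.
  case: (j =P k) => [jk|njk].
    rewrite jk in ij vj *; have := I1 _ _ ij vi vj; have := nv i; rewrite ij vi /= leqnn; lia.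
  have njk' : j <> k :> nat by move=> e; apply/njk/val_inj.
  by have := I1 _ _ ij vi vj; lia.
- rewrite /update; case: (i =P k) => [-> | nik]; first by rewrite ltnSn.
  have nik' : i <> k :> nat by move=> e; apply/nik/val_inj.
  have -> : (i < k.+1) = (i < k) by lia.
  exact: I2.
- have [J1 J2 J3] := I3 i op xd; rewrite /update; case: (i =P k) => [ik|nik]; last first.
    have nik' : i <> k :> nat by move=> e; apply/nik/val_inj.
    have -> : (i < k.+1) = (i < k) by lia.
    by split.
  rewrite ik in J1 J2 J3 *; rewrite ltnSn; rewrite ltnn in J2 J3.
  have nkm : (k != m :> nat) by move: vk; rewrite /is_tip op xd.
  split=> [/eqP|km|km]; first by rewrite (negPf nkm).
    have := J2 km; move: Rv; rewrite /in_region /blocked /slit => /and4P[_ _ _]; lia.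
  have := J3 km; move: Rv; rewrite /in_region /blocked /slit => /and4P[_ _ _]; lia.
Qed.

(* Row [k] splits into the two possible steps of path [k]; the row of a step to an
   unavailable triangle is zero or equal to an earlier row. *)
Lemma det_front_move x (k : 'I_p) w : x < N -> admissible x k w -> ~~ is_tip x k ->
  (\det (front_mx x k w) =
   (if free_at x k w (w k) then \det (front_mx x k.+1 (update w k (w k))) else 0)
   + (if free_at x k w (w k).+1 then \det (front_mx x k.+1 (update w k (w k).+1)) else 0))%R.
Proof.
move=> xN [I1 I2 I3] vk.
pose B v : 'M[rat]_p := (\matrix_(i, j)
  (if i == k then if blocked p d x.+1 v then 0 else npaths p N b d (N - x.+1) v j
   else front_row x k w i j)%:R)%R.
have -> : (\det (front_mx x k w) = \det (B (w k)) + \det (B (w k).+1))%R.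
  rewrite (@determinant_multilinear _ _ _ (B (w k)) (B (w k).+1) k 1%R 1%R) ?mul1r //.
  - apply/rowP => j; rewrite !mxE eqxx /front_row (negPf vk) ltnn !mul1r -natrD.
    have -> : N - x = (N - x.+1).+1 by lia.
    by rewrite /= (_ : N - (N - x.+1) = x.+1)//; lia.
  - by apply/matrixP => i j; rewrite !mxE eq_sym (negPf (neq_lift _ _)).
  - by apply/matrixP => i j; rewrite !mxE eq_sym (negPf (neq_lift _ _)).
have detB v : w k <= v <= (w k).+1 ->
    (\det (B v) = if free_at x k w v then \det (front_mx x k.+1 (update w k v)) else 0)%R.
  move=> vw; case: ifP => [/andP[Rv _]|].
    congr (\det _)%R; apply/matrixP => i j; rewrite !mxE /front_row /update; congr (_%:R)%R.
    case: (i =P k) => [-> | nik].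
      rewrite (negPf vk) ltnSn; move: Rv; rewrite /in_region => /and4P[_ _ _ /negPf -> //].
    have nik' : i <> k :> nat by move=> e; apply/nik/val_inj.
    have -> // : (i < k.+1) = (i < k) by lia.
  move/negbT; rewrite negb_and negbK => /orP[nR|/existsP[i /and3P[ik vi /eqP wi]]]; last first.
    have nik : i != k by rewrite -val_eqE /= neq_ltn ik.
    have Ri := I2 i vi; rewrite ik wi in Ri.
    apply: (determinant_alternate nik) => j; rewrite !mxE (negPf nik) eqxx /front_row (negPf vi) ik wi.
    by move: Ri; rewrite /in_region => /and4P[_ _ _ /negPf ->].
  rewrite (expand_det_row _ k) big1 // => j _; rewrite !mxE eqxx.
  case: ifP => [|nk]; first by rewrite mul0r.
  rewrite npaths_out ?mul0r //; have := I2 k vk; rewrite ltnn.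
  move: nR; rewrite /in_region nk /= andbT /in_strip xN /=; have := ltn_ord j.
  move=> jp nE /andP[/and3P[e1 e2 e3] _]; move: nE; rewrite /N in xN *; lia.
by rewrite !detB //; lia.
Qed.

(** The same two-term recursion as in [det_front_move]. Count and determinant thus agree by
    induction, without an involution on families of paths. *)
Lemma num_tilings_move x (k : 'I_p) w : x < N -> admissible x k w -> ~~ is_tip x k ->
  num_tilings N.+1 (b + p) (front x k w) =
   (if free_at x k w (w k) then num_tilings N.+1 (b + p) (front x k.+1 (update w k (w k))) else 0)
   + (if free_at x k w (w k).+1 then num_tilings N.+1 (b + p) (front x k.+1 (update w k (w k).+1)) else 0).
Proof.
move=> xN I vk.
rewrite (@num_tilings_right _ _ _ x (w k)).
- have regE v : front x k w x.+1 v false = free_at x k w v by rewrite /front eqxx.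
  rewrite !regE; by congr (_ + _); case: ifP => // _; apply: eq_num_tilings => y u o; rewrite -(front_update _ _ _ _ I vk).
- by apply: front_bounded => //; apply: ltnW.
- by rewrite /front eqxx; apply/existsP; exists k; rewrite leqnn vk eqxx.
- by rewrite /front (ltn_eqF (ltnSn x)) ltnNge leqnSn.
Qed.

Lemma admissible_next x w : x.+1 < N -> admissible x p w -> admissible x.+1 0 w.
Proof.
move=> xN [I1 I2 I3].
have vv (i : 'I_p) : is_tip x.+1 i -> is_tip x i by rewrite /is_tip => /and3P[-> ? ->]; lia.
have tipm (i : 'I_p) : is_tip x i -> ~~ is_tip x.+1 i -> [/\ odd p, x < d.*2, x.+1 = d.*2, i = m :> nat & w i = tip].
  move=> /and3P[op xd /eqP im]; rewrite /is_tip op im eqxx => nv; have [J _ _] := I3 i op xd.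
  by split=> //; [lia | apply: J].
split=> [i j ij vi vj|i vi|i op xd]; rewrite ?ltn0 /=.
- case: (boolP (is_tip x i)) => vi'.
    have [op xd xd' im ->] := tipm _ vi' vi; have [_ _ J3] := I3 j op xd.
    have := J3 ltac:(lia); rewrite ltn_ord /tip /m; lia.
  case: (boolP (is_tip x j)) => vj'.
    have [op xd xd' jm ->] := tipm _ vj' vj; have [_ J2 _] := I3 i op xd.
    have := J2 ltac:(lia); rewrite ltn_ord /tip /m; lia.
  have := I1 _ _ ij vi' vj'; have := ltn_ord j; lia.
- case: (boolP (is_tip x i)) => vi'.
    have [op xd xd' im ->] := tipm _ vi' vi.
    by rewrite /in_region xN /= /in_strip /tip /m xd' ltnn andbF andbT; lia.
  have := I2 _ vi'; rewrite ltn_ord /in_region xN /= /blocked => /and3P[_ -> nk] /=.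
  by apply: contra nk => /andP[-> /ltnW ->].
- have [J1 J2 J3] := I3 i op (ltnW xd); rewrite ltn_ord in J2 J3.
  by split=> // im; [have := J2 im | have := J3 im]; lia.
Qed.

Lemma num_tilings_det_column x : x < N ->
  (forall w, admissible x p w -> ((num_tilings N.+1 (b + p) (front x p w))%:R = \det (front_mx x p w))%R) ->
  forall k w, k <= p -> admissible x k w ->
  ((num_tilings N.+1 (b + p) (front x k w))%:R = \det (front_mx x k w))%R.
Proof.
move=> xN done_p k w; move Eq : (p - k) => q; elim: q k w Eq => [|q IHq] k w Eq kp I.
  have kp' : k = p by lia.
  by rewrite kp' in I *; apply: done_p.
have kp' : k < p by lia.
  (* Before the line [2 d] the tip is not yet a path: neither the front nor the matrix changes when
     [k] passes its row. *)
  have [vk|vk] := boolP (is_tip x k).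
    have nk (i : 'I_p) : ~~ is_tip x i -> (i < k.+1) = (i < k).
      move=> vi; rewrite ltnS leq_eqVlt; case: eqP => // ik; move: vi; rewrite /is_tip ik.
      by move: vk; rewrite /is_tip => ->.
    have nk' (i : 'I_p) : ~~ is_tip x i -> (k.+1 <= i) = (k <= i).
      by move=> vi; rewrite leqNgt nk // -leqNgt.
    rewrite (_ : num_tilings _ _ (front x k w) = num_tilings N.+1 (b + p) (front x k.+1 w)); last first.
      apply: eq_num_tilings => y u o; rewrite /front; case: o.
        by case: ifP => // _; apply: eq_existsb => i; case: (boolP (is_tip x i)) => vi; rewrite ?andbF //= nk'.
      by case: ifP => // _; congr (_ && ~~ _); apply: eq_existsb => i;
        case: (boolP (is_tip x i)) => vi; rewrite ?andbF //= nk.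
    rewrite (_ : front_mx x k w = front_mx x k.+1 w); last first.
      apply/matrixP => i j; rewrite !mxE /front_row; case: ifP => // /negbT vi.
      by rewrite nk.
    apply: IHq; [lia | done |].
    case: I => [I1 I2 I3]; split=> [i j ij vi vj|i vi|i op xd].
    - by rewrite nk // nk'//; apply: I1.
    - by rewrite nk //; apply: I2.
    - have [J1 J2 J3] := I3 i op xd; have /and3P[_ _ /eqP km] := vk.
      by split=> // im; rewrite (_ : (i < k.+1) = (i < k)); [exact: J2 | lia | exact: J3 | lia].
  have := det_front_move (k := Ordinal kp') xN I vk; rewrite /= => ->.
  have := num_tilings_move (k := Ordinal kp') xN I vk; rewrite /= => ->.
  rewrite natrD; congr (_ + _)%R; case: ifP => // fr; apply: IHq => //; first lia.
  - by apply: (admissible_update (k := Ordinal kp') I vk _ fr); rewrite leqnn leqnSn.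
  - by lia.
  - by apply: (admissible_update (k := Ordinal kp') I vk _ fr); rewrite leqnn leqnSn.
Qed.

Lemma num_tilings_det x k w : x < N -> k <= p -> admissible x k w ->
  ((num_tilings N.+1 (b + p) (front x k w))%:R = \det (front_mx x k w))%R.
Proof.
move En : (N - x.+1) => n; elim: n x k w En => [|n IHn] x k w En xN;
  apply: num_tilings_det_column => // {k w} w I.
  have xN' : x.+1 = N by lia.
  have nv i : ~~ is_tip x i by rewrite /is_tip; lia.
  (* On the last line the [p] indices increase strictly inside an interval of length [p] and
     therefore fill it: nothing is left to tile, and the matrix is the identity. *)
  have wE (i : 'I_p) : w i = b + i.
    have bnd (j : 'I_p) : b <= w j < b + p.
      by have := admissible_in I (nv j); rewrite ltn_ord /in_region /in_strip xN' => /and4P[_ _ /and3P[]]; rewrite /N; lia.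
    have inc (j l : 'I_p) : j < l -> w j < w l.
      by move=> jl; have := admissible_inc I jl (nv j) (nv l); have := ltn_ord l; lia.
    have lo j (jp : j < p) : b + j <= w (Ordinal jp).
      elim: j jp => [|j IHj] jp; first by have /andP[] := bnd (Ordinal jp); lia.
      have jp' : j < p by lia.
      by have := inc (Ordinal jp') (Ordinal jp) (ltnSn _); have := IHj jp'; lia.
    have hi j (jp : p - j.+1 < p) : j < p -> w (Ordinal jp) <= b + (p - j.+1).
      elim: j jp => [|j IHj] jp jp2; first by have /andP[] := bnd (Ordinal jp); lia.
      have jp' : p - j.+1 < p by lia.
      have h : Ordinal jp < Ordinal jp' by move=> /=; lia.
      by have := inc _ _ h; have := IHj jp' ltac:(lia); lia.
    have l := lo i (ltn_ord i); have ip : p - (p - i.+1).+1 < p by have := ltn_ord i; lia.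
    have h := hi _ ip ltac:(have := ltn_ord i; lia).
    have e1 : Ordinal (ltn_ord i) = i by apply: val_inj.
    have e2 : Ordinal ip = i by apply: val_inj => /=; have := ltn_ord i; lia.
    by rewrite e1 in l; rewrite e2 in h; have := ltn_ord i; lia.
  have -> : num_tilings N.+1 (b + p) (front x p w) = 1.
    rewrite /num_tilings (_ : cell_set _ _ _ = set0) ?num_matchings0 //; apply/setP => -[[y u] o]; rewrite !inE /= /front.
    case: o.
      case: (y =P x :> nat) => _; first by apply/existsP => -[i]; rewrite leqNgt ltn_ord.
      by apply/negP => /andP[]; rewrite /in_region; lia.
    case: (y =P x.+1 :> nat) => [-> | ne]; last by apply/negP => /andP[]; rewrite /in_region; lia.
    apply/negP => /andP[Ru /existsPn nw].
    have bu : b <= u < b + p by move: Ru; rewrite /in_region /in_strip xN' => /and4P[_ _ /and3P[]]; rewrite /N; lia.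
    have up : u - b < p by lia.
    by have := nw (Ordinal up); rewrite wE nv /= up /= subnKC ?eqxx //; lia.
  have -> : front_mx x p w = 1%:M%R.
    apply/matrixP => i j; rewrite !mxE /front_row (negPf (nv i)) ltn_ord En wE /= eqn_add2l.
    by rewrite -val_eqE.
  by rewrite det1.
have xN' : x.+1 < N by lia.
  rewrite num_tilings_forced // IHn //; [|lia|exact: admissible_next].
  congr (\det _)%R; apply/matrixP => i j; rewrite !mxE /front_row ltn_ord ltn0.
  case: (boolP (is_tip x i)) => vi.
    case: ifP => // nv; have /and3P[op xd /eqP im] := vi.
    have [-> // _ _] := admissible_tip I i op xd.
    have -> // : x.+1 = d.*2 by move: nv; rewrite /is_tip op im eqxx; lia.
  rewrite ifF //; apply/negP => /and3P[op xd im]; move: vi; rewrite /is_tip op im (ltnW xd) //.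
Qed.
End Region.

(** * From lists of lattice triangles to cells of the strip *)

Lemma eq_num_matchings (F : finType) (e e' : rel F) (A : {set F}) : e =2 e' -> num_matchings e A = num_matchings e' A.
Proof.
move=> ee; rewrite /num_matchings /matchings (_ : edges e A = edges e' A) //.
by apply/setP => xy; rewrite !inE ee.
Qed.

Section Encoding.
Variables p b c d : nat.
Let N := b + c.
Hypothesis dN : d.*2 < N.
Hypothesis db : d <= b.
Hypothesis dc : d <= c.

(** The lattice point that names a left-pointing triangle lies one line to the left of its vertical
    side, hence the shift by [~~ f.2]. *)
Definition tri_of (X T : nat) (f : 'I_X.+1 * 'I_T.+1 * bool) : tri :=
  (Posz f.1.1 - Posz (~~ f.2), Posz f.1.2 - Posz f.1.1, f.2)%R.

Lemma tri_of_inj X T : injective (@tri_of X T).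
Proof.
case=> [[x t] o] [[x' t'] o'] [/= h1 h2 ho]; rewrite ho in h1 *.
have ex : x = x' by apply: val_inj => /=; lia.
by rewrite ex in h2 *; congr (_, _, _); apply: val_inj => /=; lia.
Qed.

Lemma adj_tri_of X T (f g : 'I_X.+1 * 'I_T.+1 * bool) :
  adj (tri_of f) (tri_of g) = cell_adj f g.
Proof.
case: f g => [[x t] o] [[x' t'] o']; rewrite /tri_of /adj /cell_adj /=.
case: o => //=; case: o' => //=.
by apply/idP/idP; lia.
Qed.

Lemma mem_hexd i j o :
  ((i, j, o) \in hexd p b c d) = in_hex p b c (i, j, o) && ~~ removed p d (i, j, o).
Proof.
rewrite /hexd /hex !mem_filter andbA [X in X && _]andbC; apply: andb_idr => /andP[hin _].
apply/allpairsP; exists ((i, j), o); split; rewrite ?inE //=; last by case: (o).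
apply/allpairsP; exists (`|i|%N, `|(j + Posz c)%R|%N); rewrite /= !mem_iota.
by move: hin; rewrite /in_hex; case: (o) => h; split; rewrite ?inE; try lia; congr (_, _); lia.
Qed.

Lemma hexd_uniq : uniq (hexd p b c d).
Proof.
do 2! apply: filter_uniq; apply: allpairs_uniq => //.
- apply: allpairs_uniq; rewrite ?iota_uniq // => -[u v] [u' v'] _ _ /= [].
  by move=> -> ?; congr (_, _); lia.
- by case=> [[i j] o] [[i' j'] o'] _ _ /= [-> -> ->].
Qed.

Definition start (i : 'I_p) : nat := if is_tip p d 0 i then d + p./2 else i.

Lemma start_admissible : admissible b c d 0 0 start.
Proof.
rewrite /start; split=> [i j ij vi vj|i vi|i op xd].
- by rewrite (negPf vi) (negPf vj) ltn0 addn1.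
- rewrite (negPf vi) ltn0 /in_region /in_strip; have := ltn_ord i; move: vi; rewrite /is_tip /slit; lia.
- by split=> im; rewrite /is_tip op xd /=; case: eqP; have := ltn_ord i; lia.
Qed.

Lemma front_start x t o : front b c d 0 0 start x t o = in_region p b c d x t o.
Proof.
rewrite /front; case: o.
  case: (x =P 0) => [-> | ]; last by case: x.
  apply/existsP/idP => [[i /and3P[_ vi /eqP <-]]|].
    by have := admissible_in start_admissible vi.
  move=> Rt; have tp : t < p by move: Rt; rewrite /in_region /in_strip => /and3P[_ /and3P[]]; lia.
  exists (Ordinal tp); suff nv : ~~ is_tip p d 0 (Ordinal tp) by rewrite nv /start (negPf nv) eqxx.
  by move: Rt; rewrite /in_region /is_tip /slit /= => /and3P[_ _]; lia.
case: (x =P 1) => [-> | ne]; first by rewrite (_ : [exists _, _] = false) ?andbT //; apply/existsP => -[].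
by rewrite /in_region; case: x ne => [|[]].
Qed.

Lemma M_hexd : ((M (hexd p b c d))%:R = \det (front_mx b c d 0 0 start))%R.
Proof.
have N0 : 0 < N by lia.
rewrite -(num_tilings_det dN db dc N0 (leq0n _) start_admissible); congr (_%:R)%R.
rewrite (M_num_matchings (A := cell_set N.+1 (b + p) (front b c d 0 0 start)) (@tri_of_inj N.+1 (b + p)) hexd_uniq).
  by apply: eq_num_matchings; apply: adj_tri_of.
case=> [[i j] o]; rewrite mem_hexd; apply/idP/mapP => [h|[[[x t] o'] ]].
  have [x [t [xN tT ei ej]]] : exists x t, [/\ x < N.+2, t < (b + p).+1,
      i = (Posz x - Posz (~~ o))%R & j = (Posz t - Posz x)%R].
    exists `|(i + Posz (~~ o))%R|%N, `|(i + Posz (~~ o) + j)%R|%N.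
    by move: h; rewrite /in_hex /N; case: (o) => /= h; split; lia.
  exists (Ordinal xN, Ordinal tT, o); last by rewrite /tri_of /= ei ej.
  rewrite mem_enum inE /= front_start; move: h; rewrite ei ej /in_region /in_strip /blocked /slit /N.
  by case: (o) => /=; lia.
rewrite mem_enum inE /= front_start /tri_of /= => h [-> -> ->].
by move: h; rewrite /in_region /in_strip /blocked /slit /N; case: (o') => /=; lia.
Qed.
End Encoding.

Module Evaluation.
Local Open Scope ring_scope.

Definition falling_poly (k : nat) : {poly rat} := \prod_(i < k) ('X - i%:R%:P).

Lemma falling_polyS k : falling_poly k.+1 = falling_poly k * ('X - k%:R%:P).
Proof. by rewrite /falling_poly big_ord_recr. Qed.

Lemma horner_falling_poly k n : (falling_poly k).[n%:R] = (n ^_ k)%:R.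
Proof.
elim: k => [|k IHk]; first by rewrite /falling_poly big_ord0 hornerC ffactn0.
rewrite falling_polyS hornerM IHk !hornerE ffactnSr natrM.
have [kn|nk] := leqP k n; first by rewrite natrB.
by rewrite ffact_small // !mul0r.
Qed.

Lemma size_falling_poly k : size (falling_poly k) = k.+1.
Proof. by rewrite /falling_poly size_prod_XsubC [in size _]/index_enum -enumT size_enum_ord. Qed.

Lemma dvdp_falling_poly k l : (k <= l)%N -> falling_poly k %| falling_poly l.
Proof.
elim: l => [|l IHl]; first by rewrite leqn0 => /eqP ->.
by rewrite leq_eqVlt => /orP[/eqP -> // | /IHl h]; rewrite falling_polyS dvdp_mulr.
Qed.

(** * The determinant as a polynomial in [b] *)

Lemma npaths_free p N b d r t j : (d.*2 + r <= N)%N ->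
  npaths p N b d r t j = if (t <= b + j)%N then 'C(r, b + j - t) else 0%N.
Proof.
elim: r t => [|r IHr] t rN /=.
  case: (ltngtP t (b + j)) => h //; first by rewrite bin0n subn_eq0 leqNgt h.
  by rewrite h subnn bin0.
have nk u : blocked p d (N - r) u = false by rewrite /blocked; lia.
rewrite !nk.
rewrite !IHr; try lia.
case: (ltngtP t (b + j)) => h //=; last by rewrite h subnn !bin0.
by rewrite subnS; have -> : (b + j - t = (b + j - t).-1.+1)%N by lia; rewrite /= binS.
Qed.

Section Polynomials.
Variables p N d : nat.
Hypothesis p_gt0 : (0 < p)%N.
Hypothesis dN : (d.*2 <= N)%N.
Let m := p./2.
Let m' := uphalf p.
Let cZ := (N + p).-1.

(** The substitution [z -> N + p - 1 - z] is the effect on the edges of the line [N] of the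
    reflection in [l]. *)
Definition flip (q : {poly rat}) := q \Po (cZ%:R%:P - 'X).

Lemma flipK q : flip (flip q) = q.
Proof.
rewrite /flip -comp_polyA comp_polyB comp_polyC comp_polyX.
by rewrite opprB addrCA subrr addr0 comp_polyXr.
Qed.

Lemma flipM q r : flip (q * r) = flip q * flip r.
Proof. exact: comp_polyM. Qed.
Lemma flipD q r : flip (q + r) = flip q + flip r.
Proof. exact: comp_polyD. Qed.
Lemma flipZ a q : flip (a *: q) = a *: flip q.
Proof. exact: comp_polyZ. Qed.
Lemma flip0 : flip 0 = 0.
Proof. exact: comp_poly0. Qed.

(** This is [C(N - x, z - t) z! (N + p - 1 - z)!] as a polynomial in [z]; the binomial coefficient
    counts the unobstructed paths from the edge [t] of the line [x] to the edge [z] of the line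
    [N]. *)
Definition free_poly x t : {poly rat} := (N - x)`!%:R *: (falling_poly t * flip (falling_poly ((x + p).-1 - t))).

Lemma free_poly_pascal x t : (x < N)%N -> (t < x + p)%N -> free_poly x t = free_poly x.+1 t + free_poly x.+1 t.+1.
Proof.
move=> xN txp; rewrite /free_poly.
have -> : (N - x = (N - x.+1).+1)%N by lia.
have -> : ((x.+1 + p).-1 - t = ((x + p).-1 - t).+1)%N by lia.
have -> : ((x.+1 + p).-1 - t.+1 = (x + p).-1 - t)%N by lia.
set s := ((x + p).-1 - t)%N.
rewrite factS !falling_polyS /flip comp_polyM comp_polyB comp_polyC comp_polyX natrM.
rewrite -!scalerA -!mul_polyC.
(* Pascal's rule becomes the splitting [N - x = (z - t) + (N + p - 1 - z - s)]. *)
have -> : ((N - x.+1).+1%:R : rat)%:P = cZ%:R%:P - (s%:R%:P + t%:R%:P) :> {poly rat}.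
  rewrite -!polyCD -polyCN -polyCD; congr (_%:P); rewrite -natrD.
  by apply/(addIr (s + t)%:R); rewrite subrK -natrD; congr (_%:R); rewrite /s /cZ; lia.
by ring.
Qed.

Lemma free_poly_flip x t : (t < x + p)%N -> flip (free_poly x t) = free_poly x ((x + p).-1 - t).
Proof.
move=> txp; rewrite /free_poly flipZ flipM flipK mulrC.
by congr (_ *: (_ * flip (falling_poly _))); lia.
Qed.

Lemma size_flip q : (size (flip q) <= size q)%N.
Proof.
have [-> | q0] := eqVneq q 0; first by rewrite flip0.
apply: leq_trans (size_comp_poly_leq _ _) _.
have -> : size (cZ%:R%:P - 'X : {poly rat}) = 2 by rewrite -size_polyN opprB size_XsubC.
by rewrite muln1 -polySpred.
Qed.

Lemma size_free_poly x t : (t < x + p)%N -> (size (free_poly x t) <= x + p)%N.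
Proof.
move=> txp; apply: leq_trans (size_scale_leq _ _) _; apply: leq_trans (size_polyMleq _ _) _.
move: (size_flip (falling_poly ((x + p).-1 - t))); rewrite !size_falling_poly.
by move: (size _) => n; lia.
Qed.

(* The number of paths from the edge [t] of the line [2 d - e] to the edge [z],
   multiplied by [z! (N + p - 1 - z)!]. *)
Fixpoint path_poly e t : {poly rat} :=
  if e is e'.+1 then
    (if slit p (d.*2 - e') t then 0 else path_poly e' t)
    + (if slit p (d.*2 - e') t.+1 then 0 else path_poly e' t.+1)
  else free_poly d.*2 t.

Lemma path_poly_flip e t : (e <= d.*2)%N -> (t < d.*2 - e + p)%N ->
  flip (path_poly e t) = path_poly e ((d.*2 - e + p).-1 - t).
Proof.
elim: e t => [|e IHe] t ed tx /=; first by rewrite !subn0 in tx *; rewrite free_poly_flip.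
rewrite flipD.
have sym u v : (u + v = (d.*2 - e + p).-1)%N ->
    flip (if slit p (d.*2 - e) u then 0 else path_poly e u) = (if slit p (d.*2 - e) v then 0 else path_poly e v).
  move=> uv; have -> : slit p (d.*2 - e) v = slit p (d.*2 - e) u by rewrite /slit; lia.
  case: ifP => _; first by rewrite flip0.
  by rewrite IHe; try lia; congr path_poly; lia.
rewrite addrC; congr (_ + _); apply: sym; lia.
Qed.

(* The wall is its own mirror image, so the antisymmetric part does not see it. *)
Lemma path_poly_antisym e t : (e <= d.*2)%N -> (t < d.*2 - e + p)%N ->
  path_poly e t - path_poly e ((d.*2 - e + p).-1 - t)
  = free_poly (d.*2 - e) t - free_poly (d.*2 - e) ((d.*2 - e + p).-1 - t).
Proof.
elim: e t => [|e IHe] t ed tx /=; first by rewrite !subn0.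
rewrite (@free_poly_pascal (d.*2 - e.+1) t); try lia.
rewrite (@free_poly_pascal (d.*2 - e.+1) (_ - t)); try lia.
have -> : ((d.*2 - e.+1).+1 = d.*2 - e)%N by lia.
have sym u v : (u + v = (d.*2 - e + p).-1)%N ->
    (if slit p (d.*2 - e) u then 0 else path_poly e u) - (if slit p (d.*2 - e) v then 0 else path_poly e v)
    = free_poly (d.*2 - e) u - free_poly (d.*2 - e) v.
  move=> uv; have -> : slit p (d.*2 - e) v = slit p (d.*2 - e) u by rewrite /slit; lia.
  case: ifP => sl; first by rewrite (_ : u = v) ?subrr //; move: sl; rewrite /slit; lia.
  have := IHe u ltac:(lia) ltac:(lia).
  by have -> : ((d.*2 - e + p).-1 - u = v)%N by lia.
have s1 := sym t ((d.*2 - e.+1 + p).-1 - t).+1%N ltac:(lia).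
have s2 := sym t.+1 ((d.*2 - e.+1 + p).-1 - t)%N ltac:(lia).
rewrite [X in _ - X]addrC opprD addrACA s1 s2.
by rewrite [X in _ = _ - X]addrC opprD addrACA.
Qed.

Lemma path_poly_npaths b c j e t : (b + c = N)%N -> (j < p)%N -> (e <= d.*2)%N -> (t < d.*2 - e + p)%N ->
  (npaths p N b d (N - d.*2 + e) t j)%:R * ((b + j)`! * (c + (p.-1 - j))`!)%:R
  = (path_poly e t).[(b + j)%:R].
Proof.
move=> bcN jp; elim: e t => [|e IHe] t ed tx; last first.
  have ex : (N - (N - d.*2 + e) = d.*2 - e)%N by lia.
  rewrite addnS [npaths _ _ _ _ _.+1 _ _]/= ex /blocked leq_subr /= natrD mulrDl hornerD.
  congr (_ + _); case: ifP => _; rewrite ?mul0r ?horner0 // IHe //; lia.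
rewrite addn0 npaths_free /= ?subnKC //; rewrite subn0 in tx.
rewrite /free_poly hornerZ hornerM /flip horner_comp hornerD hornerN hornerC hornerX.
have -> : cZ%:R - (b + j)%:R = (c + (p.-1 - j))%:R :> rat.
  by apply/(addIr (b + j)%:R); rewrite subrK -natrD; congr (_%:R); rewrite /cZ; lia.
rewrite !horner_falling_poly -!natrM; congr (_%:R).
set C := (c + (p.-1 - j))%N; set B := (b + j)%N; set s := ((d.*2 + p).-1 - t)%N.
have [tB|Bt] := leqP t B; last by rewrite ffact_small //; lia.
have [sC|Cs] := leqP s C; last first.
  rewrite [X in (X * _)%N = _]bin_small; last by rewrite /B /C /s in tB Cs *; lia.
  by rewrite (ffact_small Cs) !muln0.
have nE : (N - d.*2 = (B - t) + (C - s))%N by rewrite /B /C /s in tB sC *; lia.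
rewrite -(ffact_fact tB) -(ffact_fact sC) -(bin_fact (n := N - d.*2) (m := B - t)); last by rewrite nE leq_addr.
have -> : (N - d.*2 - (B - t) = C - s)%N by lia.
by lia.
Qed.

(** A path above the wall stays above it, so it leaves the line [2 d] at an edge [u >= d + m'], and
    the free polynomial of that edge contains [falling_poly u]. *)
Lemma path_poly_dvd e t : (e <= d.*2)%N -> (t < d.*2 - e + p)%N -> (d.*2 - e + p <= t.*2)%N ->
  falling_poly (d + m') %| path_poly e t.
Proof.
elim: e t => [|e IHe] t ed tx up /=.
  by rewrite /free_poly dvdpZr ?dvdp_mulr ?dvdp_falling_poly ?pnatr_eq0 -?lt0n ?fact_gt0 //; rewrite /m'; lia.
have h u : (u < d.*2 - e + p)%N -> (d.*2 - e + p <= u.*2.+1)%N ->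
    falling_poly (d + m') %| (if slit p (d.*2 - e) u then 0 else path_poly e u).
  move=> ux uy; case: ifP => [_|sl]; first exact: dvdp0.
  by apply: IHe; move: sl; rewrite /slit; lia.
by rewrite dvdp_add // h; lia.
Qed.

Lemma size_path_poly e t : (e <= d.*2)%N -> (t < d.*2 - e + p)%N -> (size (path_poly e t) <= d.*2 + p)%N.
Proof.
elim: e t => [|e IHe] t ed tx /=; first by apply: size_free_poly; lia.
apply: leq_trans (size_polyD _ _) _; rewrite geq_max.
by apply/andP; split; case: ifP => _; rewrite ?size_poly0 // IHe //; lia.
Qed.

Definition row_poly (i : nat) : {poly rat} := if is_tip p d 0 i then path_poly 0 (d + m) else path_poly d.*2 i.

Lemma row_poly_flip i : (i < p)%N -> flip (row_poly i) = row_poly (p.-1 - i).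
Proof.
move=> ip; rewrite /row_poly; have -> : is_tip p d 0 (p.-1 - i) = is_tip p d 0 i by rewrite /is_tip; lia.
case: ifP => [/and3P[op d0 /eqP im]|_]; rewrite path_poly_flip ?subnn //; rewrite /m; try lia.
by congr (path_poly 0 _); lia.
Qed.

Lemma row_poly_antisym i : (i < p)%N -> row_poly i - row_poly (p.-1 - i) = free_poly 0 i - free_poly 0 (p.-1 - i).
Proof.
move=> ip; rewrite /row_poly; have -> : is_tip p d 0 (p.-1 - i) = is_tip p d 0 i by rewrite /is_tip; lia.
case: ifP => [/and3P[op d0 /eqP im]|_].
  by rewrite (_ : (p.-1 - i)%N = i) ?subrr //; lia.
by have := @path_poly_antisym d.*2 i (leqnn _); rewrite subnn; apply.
Qed.

Lemma size_row_poly i : (i < p)%N -> (size (row_poly i) <= d.*2 + p)%N.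
Proof.
by move=> ip; rewrite /row_poly; case: ifP => _; apply: size_path_poly; rewrite ?subnn //; rewrite /m; lia.
Qed.

Lemma row_poly_dvd_up i : (m' <= i < p)%N -> falling_poly (d + m') %| row_poly i.
Proof.
move=> ip; rewrite /row_poly ifF; first by apply: path_poly_dvd; rewrite ?subnn //; move: ip; rewrite /m'; lia.
by apply/negP => /and3P[]; move: ip; rewrite /m'; lia.
Qed.

(** Weakening [d + m'] to [d + m] lets the row of the tip, which starts at the edge [d + m], share
    the divisor: now [m'] rows have it for either parity of [p]. *)
Lemma row_poly_dvd i : (m <= i < p)%N -> falling_poly (d + m) %| row_poly i.
Proof.
move=> /andP[mi ip]; have [im'|im'] := leqP m' i.
  by apply: dvdp_trans (row_poly_dvd_up _); [apply: dvdp_falling_poly; rewrite /m /m'; lia | rewrite im'].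
have [op im] : odd p /\ i = m by rewrite /m /m' in mi im' *; lia.
have fwd : falling_poly (d + m) %| free_poly d.*2 (d + m).
  by rewrite /free_poly dvdpZr ?dvdp_mulr // pnatr_eq0 -lt0n fact_gt0.
rewrite /row_poly /is_tip op im eqxx andbT; case: (posnP d) => [d0|d_gt0]; last by rewrite double_gt0 d_gt0.
have d20 : d.*2 = 0%N by lia.
have dm : (d + m = m)%N by lia.
by rewrite dm in fwd *; rewrite ifF ?[in path_poly d.*2]d20 //; lia.
Qed.

Definition path_rows b (i j : nat) : nat :=
  if is_tip p d 0 i then npaths p N b d (N - d.*2) (d + m) j else npaths p N b d N i j.

Lemma path_rows_poly b c i j : (b + c = N)%N -> (i < p)%N -> (j < p)%N ->
  (path_rows b i j)%:R * ((b + j)`! * (c + (p.-1 - j))`!)%:R = (row_poly i).[(b + j)%:R].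
Proof.
move=> bcN ip jp; rewrite /path_rows /row_poly; case: ifP => _.
  by rewrite -(@path_poly_npaths b c j 0) ?addn0 //; rewrite /m; lia.
by rewrite -(@path_poly_npaths b c j d.*2) ?subnK ?subnn.
Qed.
End Polynomials.

(** * Degree bound *)

Lemma det_mulmx_expand (R : comPzRingType) n K (A : 'M[R]_(n, K)) (B : 'M[R]_(K, n)) :
  \det (A *m B) = \sum_(f : {ffun 'I_n -> 'I_K})
     (\prod_i A i (f i)) * \det (\matrix_(i, j) B (f i) j).
Proof.
rewrite /determinant.
under eq_bigr do under eq_bigr do rewrite mxE.
under eq_bigr do rewrite bigA_distr_bigA mulr_sumr.
rewrite exchange_big; apply: eq_bigr => f _; rewrite mulr_sumr; apply: eq_bigr => s _.
rewrite big_split /= mulrCA; congr (_ * (_ * _)).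
by apply: eq_bigr => i _; rewrite mxE.
Qed.

Lemma leq_sum_uniq (s : seq nat) : uniq s -> (\sum_(i < size s) i <= \sum_(x <- s) x)%N.
Proof.
move En : (size s) => n; elim: n s En => [|n IHn] s En us; first by rewrite big_ord0.
have [x xs nx] : exists2 x, x \in s & (n <= x)%N.
  case: (boolP (has (leq n) s)) => [/hasP[x] ? ?|/hasPn h]; first by exists x.
  have sub : {subset s <= iota 0 n} by move=> x /h; rewrite mem_iota -ltnNge.
  by have := uniq_leq_size us sub; rewrite En size_iota ltnn.
rewrite big_ord_recr /= (perm_big _ (perm_to_rem xs)) big_cons addnC leq_add //.
by apply: IHn; rewrite ?size_rem ?En ?rem_uniq.
Qed.

Lemma leq_sum_inj (I : finType) (P : pred I) (h : I -> nat) :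
  {in P &, injective h} -> (\sum_(i < #|P|) i <= \sum_(i in P) h i)%N.
Proof.
move=> hi; have u : uniq [seq h i | i <- enum P].
  by rewrite map_inj_in_uniq ?enum_uniq // => x y; rewrite !mem_enum; apply: hi.
have := leq_sum_uniq u; rewrite size_map -cardE => /leq_trans; apply.
by rewrite big_map big_enum.
Qed.

Lemma geq_sum_inj (I : finType) (P : pred I) (h : I -> nat) B :
  {in P &, injective h} -> (forall i, i \in P -> h i < B)%N ->
  (\sum_(i in P) h i + \sum_(i < #|P|) i <= #|P| * B.-1)%N.
Proof.
move=> hi hB; have hi' : {in P &, injective (fun i => B.-1 - h i)%N}.
  by move=> x y xP yP e; apply: hi => //; have := hB _ xP; have := hB _ yP; lia.
have <- : (\sum_(i in P) h i + \sum_(i in P) (B.-1 - h i) = #|P| * B.-1)%N.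
  by rewrite -big_split -sum_nat_const /=; apply: eq_bigr => i iP; have := hB _ iP; lia.
by rewrite leq_add2l; apply: leq_sum_inj.
Qed.

Lemma sum_ord_id n : ((\sum_(i < n) i) * 2 = n * n.-1)%N.
Proof.
elim: n => [|n IHn]; first by rewrite big_ord0.
by rewrite big_ord_recr /= mulnDl IHn; case: n {IHn} => [|n]; lia.
Qed.

(** Here [a] and [e] are the sums of the halved exponents of the [p./2] odd and of the [uphalf p]
    even rows. The total of the exponents exceeds [0 + ... + (p - 1)] by at most [2 d uphalf p],
    since only the even rows may use exponents from [p] on. *)
Lemma degree_count (p d a e x y z : nat) : (0 < p)%N ->
  (a + x <= p./2 * p./2.-1)%N -> (e + y <= uphalf p * (d + uphalf p).-1)%N ->
  (z * 2 = p * p.-1)%N -> (y * 2 = uphalf p * (uphalf p).-1)%N -> (x * 2 = p./2 * p./2.-1)%N ->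
  (a.*2 + p./2 + e.*2 <= z + (d * uphalf p).*2)%N.
Proof.
move=> p0; have [q [th [-> th1 -> ->]]] : exists q th,
    [/\ p = q.*2 + th, th <= 1, p./2 = q & uphalf p = q + th]%N.
  by exists p./2, (odd p); split; lia.
case: th th1 => [|[|//]] _; case: q => [|q]; rewrite ?addn0 ?addn1 /= => h1 h2 h3 h4 h5.
- lia.
- have e1 : (q.+1 * (d + q.+1).-1 = q.+1 * d + q.+1 * q)%N by rewrite addnS /= mulnDr.
  lia.
- lia.
- have e1 : (q.+2 * (d + q.+2).-1 = q.+2 * d + q.+2 * q.+1)%N by rewrite addnS /= mulnDr.
  lia.
Qed.

(** Expand each entry in powers of [j]. A choice of powers survives only if they are distinct, so at
    least [0 + ... + (n - 1)] of the total exponent goes into constants. *)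
Lemma size_det_powers n (f : 'I_n -> nat) : injective f ->
  (size (\det (\matrix_(i < n, j < n) (('X + j%:R%:P : {poly rat}) ^+ f i)))
     <= (\sum_i f i - \sum_(i < n) i).+1)%N.
Proof.
move=> f_inj; pose K := (\max_i f i).+1.
have fK i : (f i < K)%N by rewrite ltnS leq_bigmax.
pose A : 'M[{poly rat}]_(n, K) := \matrix_(i, r) ('X^(f i - r) *+ 'C(f i, r)).
pose V : 'M[{poly rat}]_(K, n) := \matrix_(r, j) (j%:R%:P ^+ r).
have -> : \matrix_(i < n, j < n) (('X + j%:R%:P : {poly rat}) ^+ f i) = A *m V.
  apply/matrixP => i j; rewrite !mxE exprDn.
  rewrite (big_ord_widen K (fun r => 'X^(f i - r) * j%:R%:P ^+ r *+ 'C(f i, r))) ?fK // big_mkcond.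
  apply: eq_bigr => r _; rewrite !mxE mulrnAl; case: ltnP => // fr.
  by rewrite bin_small // mulr0n.
rewrite det_mulmx_expand; apply: leq_trans (size_sum _ _ _) _; apply/bigmax_leqP => h _.
have [/injectiveP h_inj|/injectivePn[i [i' nii' hii']]] := boolP (injectiveb h); last first.
  rewrite [X in _ * X](determinant_alternate nii') ?mulr0 ?size_poly0 // => j.
  by rewrite !mxE hii'.
have [hf|] := boolP [forall i, (h i <= f i)%N]; last first.
  rewrite negb_forall => /existsP[i]; rewrite -ltnNge => fh.
  by rewrite (bigD1 i) //= mxE bin_small // mulr0n !mul0r size_poly0.
move/forallP: hf => hf.
have -> : \det (\matrix_(i, j) V (h i) j) =
   (\det (\matrix_(i < n, j < n) ((j%:R : rat) ^+ h i)))%:P :> {poly rat}.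
  rewrite -det_map_mx; congr (\det _); apply/matrixP => i j; by rewrite !mxE rmorphXn.
rewrite mulrC mul_polyC; apply: leq_trans (size_scale_leq _ _) _.
have -> : \prod_i A i (h i) = (\prod_i 'C(f i, h i))%:R *: 'X^(\sum_i (f i - h i)).
  rewrite -mul_polyC polyC_natr natr_prod expr_sum -big_split /=.
  by apply: eq_bigr => i _; rewrite mxE mulr_natl.
apply: leq_trans (size_scale_leq _ _) _; rewrite size_polyXn ltnS.
have sfh : (\sum_i (f i - h i) + \sum_i h i = \sum_i f i)%N.
  by rewrite -big_split /=; apply: eq_bigr => i _; rewrite subnK.
have hi' : {in 'I_n &, injective (fun i => h i : nat)} by move=> i i' _ _ /val_inj/h_inj.
have := leq_sum_inj hi'; rewrite card_ord -sfh => hs.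
by rewrite leq_subRL ?(leq_trans hs) ?leq_addl // addnC leq_add2l.
Qed.

Lemma coef_comp_polyNX (q : {poly rat}) k : (q \Po - 'X)`_k = (-1) ^+ k * q`_k.
Proof.
rewrite comp_polyE coef_sum.
under eq_bigr do rewrite coefZ -mulN1r -polyCN exprMn -polyC_exp coefCM coefXn.
have [kq|qk] := ltnP k (size q); last first.
  rewrite big1 ?nth_default ?mulr0 // => i _; case: eqP => [e|_]; last by rewrite !mulr0.
  by move: qk; rewrite e leqNgt ltn_ord.
rewrite (bigD1 (Ordinal kq)) //= eqxx mulr1 mulrC big1 ?addr0 // => i nik.
by case: eqP => [e|_]; [case/eqP: nik; apply: val_inj | rewrite !mulr0].
Qed.

Lemma comp_poly_wide (q r : {poly rat}) K : (size q <= K)%N ->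
  q \Po r = \sum_(k < K) q`_k *: r ^+ k.
Proof.
move=> qK; rewrite comp_polyE (big_ord_widen K (fun k => q`_k *: r ^+ k)) // big_mkcond.
by apply: eq_bigr => k _; case: ltnP => // sk; rewrite nth_default // scale0r.
Qed.

Section DetPoly.
Variables p N d : nat.
Hypothesis p_gt0 : (0 < p)%N.
Hypothesis dN : (d.*2 <= N)%N.
Let m := p./2.
Let m' := uphalf p.

Definition shifted_det (q : nat -> {poly rat}) :=
  \det (\matrix_(i < p, j < p) (q i \Po ('X + j%:R%:P))).
Definition det_poly := shifted_det (row_poly p N d).

Lemma shifted_det_comp q r : (forall j : nat, ('X + j%:R%:P) \Po r = r \Po ('X + j%:R%:P)) ->
  shifted_det q \Po r = shifted_det (fun i => q i \Po r).
Proof.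
move=> hr; rewrite /shifted_det -[LHS]/(comp_poly r _) -det_map_mx; congr (\det _).
by apply/matrixP => i j; rewrite !mxE /= -!comp_polyA hr.
Qed.

(** The fixed point of the reflection; recentring there turns [flip] into the substitution of
    [- 'X]. *)
Let z0 : rat := (N + p).-1%:R / 2%:R.
Let h i := row_poly p N d i \Po ('X + z0%:P).
Let G i := if (i < m)%N then h i - h (p.-1 - i) else h i + h (p.-1 - i).

Lemma size_shift (q : {poly rat}) (z : rat) : size (q \Po ('X + z%:P)) = size q.
Proof. by rewrite size_comp_poly2 // -[z]opprK polyCN size_XsubC. Qed.

Let h_flip i : (i < p)%N -> h (p.-1 - i) = h i \Po - 'X.
Proof.
move=> ip; rewrite /h -row_poly_flip // /flip -!comp_polyA; congr (_ \Po _).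
rewrite comp_polyB comp_polyC comp_polyX comp_polyD comp_polyC comp_polyX.
rewrite opprD addrC -addrA [X in - 'X + X](_ : _ = z0%:P) //.
by rewrite -polyCN -polyCD; congr (_%:P); rewrite /z0; field.
Qed.

Let G_parity i k : (i < p)%N -> (G i)`_k != 0 -> odd k = (i < m)%N.
Proof.
move=> ip; rewrite /G; case: ifP => im; rewrite h_flip // ?coefB ?coefD coef_comp_polyNX -signr_odd.
  by case: (odd k) => //; rewrite expr0 mul1r subrr eqxx.
by case: (odd k) => //; rewrite expr1 mulN1r subrr eqxx.
Qed.

Let G_size i : (i < p)%N -> (size (G i) <= if (i < m)%N then p else d.*2 + p)%N.
Proof.
move=> ip; rewrite /G; case: ifP => im.
  rewrite /h -comp_polyB row_poly_antisym // size_shift.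
  apply: leq_trans (size_polyD _ _) _; rewrite size_polyN geq_max.
  by apply/andP; split; apply: (leq_trans (size_free_poly p_gt0 dN _)); lia.
apply: leq_trans (size_polyD _ _) _; rewrite geq_max /h !size_shift !size_row_poly //; lia.
Qed.

(* The rows [i < m] are odd polynomials, the others even ones.  Expanding them into
   monomials, only families of pairwise distinct powers contribute. *)
Lemma size_shifted_G : (size (shifted_det G) <= (d * m').*2.+1)%N.
Proof.
pose K := (d.*2 + p)%N.
pose C : 'M[{poly rat}]_(p, K) := \matrix_(i, k) ((G i)`_k)%:P.
pose Pw : 'M[{poly rat}]_(K, p) := \matrix_(k, j) ('X + j%:R%:P) ^+ k.
have -> : shifted_det G = \det (C *m Pw).
  congr (\det _); apply/matrixP => i j; rewrite !mxE (@comp_poly_wide _ _ K).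
    by apply: eq_bigr => k _; rewrite !mxE mul_polyC.
  by apply: leq_trans (G_size (ltn_ord i)) _; case: ifP => _; rewrite /K; lia.
rewrite det_mulmx_expand; apply: leq_trans (size_sum _ _ _) _; apply/bigmax_leqP => f _.
have [/injectiveP f_inj|/injectivePn[i [i' nii' fii']]] := boolP (injectiveb f); last first.
  rewrite [X in _ * X](determinant_alternate nii') ?mulr0 ?size_poly0 // => j.
  by rewrite !mxE fii'.
have [/forallP nz|] := boolP [forall i : 'I_p, (G i)`_(f i) != 0]; last first.
  rewrite negb_forall => /existsP[i]; rewrite negbK => /eqP z.
  by rewrite (bigD1 i) //= mxE z !mul0r size_poly0.
have -> : \prod_i C i (f i) = (\prod_(i < p) (G i)`_(f i))%:P.
  by rewrite rmorph_prod; apply: eq_bigr => i _; rewrite mxE.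
rewrite mul_polyC; apply: leq_trans (size_scale_leq _ _) _.
under [X in \det X]eq_mx do rewrite mxE.
have f_inj' : injective (fun i => f i : nat) by move=> i i' /val_inj/f_inj.
apply: leq_trans (size_det_powers f_inj') _; rewrite ltnS leq_subLR.
have par (i : 'I_p) := G_parity (ltn_ord i) (nz i).
have bnd (i : 'I_p) : (f i < if (i < m)%N then p else d.*2 + p)%N.
  apply: leq_trans (G_size (ltn_ord i)); rewrite ltnNge; apply/negP => le.
  by have := nz i; rewrite nth_default ?eqxx.
pose lo := [pred i : 'I_p | (i < m)%N]; pose hi := [pred i : 'I_p | ~~ (i < m)%N].
have m_le : (m <= p)%N by rewrite /m; lia.
have card_lo : #|lo| = m.
  by rewrite -sum1_card -(big_ord_widen p (fun=> 1%N) m_le) sum_nat_const card_ord muln1.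
have card_hi : #|hi| = m'.
  have := cardC lo; rewrite card_ord card_lo => e; rewrite (eq_card (B := [predC lo])) // /m /m' in e *; lia.
have half_inj P : (forall i j : 'I_p, i \in P -> j \in P -> odd (f i) = odd (f j)) ->
    {in P &, injective (fun i => (f i)./2)}.
  move=> hP i j iP jP e; apply: f_inj'; rewrite /= -(odd_double_half (f i)) e (hP _ _ iP jP).
  exact: odd_double_half.
have s_lo := @geq_sum_inj _ lo (fun i => (f i)./2) m _ _.
have s_hi := @geq_sum_inj _ hi (fun i => (f i)./2) (d + m') _ _.
rewrite card_lo in s_lo; rewrite card_hi in s_hi.
have {}s_lo : (\sum_(i in lo) (f i)./2 + \sum_(i < m) i <= m * m.-1)%N.
  apply: s_lo; first by apply: half_inj => i j; rewrite !inE !par => -> ->.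
  by move=> i; rewrite inE => im; have := bnd i; have := par i; rewrite im; rewrite /m; lia.
have {}s_hi : (\sum_(i in hi) (f i)./2 + \sum_(i < m') i <= m' * (d + m').-1)%N.
  apply: s_hi; first by apply: half_inj => i j; rewrite !inE !par => /negPf -> /negPf ->.
  by move=> i; rewrite inE => /negPf im; have := bnd i; have := par i; rewrite im /m' ; lia.
have e_lo : (\sum_(i in lo) f i = (\sum_(i in lo) (f i)./2).*2 + m)%N.
  rewrite -[X in (_ + X)%N]card_lo -sum1_card -mul2n big_distrr -big_split /=.
  by apply: eq_bigr => i; rewrite inE => im; have := par i; rewrite im; lia.
have e_hi : (\sum_(i in hi) f i = (\sum_(i in hi) (f i)./2).*2)%N.
  rewrite -mul2n big_distrr /=.
  by apply: eq_bigr => i; rewrite inE => /negPf im; have := par i; rewrite im; lia.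
have -> : (\sum_i f i = (\sum_(i in lo) (f i)./2).*2 + m + (\sum_(i in hi) (f i)./2).*2)%N.
  by rewrite -e_lo -e_hi (bigID (mem lo)).
exact: (degree_count p_gt0 s_lo s_hi (sum_ord_id _) (sum_ord_id _) (sum_ord_id _)).
Qed.

Lemma size_det_poly : (size det_poly <= (d * m').*2.+1)%N.
Proof.
rewrite -(size_shift det_poly z0) /det_poly shifted_det_comp => [|j]; last first.
  by rewrite !comp_polyD !comp_polyC !comp_polyX addrAC.
have half_double (x : {poly rat}) : (2^-1 : rat) *: (x + x) = x.
  by rewrite -mulr2n -scaler_nat scalerA mulVf ?scale1r.
(* These coefficients solve the definition of [G] for [h]: [2 h i] is [G i] plus or minus [G] of the
   mirror row, and the middle row of odd [p] has [G m = 2 h m]. The change of basis is constant, so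
   it cannot raise the degree. *)
pose sg i : rat := if (i < m)%N then 1 else if (p.-1 - i < m)%N then -1 else 0.
pose V : 'M[{poly rat}]_p :=
  \matrix_(i, k) (2^-1 * ((k == i)%:R + sg i * (k == rev_ord i)%:R))%:P.
have sumd (i : 'I_p) (Q : 'I_p -> {poly rat}) : \sum_k ((k == i)%:R : rat)%:P * Q k = Q i.
  rewrite (bigD1 i) //= eqxx mul1r big1 ?addr0 // => k /negPf ->; by rewrite mul0r.
have -> : shifted_det (fun i => row_poly p N d i \Po ('X + z0%:P)) =
   \det (V *m \matrix_(i, j) (G i \Po ('X + j%:R%:P))).
  congr (\det _); apply/matrixP => i j; rewrite !mxE -/(h i).
  under eq_bigr do rewrite !mxE polyCM polyCD polyCM mulrDr mulrDl -!mulrA.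
  rewrite big_split -!mulr_sumr !sumd /= -!mulrDr !mul_polyC -comp_polyZ -comp_polyD -comp_polyZ.
  congr (_ \Po _); have ip := ltn_ord i.
  have rev2 : (p.-1 - (p.-1 - i) = i)%N by lia.
  have -> : (p - i.+1 = p.-1 - i)%N by lia.
  rewrite /G /sg rev2; case: ltnP => im.
    have -> : (p.-1 - i < m)%N = false by move: im; rewrite /m; lia.
    by rewrite scale1r addrA subrK half_double.
  case: ltnP => im'.
    by rewrite scaleN1r opprB addrACA subrr addr0 half_double.
  rewrite scale0r addr0; have -> : (p.-1 - i = i)%N by rewrite /m in im im'; lia.
  by rewrite half_double.
rewrite det_mulmx.
have -> : \det V = (\det (\matrix_(i < p, k < p) (2^-1 * ((k == i)%:R + sg i * (k == rev_ord i)%:R))))%:P.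
  by rewrite -det_map_mx; congr (\det _); apply/matrixP => i j; rewrite !mxE.
by rewrite mul_polyC; apply: leq_trans (size_scale_leq _ _) size_shifted_G.
Qed.

Lemma det_poly_horner b c : (b + c = N)%N ->
  \det (\matrix_(i < p, j < p) (path_rows p N d b i j)%:R)
    * (\prod_(j < p) ((b + j)`! * (c + j)`!))%:R = det_poly.[b%:R].
Proof.
move=> bcN.
have -> : (\prod_(j < p) ((b + j)`! * (c + j)`!) =
           \prod_(j < p) ((b + j)`! * (c + (p.-1 - j))`!))%N.
  rewrite !big_split; congr (_ * _)%N; rewrite [RHS](reindex_inj rev_ord_inj).
  by apply: eq_bigr => j _ /=; congr (_ + _)`!; have := ltn_ord j; lia.
have -> : det_poly.[b%:R] = \det (\matrix_(i < p, j < p) (row_poly p N d i).[(b + j)%:R]).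
  rewrite -[LHS]/(horner_eval b%:R _) -det_map_mx; congr (\det _); apply/matrixP => i j.
  by rewrite !mxE /= /horner_eval horner_comp hornerD hornerC hornerX natrD.
pose dg : 'rV[rat]_p := \row_j ((b + j)`! * (c + (p.-1 - j))`!)%:R.
have -> : (\prod_(j < p) ((b + j)`! * (c + (p.-1 - j))`!))%:R = \det (diag_mx dg).
  by rewrite det_diag natr_prod; apply: eq_bigr => j _; rewrite mxE.
rewrite -det_mulmx; congr (\det _); apply/matrixP => i j.
by rewrite mul_mx_diag !mxE (path_rows_poly _ _ bcN).
Qed.

(** Reflection reverses both the rows and the columns, and the two signs cancel. *)
Lemma det_poly_flip : det_poly \Po (N%:R%:P - 'X) = det_poly.
Proof.
pose A := \matrix_(i < p, j < p) (row_poly p N d i \Po ('X + j%:R%:P)).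
pose s : 'S_p := perm rev_ord_inj.
have -> : det_poly \Po (N%:R%:P - 'X) = \det (row_perm s (col_perm s A)).
  rewrite -[LHS]/(comp_poly _ _) -det_map_mx; congr (\det _); apply/matrixP => i j.
  rewrite !mxE /= !permE; have ip := ltn_ord i; have jp := ltn_ord j.
  have -> : row_poly p N d (rev_ord i) = flip p N (row_poly p N d i).
    by rewrite row_poly_flip //; congr (row_poly _ _ _ _); rewrite /=; lia.
  rewrite /flip -!comp_polyA; congr (_ \Po _).
  rewrite comp_polyD comp_polyX comp_polyC comp_polyB comp_polyC comp_polyX.
  have -> : (N + p).-1 = (N + j + rev_ord j)%N by rewrite /=; lia.
  by rewrite !natrD !polyCD; ring.
by rewrite row_permE col_permE !det_mulmx !det_perm odd_permV mulrCA -signr_addb addbb mulr1.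
Qed.
End DetPoly.

(** * The divisor and its mirror image *)

Lemma path_ltn_last x s : path ltn x s -> (x + size s <= last x s)%N.
Proof.
elim: s x => [|y s IHs] x /=; first by rewrite addn0.
by case/andP=> xy /IHs; lia.
Qed.

(** In an increasing sequence inside a window of length [m + size s] starting at [k], the [i]-th
    member lies between [k + i] and [k + i + m]. *)
Lemma dvdp_prod_sorted (Q A : nat -> {poly rat}) m k s :
  (forall i j, (i <= j <= i + m)%N -> Q i %| A j) ->
  sorted ltn s -> (forall j, j \in s -> k <= j < k + m + size s)%N ->
  \prod_(i < size s) Q (k + i)%N %| \prod_(j <- s) A j.
Proof.
move=> QA; elim: s k => [|j s IHs] k /=; first by rewrite big_ord0 big_nil.
move=> js hs; rewrite big_ord_recl big_cons /=.
have hj := hs j (mem_head _ _); have hl := hs _ (mem_last j s).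
apply: dvdp_mul; first by rewrite addn0; apply: QA; move: (last j s) (path_ltn_last js) hl => w; lia.
under eq_bigr do rewrite /bump leq0n addnA addn1.
apply: IHs => [|i si]; first exact: path_sorted js.
have /allP/(_ _ si) /= ji := order_path_min ltn_trans js.
by have := hs i (mem_behead (s := j :: s) si); lia.
Qed.

Lemma falling_poly_comp k j : falling_poly k \Po ('X + j%:R%:P) = \prod_(r < k) ('X + (j%:R - r%:R)%:P).
Proof.
rewrite /falling_poly rmorph_prod /=; apply: eq_bigr => r _.
by rewrite comp_polyB comp_polyC comp_polyX -addrA -polyCN -polyCD.
Qed.

Section Evaluate.
Variables p N d : nat.
Hypothesis p_gt0 : (0 < p)%N.
Hypothesis dN : (d.*2 <= N)%N.
Let m := p./2.
Let m' := uphalf p.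

Definition root_row (i : nat) : {poly rat} := \prod_(l < d) ('X + (i%:R - l%:R)%:P).
Definition root_poly : {poly rat} := \prod_(i < m') root_row i.

Lemma root_row_dvd i j : (i <= j <= i + m)%N -> root_row i %| falling_poly (d + m) \Po ('X + j%:R%:P).
Proof.
move=> /andP[ij ji]; rewrite falling_poly_comp.
(* Of the factors [X + j - r] with [r < d + m], those with [j - i <= r < j - i + d] form
   [root_row i]. *)
have -> : (d + m = (j - i) + (d + (i + m - j)))%N by lia.
rewrite big_split_ord /=; apply: dvdp_mull; rewrite big_split_ord /=; apply: dvdp_mulr.
rewrite (eq_bigr (fun l : 'I_d => 'X + (i%:R - l%:R)%:P)) ?dvdpp // => l _.
by congr (_ + _%:P); rewrite natrD natrB //; ring.
Qed.

(* In each term of the determinant the upper rows use columns [j_0 < j_1 < ...]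
   with [i <= j_i <= i + m], so that [root_row i] divides the [i]-th factor. *)
Lemma root_poly_dvd : root_poly %| det_poly p N d.
Proof.
rewrite /det_poly /shifted_det /determinant; apply: (big_ind (fun q => root_poly %| q)) => [|? ?|s _]; [exact: dvdp0 | exact: dvdp_add |].
apply: dvdp_mull; rewrite (bigID (fun i : 'I_p => (m <= i)%N)) /=; apply: dvdp_mulr.
apply: (@dvdp_trans _ (\prod_(i < p | (m <= i)%N) (falling_poly (d + m) \Po ('X + (s i)%:R%:P)))); last first.
  apply: (big_ind2 (fun x y => x %| y)) => // [? ? ? ?|i mi]; first exact: dvdp_mul.
  by rewrite mxE; apply: dvdp_comp_poly; apply: row_poly_dvd => //; rewrite -/m mi /=.
pose J := [set s i | i : 'I_p & (m <= i)%N].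
have -> : \prod_(i < p | (m <= i)%N) (falling_poly (d + m) \Po ('X + (s i)%:R%:P)) =
    \prod_(j <- [seq val j | j <- enum J]) (falling_poly (d + m) \Po ('X + j%:R%:P)).
  rewrite big_map big_enum /= big_imset /= => [|i i' _ _ /perm_inj //].
  by apply: eq_bigl => i; rewrite inE.
have cJ : size [seq val j | j <- enum J] = m'.
  rewrite size_map -cardE card_imset; last exact: perm_inj.
  have := cardsC [set i : 'I_p | (i < m)%N]; rewrite card_ord.
  have -> : #|[set i : 'I_p | (i < m)%N]| = m.
    rewrite cardsE -sum1_card -(big_ord_widen p (fun=> 1%N)); last by rewrite /m; lia.
    by rewrite sum_nat_const card_ord muln1.
  have -> : ~: [set i : 'I_p | (i < m)%N] = [set i : 'I_p | (m <= i)%N].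
    by apply/setP => i; rewrite !inE -leqNgt.
  by rewrite /m /m'; lia.
have := @dvdp_prod_sorted root_row (fun j => falling_poly (d + m) \Po ('X + j%:R%:P)) m 0
  [seq val j | j <- enum J] root_row_dvd _ _.
rewrite cJ; apply.
  apply: (subseq_sorted ltn_trans _ (iota_ltn_sorted 0 p)).
  by rewrite -val_enum_ord; apply: map_subseq; rewrite [enum 'I_p]enumT; apply: filter_subseq.
move=> j /mapP[i _ ->] /=; have := ltn_ord i; rewrite /m /m'; lia.
Qed.

Lemma size_root_poly : size root_poly = (d * m').+1.
Proof.
rewrite /root_poly /root_row.
under eq_bigr do under eq_bigr do rewrite -[_%:P]opprK -polyCN.
rewrite size_prod => [|i _]; last by rewrite monic_neq0 // monic_prod_XsubC.
under eq_bigr do rewrite size_prod_XsubC [in size _]/index_enum -enumT size_enum_ord.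
by rewrite sum_nat_const card_ord; lia.
Qed.

Lemma root_poly_flip_dvd : root_poly \Po (N%:R%:P - 'X) %| det_poly p N d.
Proof. by rewrite -(det_poly_flip p_gt0 dN); apply: dvdp_comp_poly; apply: root_poly_dvd. Qed.

Definition root_value (x : rat) : rat := \prod_(i < m') \prod_(l < d) (x + (i%:R - l%:R)).

Lemma horner_root_poly x : root_poly.[x] = root_value x.
Proof.
rewrite /root_poly /root_value horner_prod; apply: eq_bigr => i _; rewrite horner_prod.
by apply: eq_bigr => l _; rewrite hornerD hornerX hornerC.
Qed.

(** The roots of [root_poly] are at most [d - 1], those of its mirror image at least [N - d + 1],
    and [2 d <= N]. *)
Lemma root_poly_coprime : coprimep root_poly (root_poly \Po (N%:R%:P - 'X)).
Proof.
rewrite coprimep_sym; set Q := _ \Po _.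
have cop1 : coprimep Q 1 by rewrite coprimep1.
have copM q r : coprimep Q q -> coprimep Q r -> coprimep Q (q * r) by rewrite coprimepMr => -> ->.
apply: (big_ind (coprimep Q)) => // i _; apply: (big_ind (coprimep Q)) => // l _.
rewrite -[_%:P]opprK -polyCN coprimep_XsubC /root /Q horner_comp hornerD hornerN hornerC hornerX.
rewrite horner_root_poly opprK.
apply/prodf_neq0 => i' _; apply/prodf_neq0 => l' _.
have := ltn_ord l; have := ltn_ord l' => ld ld'.
have -> : N%:R + (i%:R - l%:R) + (i'%:R - l'%:R) = (N + i + i' - (l + l'))%N%:R :> rat.
  by rewrite natrB ?natrD; [ring | lia].
by rewrite pnatr_eq0 -lt0n; lia.
Qed.

(** The two coprime divisors together exhaust the degree allowed for [det_poly]. Only a scalar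
    remains, and comparing two points eliminates it; the points used are [x = b] and [y = N - d]. *)
Lemma det_poly_cross x y :
  (det_poly p N d).[x] * (root_value y * root_value (N%:R - y)) = (det_poly p N d).[y] * (root_value x * root_value (N%:R - x)).
Proof.
have szf : size (root_poly \Po (N%:R%:P - 'X)) = (d * m').+1.
  rewrite size_comp_poly2 ?size_root_poly //.
  by rewrite -size_polyN opprB size_XsubC.
have dv : root_poly * (root_poly \Po (N%:R%:P - 'X)) %| det_poly p N d.
  by rewrite Gauss_dvdp ?root_poly_coprime // root_poly_dvd root_poly_flip_dvd.
have [k Dk] : exists k, det_poly p N d = k *: (root_poly * (root_poly \Po (N%:R%:P - 'X))).
  case/dvdpP: dv => q Dq; have := size_det_poly p_gt0 dN; rewrite Dq.
  have [-> _|q0] := eqVneq q 0; first by exists 0; rewrite mul0r scale0r.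
  have nz : root_poly * (root_poly \Po (N%:R%:P - 'X)) != 0.
    by rewrite mulf_neq0 // -size_poly_eq0 ?szf ?size_root_poly.
  rewrite size_mul // size_mul -?size_poly_eq0 ?szf ?size_root_poly //.
  move=> sz; have s1 : (size q <= 1)%N by move: sz; rewrite -/m'; move: (size q) (d * m')%N => a e; lia.
  by rewrite (size1_polyC s1) mul_polyC; exists q`_0.
rewrite Dk !hornerZ !hornerM !horner_comp !horner_root_poly !hornerD !hornerN !hornerC !hornerX.
by ring.
Qed.
End Evaluate.

Lemma det_block_zero (A : nat -> nat -> rat) n k l : n = (k + l)%N ->
  (forall i j, (i < k)%N -> (k <= j < n)%N -> A i j = 0) ->
  \det (\matrix_(i < n, j < n) A i j)
  = \det (\matrix_(i < k, j < k) A i j) * \det (\matrix_(i < l, j < l) A (k + i)%N (k + j)%N).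
Proof.
move=> -> A0.
have -> : (\matrix_(i < k + l, j < k + l) A i j) =
    block_mx (\matrix_(i < k, j < k) A i j) 0
             (\matrix_(i < l, j < k) A (k + i)%N j) (\matrix_(i < l, j < l) A (k + i)%N (k + j)%N).
  rewrite -[LHS]submxK; congr block_mx; apply/matrixP => i j; rewrite !mxE //=.
  by apply: A0 => //=; have := ltn_ord j; lia.
by rewrite det_lblock.
Qed.

Lemma det_rev n (A : nat -> nat -> rat) :
  \det (\matrix_(i < n, j < n) A (n.-1 - i)%N (n.-1 - j)%N) = \det (\matrix_(i < n, j < n) A i j).
Proof.
pose s : 'S_n := perm (@rev_ord_inj n).
have -> : (\matrix_(i < n, j < n) A (n.-1 - i)%N (n.-1 - j)%N) =
    row_perm s (col_perm s (\matrix_(i < n, j < n) A i j)).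
  apply/matrixP => i j; rewrite !mxE !permE /=; congr A; have := ltn_ord i; have := ltn_ord j; lia.
by rewrite row_permE col_permE !det_mulmx !det_perm odd_permV mulrCA -signr_addb addbb mulr1.
Qed.

Section Corner.
Variables p d : nat.
Hypothesis p_gt0 : (0 < p)%N.
Let m := p./2.
Let m' := uphalf p.

(** * The corner [c = d] *)

(** Such a path leaves the line [2 d] below the edge [d + m] and can rise by at most [N - 2 d]
    afterwards. *)
Lemma npaths_low_zero N e t j : (d.*2 <= N)%N -> (e <= d.*2)%N ->
  (t.*2.+1 < p + (d.*2 - e))%N -> (m <= j)%N -> npaths p N (N - d) d (N - d.*2 + e) t j = 0%N.
Proof.
move=> dN; elim: e t => [|e IHe] t ed tx mj.
  have tm : (t < d + m)%N by rewrite /m; lia.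
  by rewrite addn0 npaths_free ?subnKC //; case: ifP => // _; rewrite bin_small //; lia.
have ex : (N - (N - d.*2 + e) = d.*2 - e)%N by lia.
rewrite addnS /= ex /blocked leq_subr /=.
by case: ifP => [_|s1]; case: ifP => [_|s2]; rewrite ?IHe //; move: s1 s2 || move: s2 || idtac; rewrite /slit; lia.
Qed.

(* If [c = d], the paths below the wall only rise after leaving it, so they are
   governed by the region with [b = c = d]. *)
Lemma npaths_low_conv N e t j : (d.*2 <= N)%N -> (e <= d.*2)%N ->
  (t.*2.+1 < p + (d.*2 - e))%N ->
  npaths p N (N - d) d (N - d.*2 + e) t j
  = (\sum_(k < m) npaths p d.*2 d d e t k *
       (if k <= N - d.*2 + j then 'C(N - d.*2, N - d.*2 + j - k) else 0))%N.
Proof.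
move=> dN; elim: e t => [|e IHe] t ed tx.
  rewrite addn0 npaths_free ?subnKC //=.
  have [td|dt] := ltnP t d.
    rewrite big1 => [|k _]; last by have -> : (t == d + k)%N = false by lia.
    by case: ifP => // _; rewrite bin_small //; lia.
  have tm : (t - d < m)%N by rewrite /m; lia.
  rewrite (bigD1 (Ordinal tm)) //= subnKC // eqxx mul1n big1 ?addn0 => [|k nk].
    have -> : (t <= N - d + j)%N = (t - d <= N - d.*2 + j)%N by lia.
    by case: ifP => // _; congr 'C(_, _); lia.
  have -> : (t == d + k)%N = false; last by [].
  apply/negP => /eqP tk; case/eqP: nk; apply: val_inj => /=; lia.
have ex : (N - (N - d.*2 + e) = d.*2 - e)%N by lia.
rewrite addnS /= ex; under eq_bigr do rewrite mulnDl.
rewrite big_split /=; congr (_ + _)%N; case: ifP => kl;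
  by [rewrite big1 | apply: IHe; move: kl; rewrite /blocked /slit; lia].
Qed.

Lemma path_rows_low N i j : (d.*2 <= N)%N -> (i < m)%N ->
  path_rows p N d (N - d) i j = npaths p N (N - d) d (N - d.*2 + d.*2) i j.
Proof.
move=> dN im; rewrite subnK // /path_rows ifF //; apply/negP => /and3P[_ _ /eqP]; move: im; rewrite /m; lia.
Qed.

Lemma path_rows_tip N j : (d.*2 <= N)%N -> odd p ->
  path_rows p N d (N - d) m j = if (d + m <= N - d + j)%N then 'C(N - d.*2, N - d + j - (d + m)) else 0%N.
Proof.
move=> dN op; rewrite -(@npaths_free p N (N - d) d) ?subnKC // /path_rows /is_tip op eqxx andbT.
case: (posnP d) => [d0|d_gt0]; last by rewrite double_gt0 d_gt0.
by rewrite ifF ?d0 ?subn0 //; lia.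
Qed.

Definition corner_minor N := \det (\matrix_(i < m, j < m) (path_rows p N d (N - d) (m' + i) (m' + j))%:R : 'M[rat]_m).

Lemma path_rows_sym (i j : nat) : (i < p)%N -> (j < p)%N ->
  path_rows p d.*2 d d (p.-1 - i) (p.-1 - j) = path_rows p d.*2 d d i j.
Proof.
move=> ip jp; have dd : (d + d = d.*2)%N by lia.
have [ip' jp'] : (p.-1 - i < p /\ p.-1 - j < p)%N by lia.
have h1 := path_rows_poly p_gt0 (leqnn _) dd ip jp; have h2 := path_rows_poly p_gt0 (leqnn _) dd ip' jp'.
rewrite -(row_poly_flip p_gt0) // in h2; rewrite /flip horner_comp hornerD hornerN hornerC hornerX in h2.
have e : (d.*2 + p).-1%:R - (d + (p.-1 - j))%:R = (d + j)%:R :> rat.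
  by rewrite -natrB; [congr (_%:R); lia | lia].
have ej : (p.-1 - (p.-1 - j) = j)%N by lia.
rewrite e -h1 ej [X in _ * X%:R = _]mulnC in h2.
apply/eqP; rewrite -(eqr_nat rat); apply/eqP; apply: mulIf h2.
by rewrite pnatr_eq0 -lt0n muln_gt0 !fact_gt0.
Qed.

(** Neither the rows below the wall nor the row of the tip reach the upper columns, and the tip
    reaches column [m] in one way only, by rising at every step. The block below the wall is its
    value for [b = c = d] times a unitriangular matrix of binomial coefficients; for [b = c = d],
    reflection turns it into the upper block. *)
Lemma det_corner N : (d.*2 <= N)%N ->
  \det (\matrix_(i < p, j < p) (path_rows p N d (N - d) i j)%:R) = corner_minor d.*2 * corner_minor N.
Proof.
move=> dN; have pE : p = (m' + m)%N by rewrite /m /m'; lia.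
have d2 : (d.*2 - d = d)%N by lia.
rewrite (@det_block_zero (fun i j => (path_rows p N d (N - d) i j)%:R) p m' m) //; last first.
  move=> i j im' mj; have [im|mi] := ltnP i m.
    by rewrite path_rows_low // npaths_low_zero //; rewrite /m /m' in im mj *; lia.
  have [op ->] : odd p /\ i = m by rewrite /m /m' in im' mi *; lia.
  by rewrite path_rows_tip // bin_small ?if_same //; rewrite /m /m' in mj *; lia.
congr (_ * _).
have mE : m' = (m + (m' - m))%N by rewrite /m /m'; lia.
rewrite (@det_block_zero (fun i j => (path_rows p N d (N - d) i j)%:R) m' m (m' - m)) //; last first.
  move=> i j im mj.
  by rewrite path_rows_low // npaths_low_zero //; rewrite /m /m' in im mj *; lia.
have -> : \det (\matrix_(i < m' - m, j < m' - m) (path_rows p N d (N - d) (m + i) (m + j))%:R) = 1 :> rat.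
  rewrite (_ : (\matrix_(i, j) _) = 1%:M) ?det1 //; apply/matrixP => i j; rewrite !mxE.
  have [op i0 j0] : [/\ odd p, i = 0%N :> nat & j = 0%N :> nat].
    by have := ltn_ord i; have := ltn_ord j; rewrite /m /m'; split; lia.
  rewrite i0 j0 !addn0 path_rows_tip // -val_eqE /= i0 j0 eqxx ifT; last lia.
  have -> : (N - d + m - (d + m) = N - d.*2)%N by lia.
  by rewrite binn.
rewrite mulr1.
have -> : \matrix_(i < m, j < m) (path_rows p N d (N - d) i j)%:R =
   \matrix_(i < m, j < m) (path_rows p d.*2 d d i j)%:R *m
   \matrix_(k < m, j < m) (if k <= N - d.*2 + j then 'C(N - d.*2, N - d.*2 + j - k) else 0)%N%:R :> 'M[rat]_m.
  apply/matrixP => i j; rewrite !mxE path_rows_low ?ltn_ord // npaths_low_conv //; last by have := ltn_ord i; rewrite /m; lia.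
  rewrite natr_sum; apply: eq_bigr => k _; rewrite !mxE natrM; congr (_%:R * _).
  have := @path_rows_low d.*2 i k (leqnn _) (ltn_ord i); by rewrite subnn add0n d2 => <-.
rewrite det_mulmx [X in _ * X]det_trig; last first.
  apply/is_trig_mxP => k j kj; rewrite mxE; case: ifP => // _.
  by rewrite bin_small //; lia.
rewrite big1 ?mulr1 => [|k _]; last by rewrite mxE ifT ?addnK ?binn //; lia.
rewrite -(det_rev m (fun i j => (path_rows p d.*2 d d i j)%:R)) /corner_minor; congr (\det _); apply/matrixP => i j; rewrite !mxE; congr (_%:R).
have [im jm] := (ltn_ord i, ltn_ord j).
rewrite d2 -path_rows_sym; [|by rewrite /m in im jm *; lia..].
by congr (path_rows _ _ _ _ _ _); rewrite /m /m' in im jm *; lia.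
Qed.
End Corner.

(** * Odd Vandermonde determinants and the corner minors *)

Lemma det_odd_powers n (u : 'I_n -> rat) :
  \det (\matrix_(r < n, j < n) u j ^+ (r.*2.+1))
  = \prod_j u j * \prod_(i < n) \prod_(j < n | (i < j)%N) (u j ^+ 2 - u i ^+ 2).
Proof.
have -> : \matrix_(r < n, j < n) u j ^+ (r.*2.+1)
  = Vandermonde n (\row_j (u j ^+ 2)) *m diag_mx (\row_j u j).
  by apply/matrixP => r j; rewrite mul_mx_diag !mxE -exprM -exprSr mul2n.
rewrite det_mulmx det_diag det_Vandermonde mulrC; congr (_ * _).
  by apply: eq_bigr => j _; rewrite mxE.
by apply: eq_bigr => i _; apply: eq_bigr => j _; rewrite !mxE.
Qed.

Definition triprod n e : nat := (\prod_(i < n) \prod_(j < n | i <= j) (e + i + j).+1)%N.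

Lemma prod_succ_fact x k : (\prod_(i < k) (x + i).+1 * x`! = (x + k)`!)%N.
Proof.
elim: k => [|k IHk]; first by rewrite big_ord0 mul1n addn0.
by rewrite big_ord_recr /= mulnAC IHk addnS factS mulnC.
Qed.

Lemma triprod_fact n e :
  (triprod n e * \prod_(j < n) (e + j)`! = \prod_(j < n) (e + j.*2.+1)`!)%N.
Proof.
rewrite /triprod (exchange_big_dep xpredT) //= -big_split /=; apply: eq_bigr => j _.
have := prod_succ_fact (e + j) j.+1; rewrite (big_ord_widen n (fun i => (e + j + i).+1)) ?ltn_ord //.
have -> : (e + j + j.+1 = e + j.*2.+1)%N by lia.
by move=> <-; congr (_ * _)%N; apply: eq_big => [i|i _]; rewrite ?ltnS // addnAC.
Qed.

Lemma triprod_gt0 n e : (0 < triprod n e)%N.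
Proof. by do 2! apply: prodn_cond_gt0 => ? _. Qed.

(** With [u j = (e + 2 j + 1) / 2] one has [u j ^ 2 - u i ^ 2 = (j - i) (e + i + j + 1)], and [u j]
    is half the diagonal factor of [triprod]. All other factors are free of [e] and go into [C]. *)
Lemma odd_vandermonde n : exists2 C : rat, C != 0 &
  forall e : nat, \prod_(j < n) ((e + j.*2.+1)%:R / 2%:R)
  * \prod_(i < n) \prod_(j < n | (i < j)%N)
      (((e + j.*2.+1)%:R / 2%:R) ^+ 2 - ((e + i.*2.+1)%:R / 2%:R) ^+ 2) = C * (triprod n e)%:R.
Proof.
exists (\prod_(i < n) (2%:R^-1 * \prod_(j < n | (i < j)%N) (j%:R - i%:R))).
  apply/prodf_neq0 => i _; rewrite mulf_neq0 ?invr_eq0 ?pnatr_eq0 //; apply/prodf_neq0 => j ij.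
  by rewrite subr_eq0 eqr_nat neq_ltn ij orbT.
move=> e; rewrite /triprod natr_prod -!big_split /=; apply: eq_bigr => i _.
have -> : (\prod_(j < n | (i <= j)%N) (e + i + j).+1)%:R
    = (e + i.*2.+1)%:R * \prod_(j < n | (i < j)%N) (e + i + j).+1%:R :> rat.
  rewrite natr_prod (bigD1 i) //=; congr (_ * _); first by congr (_%:R); lia.
  by apply: eq_bigl => j; rewrite ltn_neqAle -val_eqE eq_sym andbC.
rewrite mulrACA -big_split /=; congr (_ * _); first by rewrite mulrC.
apply: eq_bigr => j ij; rewrite !addnS -!natr1 !natrD -!mul2n !natrM.
by field.
Qed.

Section CornerValue.
Variables p d N : nat.
Hypothesis p_gt0 : (0 < p)%N.
Hypothesis dN : (d.*2 <= N)%N.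
Let m := p./2.
Let m' := uphalf p.
Let th : nat := odd p.
Let z0 : rat := (N + p).-1%:R / 2%:R.

(** The reflection principle: by [row_poly_antisym] this is the row [m' + i] minus its mirror image,
    although the formula does not mention the wall. *)
Definition refl_poly i : {poly rat} := free_poly p N 0 (m' + i) - free_poly p N 0 (m.-1 - i).
Let q i := refl_poly i \Po ('X + z0%:P).

Let q_odd i k : (i < m)%N -> ~~ odd k -> (q i)`_k = 0.
Proof.
move=> im ek.
have e1 : free_poly p N 0 (m.-1 - i) = flip p N (free_poly p N 0 (m' + i)).
  rewrite (free_poly_flip p_gt0 dN); last by rewrite /m /m' in im *; lia.
  by congr free_poly; rewrite /m /m' in im *; lia.
pose g := free_poly p N 0 (m' + i) \Po ('X + z0%:P).
have -> : q i = g - (g \Po - 'X).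
  rewrite /q /refl_poly comp_polyB e1; congr (_ - _); rewrite /flip -!comp_polyA; congr (_ \Po _).
  rewrite comp_polyB comp_polyC comp_polyX comp_polyD comp_polyC comp_polyX.
  rewrite opprD addrC -addrA [X in - 'X + X](_ : _ = z0%:P) //.
  by rewrite -polyCN -polyCD; congr (_%:P); rewrite /z0; field.
by rewrite coefB coef_comp_polyNX -signr_odd (negPf ek) mul1r subrr.
Qed.

Let q_size i : (i < m)%N -> (size (q i) <= p)%N.
Proof.
move=> im; rewrite /q size_shift /refl_poly.
apply: leq_trans (size_polyD _ _) _; rewrite size_polyN geq_max.
by apply/andP; split; apply: (leq_trans (size_free_poly p_gt0 dN _)); rewrite /m /m' in im *; lia.
Qed.

Let q_horner i x : (i < m)%N ->
  (refl_poly i).[x] = \sum_(r < m) (q i)`_(r.*2.+1) * (x - z0) ^+ r.*2.+1.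
Proof.
move=> im.
have -> : (refl_poly i).[x] = (q i).[x - z0].
  by rewrite /q horner_comp [('X + _).[_]]hornerD hornerX hornerC subrK.
rewrite (@horner_coef_wide _ (m.*2.+1)); last first.
  by apply: leq_trans (q_size im) _; rewrite /m; lia.
have splitting n (F : nat -> rat) : \sum_(k < n.*2.+1) F k
    = \sum_(r < n.+1) F r.*2 + \sum_(r < n) F r.*2.+1.
  elim: n => [|n IHn]; first by rewrite !big_ord_recr !big_ord0 /= addr0.
  rewrite [in LHS]doubleS big_ord_recr big_ord_recr /= IHn.
  by rewrite [X in _ = X + _]big_ord_recr [X in _ = _ + X]big_ord_recr /= doubleS; ring.
rewrite (splitting m (fun k => (q i)`_k * (x - z0) ^+ k)) big1 ?add0r // => r _.
by rewrite q_odd ?mul0r // odd_double.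
Qed.

(** An odd polynomial in [x - z0] of degree below [p] involves only the [m] exponents
    [1, 3, ..., 2 m - 1]. The coefficients therefore form a square matrix, whose determinant is
    independent of [M] and may stay unknown. *)
Lemma det_refl_poly : exists K : rat, forall M : nat, (N <= M.*2)%N ->
  \det (\matrix_(i < m, j < m) (refl_poly i).[(M + m' + j)%:R])
  = K * (triprod m (M.*2 - N + th))%:R.
Proof.
have [C _ hC] := odd_vandermonde m.
exists (\det (\matrix_(i < m, r < m) (q i)`_(r.*2.+1)) * C) => M NM.
rewrite -mulrA -hC -det_odd_powers -det_mulmx; congr (\det _); apply/matrixP => i j.
rewrite !mxE q_horner //; apply: eq_bigr => r _; rewrite !mxE; congr (_ * _ ^+ _).
(* Twice the distance of the evaluation point from [z0]; the summand [th] appears because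
   [2 m' = p + th]. *)
have -> : (M.*2 - N + th + j.*2.+1)%:R = (M + m' + j).*2%:R - (N + p).-1%:R :> rat.
  by rewrite -natrB; [congr (_%:R); rewrite /th /m'; lia | rewrite /m'; lia].
by rewrite /z0 -mul2n natrM; field.
Qed.

Lemma refl_poly_ffact (i j : 'I_m) : (refl_poly i).[(N + m' + j)%:R]
  = (N`! * ((N + m' + j) ^_ (m' + i) * (m.-1 - j) ^_ (m.-1 - i)))%:R.
Proof.
have [im jm] := (ltn_ord i, ltn_ord j).
rewrite /refl_poly /free_poly subn0 !hornerD !hornerN !hornerZ !hornerM /flip !horner_comp !hornerD !hornerN !hornerC !hornerX.
have -> : (N + p).-1%:R - (N + m' + j)%:R = (m.-1 - j)%:R :> rat.
  by rewrite -natrB; [congr (_%:R); rewrite /m /m' in im jm *; lia | rewrite /m /m' in im jm *; lia].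
rewrite !horner_falling_poly [X in _ - _ * (_ * X%:R)]ffact_small; last by rewrite /m /m' in im jm *; lia.
rewrite !mulr0 subr0 -!natrM.
have -> : (p.-1 - (m' + i) = m.-1 - i)%N by rewrite /m /m' in im jm *; lia.
by [].
Qed.

(** At [M = N], that is [c = 0], the mirror image of the point in column [j] is [m - 1 - j], and the
    falling factorials vanish above the diagonal. This one value replaces the computation of [K]. *)
Lemma det_refl_poly_top : \det (\matrix_(i < m, j < m) (refl_poly i).[(N + m' + j)%:R])
  = (\prod_(j < m) ((N + m' + j)`! * (m.-1 - j)`!))%:R.
Proof.
rewrite det_trig.
  rewrite natr_prod; apply: eq_bigr => j _; rewrite mxE refl_poly_ffact; congr (_%:R); have jm := ltn_ord j.
  rewrite ffactnn mulnA; congr (_ * _)%N.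
  have -> : (N + m' + j = N + (m' + j))%N by lia.
  by rewrite mulnC -[N in X in (_ * X)%N](addnK (m' + j)) ffact_fact //; lia.
apply/is_trig_mxP => i j ij; rewrite mxE refl_poly_ffact [X in (_ * (_ * X))%N]ffact_small ?muln0 //.
by have := ltn_ord j; lia.
Qed.

(** For [c = d] the mirror row lies below the wall and vanishes at the upper columns, so each upper
    row equals its antisymmetric combination there. *)
Lemma corner_minor_refl_poly :
  corner_minor p d N * (\prod_(j < m) ((N - d + m' + j)`! * (d + (m.-1 - j))`!))%:R
  = \det (\matrix_(i < m, j < m) (refl_poly i).[(N - d + m' + j)%:R]).
Proof.
pose dg : 'rV[rat]_m := \row_j ((N - d + m' + j)`! * (d + (m.-1 - j))`!)%:R.
have -> : (\prod_(j < m) ((N - d + m' + j)`! * (d + (m.-1 - j))`!))%:R = \det (diag_mx dg).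
  by rewrite det_diag natr_prod; apply: eq_bigr => j _; rewrite mxE.
rewrite /corner_minor -/m -/m' -det_mulmx; congr (\det _); apply/matrixP => i j.
rewrite mul_mx_diag !mxE; have [im jm] := (ltn_ord i, ltn_ord j).
have bc : (N - d + d = N)%N by lia.
have ip : (m' + i < p)%N by rewrite /m /m' in im *; lia.
have jp : (m' + j < p)%N by rewrite /m /m' in jm *; lia.
have ip' : (m.-1 - i < p)%N by rewrite /m in im *; lia.
have sym : (p.-1 - (m' + i) = m.-1 - i)%N by rewrite /m /m' in im *; lia.
have symj : (p.-1 - (m' + j) = m.-1 - j)%N by rewrite /m /m' in jm *; lia.
have r1 := path_rows_poly p_gt0 dN bc ip jp; have r2 := path_rows_poly p_gt0 dN bc ip' jp.
rewrite path_rows_low // in r2; last by rewrite /m in im *; lia.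
rewrite npaths_low_zero // in r2; try (by rewrite /m /m' in im jm *; lia).
have := congr1 (fun f => f.[(N - d + (m' + j))%:R]) (row_poly_antisym p_gt0 dN ip).
rewrite /= !hornerD !hornerN sym -r1 -r2 mul0r subr0.
rewrite addnA => <-.
by rewrite symj.
Qed.

Lemma corner_minor_value :
  corner_minor p d N * (\prod_(j < m) ((N - d + m' + j)`! * (d + (m.-1 - j))`!))%:R * (triprod m (N + th))%:R
  = (\prod_(j < m) ((N + m' + j)`! * (m.-1 - j)`!))%:R * (triprod m (N - d.*2 + th))%:R.
Proof.
have [K hK] := det_refl_poly.
have h1 := hK N ltac:(lia); have h2 := hK (N - d)%N ltac:(lia).
have e1 : (N.*2 - N = N)%N by lia.
have e2 : ((N - d).*2 - N = N - d.*2)%N by lia.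
rewrite e1 in h1; rewrite e2 in h2.
by rewrite corner_minor_refl_poly h2 -det_refl_poly_top h1 mulrAC.
Qed.
End CornerValue.

End Evaluation.
Import Evaluation.

Definition ffprod k d n := \prod_(i < k) (n + i) ^_ d.
Definition factprod k n := \prod_(i < k) (n + i)`!.

(** * The product formula *)

Lemma hexd0 p b c : hexd p b c 0 = hex p b c.
Proof.
apply/all_filterP/allP => -[[i j] o]; rewrite mem_filter => /andP[h _].
apply/negP => /andP[_]; rewrite muln0; move: h; rewrite /in_hex; case: o; lia.
Qed.

Lemma root_value_ffprod p d n : d <= n -> (root_value p d n%:R = (ffprod (uphalf p) d n)%:R)%R.
Proof.
move=> dn; rewrite /root_value /ffprod natr_prod; apply: eq_bigr => i _.
rewrite ffact_prod natr_prod; apply: eq_bigr => l _; have := ltn_ord l => ld.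
by rewrite addrA -natrD natrB //; lia.
Qed.

Lemma factprod_rev k n : \prod_(j < k) (n + (k.-1 - j))`! = factprod k n.
Proof.
rewrite /factprod [RHS](reindex_inj rev_ord_inj); apply: eq_bigr => j _ /=.
by congr (_ + _)`!; have := ltn_ord j; lia.
Qed.

Section Count.
Variables p b c d : nat.
Hypothesis p_gt0 : 0 < p.
Hypothesis dN : d.*2 < b + c.
Hypothesis db : d <= b.
Hypothesis dc : d <= c.
Let N := b + c.
Let m := p./2.
Let m' := uphalf p.
Let th : nat := odd p.

Let corner_den n := factprod m (n - d + m') * factprod m d * triprod m (n + th).
Let corner_num n := factprod m (n + m') * factprod m 0 * triprod m (n - d.*2 + th).

Lemma corner_minor_nat n : d.*2 <= n -> (corner_minor p d n * (corner_den n)%:R = (corner_num n)%:R)%R.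
Proof.
move=> dn; have := corner_minor_value p_gt0 dn; rewrite -/m -/m' -/th !big_split /=.
have -> : \prod_(i < m) (m.-1 - i)`! = factprod m 0 by rewrite -factprod_rev.
rewrite -mulrA -!natrM => h; rewrite /corner_den /corner_num -(factprod_rev m d); exact: h.
Qed.

(** This is [det_poly_cross] between [b] and the corner [N - d], multiplied out. The minors of
    [det_corner] are the quotients [corner_num / corner_den] at [2 d] and at [N]. *)
Theorem M_hexd_product :
  M (hexd p b c d) * (factprod p b * factprod p c) * (ffprod m' d (N - d) * ffprod m' d d)
    * (corner_den d.*2 * corner_den N)
  = factprod p (N - d) * factprod p d * (ffprod m' d b * ffprod m' d c)
    * (corner_num d.*2 * corner_num N).
Proof.
have dN' : d.*2 <= N by apply: ltnW.
have MD : ((M (hexd p b c d))%:R = \det (\matrix_(i < p, j < p) (path_rows p N d b i j)%:R : 'M[rat]_p))%R.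
  rewrite M_hexd //; congr (\det _)%R; apply/matrixP => i j; rewrite !mxE /front_row /path_rows /start ltn0 subn0.
  by case: (is_tip p d 0 i).
have h1 := det_poly_horner p_gt0 dN' (erefl N : b + c = N)%N.
have h2 := det_poly_horner p_gt0 dN' (subnK (leq_trans (leq_addr _ _) (etrans (congr1 (leq^~ N) (addnn d)) dN')) : (N - d + d = N)%N).
have h3 := det_poly_cross p_gt0 dN' b%:R%R (N - d)%:R%R.
rewrite -h1 -h2 -MD (det_corner p_gt0 dN') !big_split /= in h3.
have e1 : (N%:R - (N - d)%:R = d%:R :> rat)%R by rewrite -natrB ?leq_subr // subKn //; lia.
have e2 : (N%:R - b%:R = c%:R :> rat)%R by rewrite /N natrD addrC addKr.
rewrite e1 e2 !root_value_ffprod // -?/m' in h3; last by rewrite /N; lia.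
have l1 := corner_minor_nat (leqnn d.*2); have l2 := corner_minor_nat dN'.
apply/eqP; rewrite -(eqr_nat rat); apply/eqP.
move: (corner_den d.*2) (corner_den N) (corner_num d.*2) (corner_num N) l1 l2 => D1 D2 N1 N2 l1 l2.
rewrite -/(factprod p b) -/(factprod p c) -/(factprod p (N - d)) -/(factprod p d) in h3.
rewrite !natrM -l1 -l2 in h3 *.
by rewrite h3; ring.
Qed.
End Count.

(** * Products of factorials in terms of superfactorials *)

Definition oddfactprod k e := \prod_(j < k) (e + j.*2.+1)`!.

Lemma fact_stdlib n : n`! = Factorial.fact n.
Proof. by elim: n => //= n IHn; rewrite factS IHn. Qed.

Lemma pow_stdlib k n : Nat.pow k n = k ^ n.
Proof. by elim: n => //= n ->; rewrite expnS. Qed.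

Lemma factprod_barnes k n : Nat.mul (factprod k n) (barnesG_succ n) = barnesG_succ (Nat.add n k).
Proof.
rewrite -[LHS]/(_ * _) -[Nat.add n k]/(n + k).
elim: k => [|k IHk]; first by rewrite /factprod big_ord0 addn0 mul1n.
rewrite addnS /= -IHk /factprod big_ord_recr /= -fact_stdlib; exact: mulnAC.
Qed.

Lemma ffprod_factprod k d n : (d <= n)%coq_nat ->
  Nat.mul (ffprod k d n) (factprod k (Nat.sub n d)) = factprod k n.
Proof.
move/ssrnat.leP=> dn; rewrite -[LHS]/(_ * _) -big_split; apply: eq_bigr => i _.
by rewrite /= addnBAC // ffact_fact //; lia.
Qed.

Lemma triprod_factprod k e : Nat.mul (triprod k e) (factprod k e) = oddfactprod k e.
Proof. exact: triprod_fact. Qed.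

Lemma oddfactprod_add k l e :
  Nat.mul (oddfactprod k e) (oddfactprod l (Nat.add (Nat.mul 2 k) e)) = oddfactprod (Nat.add k l) e.
Proof.
rewrite -[Nat.mul 2 k]/(2 * k) -[Nat.add (2 * k) e]/(2 * k + e) -[Nat.add k l]/(k + l).
rewrite /oddfactprod big_split_ord /= -[LHS]/(_ * _); congr (_ * _).
by apply: eq_bigr => i _; congr (_`!); lia.
Qed.

(** Since [(2 j + 1)!^2 (2 j + 2) = (2 j + 1)! (2 j + 2)!], both sides equal [1! 2! ... (2 n)!]. The
    square is the source of the halves in the asymptotic exponents. *)
Lemma oddfactprod_square n :
  (oddfactprod n 0 * oddfactprod n 0 * (Nat.pow 2 n * Factorial.fact n)
   = barnesG_succ (2 * n) * Factorial.fact (2 * n))%coq_nat.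
Proof.
rewrite !(multE, pow_stdlib) -!fact_stdlib mul2n.
elim: n => [|n IHn]; first by rewrite /oddfactprod big_ord0.
have -> : oddfactprod n.+1 0 = oddfactprod n 0 * (n.*2.+1)`! by rewrite /oddfactprod big_ord_recr.
have bS k : barnesG_succ k.+1 = barnesG_succ k * k`! by rewrite fact_stdlib.
rewrite doubleS !bS !factS expnS.
transitivity (oddfactprod n 0 * oddfactprod n 0 * (2 ^ n * n`!)
  * ((n.*2.+1 * (n.*2)`!) * (n.*2.+1 * (n.*2)`!) * (2 * n.+1))); first by ring.
rewrite IHn; have -> : 2 * n.+1 = n.*2.+2 by lia.
ring.
Qed.

Lemma oddfactprod_1 n :
  (oddfactprod n 1 = Nat.pow 2 n * Factorial.fact n * oddfactprod n 0)%coq_nat.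
Proof.
rewrite !(multE, pow_stdlib) -!fact_stdlib.
elim: n => [|n IHn]; first by rewrite /oddfactprod !big_ord0.
rewrite /oddfactprod !big_ord_recr /= -!/(oddfactprod _ _) IHn add0n add1n expnS !factS.
have -> : n.*2.+2 = 2 * n.+1 by lia.
ring.
Qed.

Lemma factprod_gt0 k n : (0 < factprod k n)%coq_nat.
Proof. by apply/ssrnat.ltP; apply: prodn_gt0 => i; apply: fact_gt0. Qed.
Lemma oddfactprod_gt0 k n : (0 < oddfactprod k n)%coq_nat.
Proof. by apply/ssrnat.ltP; apply: prodn_gt0 => i; apply: fact_gt0. Qed.
Lemma ffprod_gt0 k d n : (d <= n)%coq_nat -> (0 < ffprod k d n)%coq_nat.
Proof. by move=> dn; apply/ssrnat.ltP; apply: prodn_gt0 => i; rewrite ffact_gt0; lia. Qed.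
Lemma triprod_pos k e : (0 < triprod k e)%coq_nat.
Proof. exact/ssrnat.ltP/triprod_gt0. Qed.

(* The sides are [b = d + u], [c = d + v] and [b + c - 2 d = 2 w]. *)
Lemma M_product m th d u v w : (th <= 1 -> 0 < m -> 0 < w -> u + v = 2 * w ->
  M (hexd (2 * m + th) (d + u) (d + v) d)
    * (factprod (2 * m + th) (d + u) * factprod (2 * m + th) (d + v))
    * (ffprod (m + th) d (d + 2 * w) * ffprod (m + th) d d)
    * (factprod m (d + (m + th)) * factprod m d * triprod m (2 * d + th)
       * (factprod m (d + 2 * w + (m + th)) * factprod m d * triprod m (2 * (d + w) + th)))
  = factprod (2 * m + th) (d + 2 * w) * factprod (2 * m + th) d
    * (ffprod (m + th) d (d + u) * ffprod (m + th) d (d + v))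
    * (factprod m (2 * d + (m + th)) * factprod m 0 * triprod m (2 * 0 + th)
       * (factprod m (2 * (d + w) + (m + th)) * factprod m 0 * triprod m (2 * w + th))))%coq_nat.
Proof.
rewrite !(multE, plusE, minusE) => /ssrnat.leP th1 /ssrnat.ltP m0 /ssrnat.ltP w0 uv.
have p0 : 0 < 2 * m + th by lia.
have dN : d.*2 < (d + u) + (d + v) by lia.
have := M_hexd_product p0 dN (leq_addr _ _) (leq_addr _ _).
have -> : (2 * m + th)./2 = m by lia.
have -> : uphalf (2 * m + th) = m + th by lia.
have -> : odd (2 * m + th) = th :> nat by lia.
have -> : d + u + (d + v) - d = d + 2 * w by lia.
have -> : d + u + (d + v) - d.*2 = 2 * w by lia.
have -> : d + u + (d + v) = 2 * (d + w) by lia.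
have -> : d.*2 - d = d by lia.
by rewrite subnn muln0 -mul2n.
Qed.

End LozengeTilings.

From Stdlib Require Import Reals Lra Lia Arith.
From Coquelicot Require Import Coquelicot.
Import LozengeTilings LozengeTilings.Evaluation.
Local Open Scope R_scope.

(** * Stirling's formula and the Glaisher-Kinkelin constant *)

(** From [n0] on [u + v] decreases, [u - v] increases, and they share a limit. The resulting error
    bound is what allows a second summation in [barnes_gap_lim]. *)
Lemma telescoping_convergence (u v : nat -> R) (n0 : nat) :
  is_lim_seq v 0 ->
  (forall n, (n0 <= n)%nat -> Rabs (u (S n) - u n) <= v n - v (S n)) ->
  exists l : R, is_lim_seq u l /\ forall n, (n0 <= n)%nat -> Rabs (u n - l) <= v n.
Proof.
  intros Hv Hu.
  assert (Hvd : forall k, v (n0 + S k)%nat <= v (n0 + k)%nat).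
  { intros k. generalize (Hu (n0 + k)%nat ltac:(lia)) (Rabs_pos (u (S (n0 + k)) - u (n0 + k)%nat)).
    replace (n0 + S k)%nat with (S (n0 + k)) by lia. lra. }
  assert (Hvlim : is_lim_seq (fun k => v (n0 + k)%nat) 0).
  { apply is_lim_seq_ext with (fun k => v (k + n0)%nat).
    - intros k. f_equal. lia.
    - now apply is_lim_seq_incr_n with (u := v). }
  assert (Hvpos : forall k, 0 <= v (n0 + k)%nat).
  { intros k. generalize (is_lim_seq_decr_compare _ _ Hvlim Hvd k). simpl. lra. }
  set (w1 := fun k => u (n0 + k)%nat + v (n0 + k)%nat).
  set (w2 := fun k => u (n0 + k)%nat - v (n0 + k)%nat).
  assert (Hw1 : forall k, w1 (S k) <= w1 k).
  { intros k. unfold w1. generalize (Hu (n0 + k)%nat ltac:(lia)).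
    replace (n0 + S k)%nat with (S (n0 + k)) by lia. intros H.
    apply Rabs_le_between in H. lra. }
  assert (Hw2 : forall k, w2 k <= w2 (S k)).
  { intros k. unfold w2. generalize (Hu (n0 + k)%nat ltac:(lia)).
    replace (n0 + S k)%nat with (S (n0 + k)) by lia. intros H.
    apply Rabs_le_between in H. lra. }
  assert (Hw20 : forall k, w2 0%nat <= w2 k).
  { induction k; [lra|]. generalize (Hw2 k). lra. }
  destruct (ex_finite_lim_seq_decr w1 (w2 0%nat)) as [l Hl].
  - exact Hw1.
  - intros k. generalize (Hw20 k) (Hvpos k). unfold w1, w2. lra.
  - assert (Hul : is_lim_seq (fun k => u (n0 + k)%nat) l).
    { apply is_lim_seq_ext with (fun k => w1 k - v (n0 + k)%nat).
      - intros k. unfold w1. ring.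
      - replace (Finite l) with (Finite (l - 0)) by (f_equal; ring).
        apply is_lim_seq_minus'; assumption. }
    assert (Hl2 : is_lim_seq w2 l).
    { unfold w2. replace (Finite l) with (Finite (l - 0)) by (f_equal; ring).
      apply is_lim_seq_minus'; assumption. }
    exists l. split.
    + apply is_lim_seq_incr_n with (N := n0).
      apply is_lim_seq_ext with (fun k => u (n0 + k)%nat); [intros k; f_equal; lia | exact Hul].
    + intros n Hn. generalize (is_lim_seq_decr_compare _ _ Hl Hw1 (n - n0)%nat)
        (is_lim_seq_incr_compare _ _ Hl2 Hw2 (n - n0)%nat).
      unfold w1, w2. replace (n0 + (n - n0))%nat with n by lia. intros H1 H2.
      apply Rabs_le_between. lra.
Qed.

(** Four terms are kept because [barnes_gap_second_difference] multiplies the remainder at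
    [y = 1 / x] and [y = - 1 / x] by about [x ^ 2 / 2] and still needs an error of order
    [x ^ (-3)]. *)
Definition ln_rem (y : R) : R := ln (1 + y) - (y - y ^ 2 / 2 + y ^ 3 / 3 - y ^ 4 / 4).

Lemma ln_rem_bound (y : R) : Rabs y <= / 2 -> Rabs (ln_rem y) <= 2 * Rabs y ^ 5.
Proof.
  intros Hy.
  assert (Hz : forall z, Rabs z <= Rabs y -> - / 2 <= z <= / 2).
  { intros z Hz. apply Rabs_le_between. lra. }
  (* The derivative of [ln_rem] is the tail [z ^ 4 / (1 + z)] of the geometric series. *)
  destruct (MVT_gen ln_rem 0 y (fun z => z ^ 4 / (1 + z))) as [z [Hz1 Hz2]].
  - intros z Hz1.
    assert (- / 2 <= z <= / 2).
    { apply Hz. apply Rabs_le_between in Hy.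
      unfold Rmin, Rmax in Hz1. destruct (Rle_dec 0 y); apply Rabs_le_between;
        [rewrite (Rabs_pos_eq y) | rewrite (Rabs_left1 y)]; lra. }
    unfold ln_rem. auto_derive; [lra|]. field. lra.
  - intros z Hz1. apply continuity_pt_filterlim.
    assert (- / 2 <= z <= / 2).
    { apply Hz. unfold Rmin, Rmax in Hz1. destruct (Rle_dec 0 y); apply Rabs_le_between;
        [rewrite (Rabs_pos_eq y) | rewrite (Rabs_left1 y)]; lra. }
    apply (ex_derive_continuous ln_rem). unfold ln_rem. auto_derive. lra.
  - replace (ln_rem 0) with 0 in Hz2 by (unfold ln_rem; rewrite Rplus_0_r, ln_1; field).
    rewrite !Rminus_0_r in Hz2. rewrite Hz2, Rabs_mult.
    assert (Hzy : Rabs z <= Rabs y).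
    { unfold Rmin, Rmax in Hz1. destruct (Rle_dec 0 y); apply Rabs_le_between;
        [rewrite (Rabs_pos_eq y) | rewrite (Rabs_left1 y)]; lra. }
    generalize (Hz z Hzy); intros Hz3.
    assert (Hq : Rabs (z ^ 4 / (1 + z)) <= 2 * Rabs y ^ 4).
    { unfold Rdiv. rewrite Rabs_mult, <- RPow_abs, (Rabs_pos_eq (/ (1 + z)));
        [|left; apply Rinv_0_lt_compat; lra].
      assert (/ (1 + z) <= 2).
      { replace 2 with (/ / 2) by field. apply Rinv_le_contravar; lra. }
      assert (Rabs z ^ 4 <= Rabs y ^ 4) by (apply pow_incr; split; [apply Rabs_pos | exact Hzy]).
      assert (0 <= Rabs z ^ 4) by (apply pow_le, Rabs_pos).
      assert (0 < / (1 + z)) by (apply Rinv_0_lt_compat; lra).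
      nra. }
    replace (2 * Rabs y ^ 5) with (2 * Rabs y ^ 4 * Rabs y) by ring.
    apply Rmult_le_compat_r; [apply Rabs_pos | exact Hq].
Qed.

(** * Wallis integrals *)

Definition wallis (n : nat) : R := RInt (fun x => sin x ^ n) 0 (PI / 2).

Lemma ex_RInt_sin_pow (n : nat) (a b : R) : ex_RInt (fun x => sin x ^ n) a b.
Proof.
  apply (ex_RInt_continuous (V := R_CompleteNormedModule)). intros z _. apply (ex_derive_continuous (fun x => sin x ^ n)).
  auto_derive. exact I.
Qed.

Lemma wallis_0 : wallis 0 = PI / 2.
Proof.
  unfold wallis. simpl. rewrite RInt_const. unfold scal; simpl; unfold mult; simpl. ring.
Qed.

Lemma wallis_1 : wallis 1 = 1.
Proof.
  unfold wallis. apply is_RInt_unique.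
  replace 1 with (minus (- cos (PI / 2)) (- cos 0))
    by (rewrite cos_PI2, cos_0; unfold minus, plus, opp; simpl; ring).
  apply (is_RInt_derive (fun x => - cos x)).
  - intros x _. auto_derive; [exact I | ring].
  - intros x _. apply (ex_derive_continuous (fun x => sin x ^ 1)). auto_derive. exact I.
Qed.

(* [- cos * sin^(n+1)] is an antiderivative of [(n+2) sin^(n+2) - (n+1) sin^n]. *)
Lemma wallis_rec (n : nat) : INR (n + 2) * wallis (S (S n)) = INR (n + 1) * wallis n.
Proof.
  assert (H : is_RInt (fun x => INR (n + 2) * sin x ^ (S (S n)) - INR (n + 1) * sin x ^ n)
                0 (PI / 2) 0).
  { replace 0 with (minus (- cos (PI / 2) * sin (PI / 2) ^ S n) (- cos 0 * sin 0 ^ S n)) at 2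
      by (rewrite cos_PI2, sin_0; unfold minus, plus, opp; simpl; ring).
    apply (is_RInt_derive (fun x => - cos x * sin x ^ S n)).
    - intros x _. auto_derive; [exact I|].
      assert (Hc : cos x * cos x = 1 - sin x ^ 2).
      { generalize (sin2_cos2 x). unfold Rsqr. simpl. lra. }
      change (match n with 0%nat => 1 | S _ => INR n + 1 end) with (INR (S n)).
      transitivity (sin x * sin x ^ S n - INR (S n) * (cos x * cos x) * sin x ^ n);
        [simpl pow; ring|].
      rewrite Hc, !plus_INR, S_INR. simpl. ring.
    - intros x _.
      apply (ex_derive_continuous (fun x => INR (n + 2) * sin x ^ (S (S n)) - INR (n + 1) * sin x ^ n)).
      auto_derive. easy. }
  assert (H' : is_RInt (fun x => INR (n + 2) * sin x ^ (S (S n)) - INR (n + 1) * sin x ^ n)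
                0 (PI / 2) (INR (n + 2) * wallis (S (S n)) - INR (n + 1) * wallis n)).
  { apply (is_RInt_minus (V := R_NormedModule)); apply (is_RInt_scal (V := R_NormedModule));
      apply (RInt_correct (V := R_CompleteNormedModule)), ex_RInt_sin_pow. }
  generalize (is_RInt_unique _ _ _ _ H) (is_RInt_unique _ _ _ _ H'). intros E1 E2.
  rewrite E1 in E2. lra.
Qed.

Lemma wallis_decr (n : nat) : wallis (S n) <= wallis n.
Proof.
  assert (Hpi := PI_RGT_0).
  apply RInt_le; try apply ex_RInt_sin_pow; [lra|].
  intros x Hx. simpl.
  assert (0 <= sin x) by (apply sin_ge_0; lra).
  assert (sin x <= 1) by apply SIN_bound.
  assert (0 <= sin x ^ n) by (apply pow_le; assumption).
  nra.
Qed.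

Definition lfact (n : nat) : R := ln (INR (Factorial.fact n)).

Lemma lfact_S (n : nat) : lfact (S n) = lfact n + ln (INR (S n)).
Proof.
  unfold lfact. change (Factorial.fact (S n)) with (S n * Factorial.fact n)%nat.
  rewrite mult_INR, ln_mult; [ring | apply lt_0_INR; lia | apply INR_fact_lt_0].
Qed.

(* Logarithm of [binomial(2n, n) / 4^n]. *)
Definition lcentral (n : nat) : R := lfact (2 * n) - 2 * lfact n - 2 * INR n * ln 2.

Lemma lcentral_S (n : nat) :
  lcentral (S n) = lcentral n + ln (INR (2 * n + 1) / INR (2 * n + 2)).
Proof.
  unfold lcentral.
  replace (2 * S n)%nat with (S (S (2 * n))) by lia.
  rewrite !lfact_S.
  assert (H1 : 0 < INR (2 * n + 1)) by (apply lt_0_INR; lia).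
  assert (H2 : 0 < INR (n + 1)) by (apply lt_0_INR; lia).
  replace (S (2 * n)) with (2 * n + 1)%nat by lia.
  replace (S (2 * n + 1)) with (2 * (n + 1))%nat by lia.
  replace (2 * n + 2)%nat with (2 * (n + 1))%nat by lia.
  replace (S n) with (n + 1)%nat by lia.
  rewrite (mult_INR 2 (n + 1)). replace (INR 2) with 2 by (simpl; ring).
  rewrite ln_div, !ln_mult; try lra. rewrite !(plus_INR n 1). simpl (INR 1). ring.
Qed.

Lemma wallis_even (n : nat) : wallis (2 * n) = PI / 2 * exp (lcentral n).
Proof.
  induction n as [|n IHn].
  - rewrite Nat.mul_0_r, wallis_0. unfold lcentral, lfact. simpl. rewrite ln_1.
    replace (0 - 2 * 0 - 2 * 0 * ln 2) with 0 by ring. rewrite exp_0. ring.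
  - replace (2 * S n)%nat with (S (S (2 * n))) by lia.
    generalize (wallis_rec (2 * n)). rewrite IHn, lcentral_S, exp_plus, exp_ln.
    + assert (H : 0 < INR (2 * n + 2)) by (apply lt_0_INR; lia). intros E.
      apply Rmult_eq_reg_l with (INR (2 * n + 2)); [|lra]. rewrite E. field. lra.
    + apply Rdiv_lt_0_compat; apply lt_0_INR; lia.
Qed.

Lemma wallis_odd (n : nat) : wallis (2 * n + 1) = exp (- lcentral n) / INR (2 * n + 1).
Proof.
  induction n as [|n IHn].
  - simpl (2 * 0 + 1)%nat. rewrite wallis_1. unfold lcentral, lfact. simpl. rewrite ln_1.
    replace (- (0 - 2 * 0 - 2 * 0 * ln 2)) with 0 by ring. rewrite exp_0. field.
  - replace (2 * S n + 1)%nat with (S (S (2 * n + 1))) by lia.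
    generalize (wallis_rec (2 * n + 1)).
    replace (2 * n + 1 + 2)%nat with (S (S (2 * n + 1))) by lia.
    replace (2 * n + 1 + 1)%nat with (2 * n + 2)%nat by lia.
    assert (H3 : 0 < INR (S (S (2 * n + 1)))) by (apply lt_0_INR; lia).
    assert (H2 : 0 < INR (2 * n + 2)) by (apply lt_0_INR; lia).
    assert (H1 : 0 < INR (2 * n + 1)) by (apply lt_0_INR; lia).
    rewrite IHn, lcentral_S, Ropp_plus_distr, exp_plus, <- ln_Rinv, exp_ln.
    + intros E. apply Rmult_eq_reg_l with (INR (S (S (2 * n + 1)))); [|lra]. rewrite E. field. lra.
    + apply Rinv_0_lt_compat, Rdiv_lt_0_compat; assumption.
    + apply Rdiv_lt_0_compat; assumption.
Qed.

(** The two bounds are the logarithms of [wallis (2 n + 1) <= wallis (2 n)] and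
    [wallis (2 n + 2) <= wallis (2 n + 1)]. *)
Lemma lcentral_bounds (n : nat) :
  - ln (PI / 2) - ln (INR (2 * n + 2)) <= 2 * lcentral n <= - ln (PI / 2) - ln (INR (2 * n + 1)) + ln (INR (2 * n + 2) / INR (2 * n + 1)).
Proof.
  assert (Hpi : 0 < PI / 2) by (generalize PI_RGT_0; lra).
  assert (H2 : 0 < INR (2 * n + 2)) by (apply lt_0_INR; lia).
  assert (H1 : 0 < INR (2 * n + 1)) by (apply lt_0_INR; lia).
  assert (L : forall x y, exp x <= exp y -> x <= y).
  { intros x y [H|H]; [left; now apply exp_lt_inv | right; now apply exp_inv]. }
  split.
  - generalize (wallis_decr (2 * n)). replace (S (2 * n)) with (2 * n + 1)%nat by lia.
    rewrite wallis_even, wallis_odd. intros H.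
    assert (H' : exp (- lcentral n - ln (INR (2 * n + 1))) <= exp (ln (PI / 2) + lcentral n)).
    { unfold Rminus at 1. rewrite !exp_plus, <- ln_Rinv, !exp_ln; try assumption.
      apply Rinv_0_lt_compat; assumption. }
    apply L in H'. assert (ln (INR (2 * n + 1)) <= ln (INR (2 * n + 2))).
    { apply ln_le; [assumption|]. apply le_INR. lia. }
    lra.
  - generalize (wallis_decr (2 * n + 1)). replace (S (2 * n + 1)) with (2 * S n)%nat by lia.
    rewrite wallis_even, wallis_odd, lcentral_S. intros H.
    assert (H' : exp (ln (PI / 2) + (lcentral n + ln (INR (2 * n + 1) / INR (2 * n + 2))))
                 <= exp (- lcentral n - ln (INR (2 * n + 1)))).
    { unfold Rminus at 1. rewrite (exp_plus (ln (PI / 2))), (exp_plus (- lcentral n)), <- ln_Rinv, (exp_ln (PI / 2)), (exp_ln (/ _)); try assumption.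
      apply Rinv_0_lt_compat; assumption. }
    apply L in H'. rewrite (ln_div (INR _)) in H' by assumption.
    rewrite (ln_div (INR _)) by assumption. lra.
Qed.

Lemma is_lim_seq_inv_pow (C : R) (k : nat) : is_lim_seq (fun n => C / INR n ^ S k) 0.
Proof.
  replace 0 with (C * 0 ^ S k) by (simpl; ring).
  apply is_lim_seq_ext_loc with (fun n => C * (/ INR n) ^ S k).
  - exists 1%nat. intros n Hn. rewrite pow_inv. reflexivity.
  - apply (is_lim_seq_scal_l _ C (0 ^ S k)).
    apply is_lim_seq_continuous with (f := fun x => x ^ S k).
    + apply derivable_continuous_pt, derivable_pt_pow.
    + replace (Finite 0) with (Rbar_inv p_infty) by reflexivity.
      apply is_lim_seq_inv; [apply is_lim_seq_INR | discriminate].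
Qed.

Lemma is_lim_seq_of_bound (u v : nat -> R) (l : R) (n0 : nat) :
  is_lim_seq v 0 -> (forall n, (n0 <= n)%nat -> Rabs (u n - l) <= v n) -> is_lim_seq u l.
Proof.
  intros Hv H. apply is_lim_seq_le_le_loc with (fun n => l - v n) (fun n => l + v n).
  - exists n0. intros n Hn. generalize (H n Hn). intros H'. apply Rabs_le_between in H'. lra.
  - replace (Finite l) with (Finite (l - 0)) by (f_equal; ring).
    apply is_lim_seq_minus'; [apply is_lim_seq_const | exact Hv].
  - replace (Finite l) with (Finite (l + 0)) by (f_equal; ring).
    apply is_lim_seq_plus'; [apply is_lim_seq_const | exact Hv].
Qed.

Lemma ln_succ (n : nat) : (0 < n)%nat -> ln (INR (S n)) = ln (INR n) + ln (1 + / INR n).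
Proof.
  intros Hn. assert (0 < INR n) by (apply lt_0_INR; lia).
  assert (0 < / INR n) by (apply Rinv_0_lt_compat; assumption).
  rewrite <- ln_mult; [|lra|lra]. f_equal. rewrite S_INR. field. lra.
Qed.

Lemma inv_INR_bounds (n : nat) : (2 <= n)%nat -> 0 < / INR n <= / 2.
Proof.
  intros Hn. assert (2 <= INR n) by (apply (le_INR 2); lia).
  split; [apply Rinv_0_lt_compat; lra | apply Rinv_le_contravar; lra].
Qed.

Lemma ln_1p_expand (y : R) : - / 2 <= y <= / 2 -> exists r,
  ln (1 + y) = y - y ^ 2 / 2 + y ^ 3 / 3 - y ^ 4 / 4 + r /\ Rabs r <= 2 * Rabs y ^ 5.
Proof.
  intros Hy. exists (ln_rem y). split; [unfold ln_rem; ring|].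
  apply ln_rem_bound, Rabs_le_between. exact Hy.
Qed.

Definition stirling_main (x : R) : R := x * ln x - x + ln (2 * PI) / 2 + ln x / 2.

Lemma stirling_constant_exists : exists l : R,
  is_lim_seq (fun n => lfact n - (INR n + / 2) * ln (INR n) + INR n) l.
Proof.
  destruct (telescoping_convergence
    (fun n => lfact n - (INR n + / 2) * ln (INR n) + INR n) (fun n => 4 / INR n ^ 1) 2)
    as [l [Hl _]].
  - apply is_lim_seq_inv_pow.
  - intros n Hn. rewrite lfact_S, ln_succ, S_INR by lia.
    generalize (inv_INR_bounds n Hn). intros He.
    assert (Hn2 : 2 <= INR n) by (apply (le_INR 2); lia).
    destruct (ln_1p_expand (/ INR n)) as [r [-> Hr]]; [lra|].
    rewrite (Rabs_pos_eq (/ INR n)) in Hr by lra.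
    set (x := INR n) in *. set (e := / x) in *.
    assert (Hxe : x = / e) by (unfold e; field; lra).
    assert (Hx1 : x * e = 1) by (unfold e; field; lra).
    replace (_ - _) with (- (e ^ 2 / 12 - e ^ 3 / 12 - e ^ 4 / 8 + (x + / 2) * r)) by (rewrite Hxe; field; lra).
    replace (4 / x ^ 1 - 4 / (x + 1) ^ 1) with (4 * e ^ 2 / (1 + e)) by (rewrite Hxe; field; lra).
    rewrite Rabs_Ropp.
    assert (H1 : Rabs ((x + / 2) * r) <= 3 * e ^ 4).
    { rewrite Rabs_mult, (Rabs_pos_eq (x + / 2)) by lra.
      apply Rle_trans with ((x + / 2) * (2 * e ^ 5)).
      - apply Rmult_le_compat_l; lra.
      - replace ((x + / 2) * (2 * e ^ 5)) with ((x * e) * 2 * e ^ 4 + e * e ^ 4) by field.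
        rewrite Hx1. assert (0 <= e ^ 4) by (apply pow_le; lra). nra. }
    apply Rabs_le_between in H1.
    assert (H2 : 2 * e ^ 2 <= 4 * e ^ 2 / (1 + e)).
    { apply Rmult_le_reg_r with (1 + e); [lra|].
      replace (4 * e ^ 2 / (1 + e) * (1 + e)) with (4 * e ^ 2) by (field; lra).
      assert (0 <= e ^ 2) by (apply pow_le; lra). nra. }
    assert (H3 : 0 <= e ^ 3 <= e ^ 2) by (simpl; split; nra).
    assert (H4 : 0 <= e ^ 4 <= e ^ 2 / 4) by (simpl; split; nra).
    apply Rabs_le_between. lra.
  - exists l. exact Hl.
Qed.

(** The constant [l] is read off from the central binomial coefficient: [2 lcentral n + ln n] tends
    to [- ln PI] by Wallis and to [- 2 l + ln 2] by the definition of [l], whence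
    [l = ln (2 PI) / 2]. *)
Lemma stirling : is_lim_seq (fun n => lfact n - stirling_main (INR n)) 0.
Proof.
  destruct stirling_constant_exists as [l Hl].
  set (u := fun n => lfact n - (INR n + / 2) * ln (INR n) + INR n) in Hl.
  assert (Hpi := PI_RGT_0).
  assert (H1 : is_lim_seq (fun n => 2 * lcentral n + ln (INR n)) (- ln PI)).
  { apply is_lim_seq_of_bound with (v := fun n => 1 / INR n ^ 1) (n0 := 1%nat).
    - apply is_lim_seq_inv_pow.
    - intros n Hn. generalize (lcentral_bounds n). intros Hb.
      assert (Hn1 : 1 <= INR n) by (apply (le_INR 1); lia).
      assert (H0 : 0 < / INR n) by (apply Rinv_0_lt_compat; lra).
      assert (E2 : ln (INR (2 * n + 2)) = ln 2 + ln (INR n) + ln (1 + / INR n)).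
      { replace (2 * n + 2)%nat with (2 * S n)%nat by lia. rewrite mult_INR, ln_mult;
          [|simpl; lra | apply lt_0_INR; lia].
        rewrite (ln_succ n) by lia. replace (INR 2) with 2 by (simpl; ring). ring. }
      assert (E1 : ln 2 + ln (INR n) <= ln (INR (2 * n + 1))).
      { rewrite <- ln_mult by lra. apply ln_le; [lra|].
        rewrite plus_INR, mult_INR. simpl (INR 2). simpl (INR 1). lra. }
      rewrite (ln_div (INR _)) in Hb by (apply lt_0_INR; lia).
      rewrite ln_div in Hb by lra.
      assert (Hle : ln (1 + / INR n) <= / INR n).
      { generalize (exp_ineq1_le (/ INR n)). intros He.
        rewrite <- (ln_exp (/ INR n)) at 2. apply ln_le; lra. }
      replace (1 / INR n ^ 1) with (/ INR n) by (field; lra).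
      apply Rabs_le_between. lra. }
  assert (H2 : is_lim_seq (fun n => u (2 * n)%nat) l).
  { apply (is_lim_seq_subseq u l (fun n => (2 * n)%nat)); [|exact Hl].
    apply eventually_subseq. intros n. lia. }
  assert (H3 : is_lim_seq (fun n => 2 * lcentral n + ln (INR n)) (2 * (l - 2 * l) + ln 2)).
  { apply is_lim_seq_ext_loc with (fun n => 2 * (u (2 * n)%nat - 2 * u n) + ln 2).
    - exists 1%nat. intros n Hn. unfold u, lcentral.
      assert (Hn1 : 1 <= INR n) by (apply (le_INR 1); lia).
      rewrite (mult_INR 2 n). replace (INR 2) with 2 by (simpl; ring).
      rewrite ln_mult by lra. field.
    - apply is_lim_seq_plus'; [|apply is_lim_seq_const].
      apply (is_lim_seq_scal_l _ 2 (l - 2 * l)). apply is_lim_seq_minus'; [exact H2|].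
      apply (is_lim_seq_scal_l _ 2 l). exact Hl. }
  assert (E : 2 * (l - 2 * l) + ln 2 = - ln PI).
  { apply is_lim_seq_unique in H1. apply is_lim_seq_unique in H3. rewrite H1 in H3.
    injection H3. lra. }
  apply is_lim_seq_ext_loc with (fun n => u n - l).
  - exists 1%nat. intros n Hn. unfold u, stirling_main. rewrite (ln_mult 2 PI) by lra. lra.
  - replace (Finite 0) with (Finite (l - l)) by (f_equal; ring).
    apply is_lim_seq_minus'; [exact Hl | apply is_lim_seq_const].
Qed.

(** * Superfactorials *)

Definition lbarnes (n : nat) : R := ln (INR (barnesG_succ n)).

Lemma barnesG_succ_pos (n : nat) : (0 < barnesG_succ n)%nat.
Proof.
  induction n as [|n IHn]; simpl; [lia|].
  apply Nat.mul_pos_pos; [exact IHn | apply Factorial.lt_O_fact].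
Qed.

Lemma lbarnes_S (n : nat) : lbarnes (S n) = lbarnes n + lfact n.
Proof.
  unfold lbarnes, lfact. simpl barnesG_succ.
  rewrite mult_INR, ln_mult; [reflexivity | | apply INR_fact_lt_0].
  apply lt_0_INR, barnesG_succ_pos.
Qed.

Definition barnes_main0 (x : R) : R :=
  x / 2 * ln (2 * PI) + (x ^ 2 / 2 - 1 / 12) * ln x - 3 / 4 * x ^ 2 + 1 / 12.

Definition barnes_gap (n : nat) : R := barnes_main0 (INR n) - lbarnes n.

(** Two differences reduce [lbarnes] to the single logarithm [ln (n + 1)], so a Taylor expansion
    around [n + 1] suffices; the resulting order [n ^ (-3)] can be summed twice. *)
Lemma barnes_gap_second_difference (n : nat) : (2 <= n)%nat ->
  Rabs ((barnes_gap (S (S n)) - barnes_gap (S n)) - (barnes_gap (S n) - barnes_gap n))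
  <= 5 / INR n ^ 2 - 5 / INR (S n) ^ 2.
Proof.
  intros Hn. unfold barnes_gap. rewrite !lbarnes_S, lfact_S.
  assert (Hn2 : 2 <= INR n) by (apply (le_INR 2); lia).
  set (x := INR (S n)).
  assert (Ex : INR n = x - 1) by (unfold x; rewrite S_INR; ring).
  assert (Ex2 : INR (S (S n)) = x + 1) by (unfold x; rewrite (S_INR (S n)); ring).
  rewrite Ex, Ex2. assert (Hx : 3 <= x) by lra.
  set (e := / x). assert (He : 0 < e) by (apply Rinv_0_lt_compat; lra).
  assert (He3 : e <= / 2) by (apply Rinv_le_contravar; lra).
  assert (Hxe : x = / e) by (unfold e; field; lra).
  assert (Hx1 : x * e = 1) by (unfold e; field; lra).
  assert (L1 : ln (x + 1) = ln x + ln (1 + e)).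
  { rewrite <- ln_mult by lra. f_equal. unfold e. field. lra. }
  assert (L2 : ln (x - 1) = ln x + ln (1 + - e)).
  { rewrite <- ln_mult by lra. f_equal. unfold e. field. lra. }
  unfold barnes_main0. rewrite L1, L2.
  destruct (ln_1p_expand e) as [r [-> Hr]]; [lra|].
  destruct (ln_1p_expand (- e)) as [q [-> Hq]]; [lra|].
  rewrite Rabs_Ropp in Hq. rewrite (Rabs_pos_eq e) in Hr, Hq by lra.
  replace (_ - _) with (- (5 / 24) * e ^ 4 + ((x + 1) ^ 2 / 2 - 1 / 12) * r + ((x - 1) ^ 2 / 2 - 1 / 12) * q)
    by (rewrite Hxe; field; lra).
  assert (P4 : 0 <= e ^ 4) by (apply pow_le; lra).
  assert (P3 : 0 <= e ^ 3) by (apply pow_le; lra).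
  assert (P5 : 0 <= e ^ 5) by (apply pow_le; lra).
  assert (Q4 : e ^ 4 <= e ^ 3 / 2) by (replace (e ^ 4) with (e ^ 3 * e) by ring; nra).
  assert (R5 : x ^ 2 * e ^ 5 = e ^ 3).
  { replace (x ^ 2 * e ^ 5) with ((x * e) ^ 2 * e ^ 3) by ring. rewrite Hx1. ring. }
  assert (Hb : forall t y, Rabs t <= 2 * e ^ 5 -> 0 <= y <= x ^ 2 -> Rabs (y * t) <= 2 * e ^ 3).
  { intros t y Ht Hy. rewrite Rabs_mult, (Rabs_pos_eq y) by lra.
    apply Rle_trans with (x ^ 2 * (2 * e ^ 5)); [|lra].
    apply Rmult_le_compat; [lra | apply Rabs_pos | lra | exact Ht]. }
  assert (B1 := Hb r ((x + 1) ^ 2 / 2 - 1 / 12) Hr ltac:(simpl; nra)).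
  assert (B2 := Hb q ((x - 1) ^ 2 / 2 - 1 / 12) Hq ltac:(simpl; nra)).
  apply Rabs_le_between in B1. apply Rabs_le_between in B2.
  assert (T : 5 * e ^ 3 <= 5 / (x - 1) ^ 2 - 5 / x ^ 2).
  { replace (5 / (x - 1) ^ 2 - 5 / x ^ 2) with (5 * e ^ 3 * (x * (2 * x - 1) / (x - 1) ^ 2))
      by (unfold e; field; lra).
    assert (1 <= x * (2 * x - 1) / (x - 1) ^ 2).
    { apply Rmult_le_reg_r with ((x - 1) ^ 2); [simpl; nra|].
      replace (x * (2 * x - 1) / (x - 1) ^ 2 * (x - 1) ^ 2) with (x * (2 * x - 1)) by (field; lra).
      simpl; nra. }
    nra. }
  apply Rabs_le_between. lra.
Qed.

(** Second differences leave a linear term in the gap undetermined; Stirling's formula shows that it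
    is absent. *)
Lemma barnes_gap_difference_lim : is_lim_seq (fun n => barnes_gap (S n) - barnes_gap n) 0.
Proof.
  apply is_lim_seq_ext_loc with (fun n =>
    (((INR n + 1) ^ 2 / 2 - 1 / 12) * ln (1 + / INR n) - INR n / 2 - 3 / 4)
    - (lfact n - stirling_main (INR n))).
  - exists 1%nat. intros n Hn. unfold barnes_gap, barnes_main0, stirling_main.
    rewrite lbarnes_S, ln_succ, S_INR by lia. field.
  - replace (Finite 0) with (Finite (0 - 0)) by (f_equal; ring).
    apply is_lim_seq_minus'; [|exact stirling].
    apply is_lim_seq_of_bound with (v := fun n => 10 / INR n ^ 1) (n0 := 2%nat);
      [apply is_lim_seq_inv_pow|].
    intros n Hn. generalize (inv_INR_bounds n Hn). intros He.
    assert (Hn2 : 2 <= INR n) by (apply (le_INR 2); lia).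
    destruct (ln_1p_expand (/ INR n)) as [r [-> Hr]]; [lra|].
    rewrite (Rabs_pos_eq (/ INR n)) in Hr by lra.
    set (x := INR n) in *. set (e := / x) in *.
    assert (Hxe : x = / e) by (unfold e; field; lra).
    assert (Hx1 : x * e = 1) by (unfold e; field; lra).
    replace (_ - 0) with (e / 12 - e ^ 3 / 9 - 5 * e ^ 4 / 48 + ((x + 1) ^ 2 / 2 - 1 / 12) * r)
      by (rewrite Hxe; field; lra).
    replace (10 / x ^ 1) with (10 * e) by (unfold e; field; lra).
    assert (P5 : 0 <= e ^ 5) by (apply pow_le; lra).
    assert (P3 : 0 <= e ^ 3 <= e) by (simpl; split; nra).
    assert (P4 : 0 <= e ^ 4 <= e) by (simpl; split; nra).
    assert (R5 : x ^ 2 * e ^ 5 = e ^ 3).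
    { replace (x ^ 2 * e ^ 5) with ((x * e) ^ 2 * e ^ 3) by ring. rewrite Hx1. ring. }
    assert (B : Rabs (((x + 1) ^ 2 / 2 - 1 / 12) * r) <= 4 * e ^ 3).
    { assert (Hc : 0 <= (x + 1) ^ 2 / 2 - 1 / 12 <= 2 * x ^ 2) by (simpl; split; nra).
      rewrite Rabs_mult, (Rabs_pos_eq (_ - _)) by lra.
      apply Rle_trans with (2 * x ^ 2 * (2 * e ^ 5)); [|lra].
      apply Rmult_le_compat; [lra | apply Rabs_pos | lra | exact Hr]. }
    apply Rabs_le_between in B. apply Rabs_le_between. lra.
Qed.

Lemma barnes_gap_lim : exists l : R, is_lim_seq barnes_gap l.
Proof.
  destruct (telescoping_convergence (fun n => barnes_gap (S n) - barnes_gap n)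
    (fun n => 5 / INR n ^ 2) 2) as [l [Hl Hb]].
  - apply is_lim_seq_inv_pow.
  - apply barnes_gap_second_difference.
  - assert (El : l = 0).
    { generalize (is_lim_seq_unique _ _ Hl) (is_lim_seq_unique _ _ barnes_gap_difference_lim).
      intros E1 E2. rewrite E1 in E2. injection E2. easy. }
    subst l. destruct (telescoping_convergence barnes_gap (fun n => 10 / INR n ^ 1) 2) as [k [Hk _]].
    + apply is_lim_seq_inv_pow.
    + intros n Hn. generalize (Hb n Hn). rewrite Rminus_0_r. intros H.
      apply Rle_trans with (1 := H).
      assert (Hn2 : 2 <= INR n) by (apply (le_INR 2); lia).
      rewrite S_INR.
      replace (10 / INR n ^ 1 - 10 / (INR n + 1) ^ 1)
        with (5 / INR n ^ 2 * (2 * INR n / (INR n + 1))) by (field; lra).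
      assert (1 <= 2 * INR n / (INR n + 1)).
      { apply Rmult_le_reg_r with (INR n + 1); [lra|].
        replace (2 * INR n / (INR n + 1) * (INR n + 1)) with (2 * INR n) by (field; lra). lra. }
      assert (0 < 5 / INR n ^ 2) by (apply Rdiv_lt_0_compat; [lra | apply pow_lt; lra]).
      nra.
    + exists k. exact Hk.
Qed.

(** [Lim_seq] is total, so the convergence of the sequence that defines [Glaisher] needs a proof.
    That sequence is [exp (barnes_gap n)] for [n >= 1]. *)
Lemma Glaisher_spec : 0 < Glaisher /\ is_lim_seq barnes_gap (ln Glaisher).
Proof.
  destruct barnes_gap_lim as [l Hl].
  assert (E : Glaisher = exp l).
  { unfold Glaisher. rewrite (is_lim_seq_unique _ (exp l)); [reflexivity|].
    apply is_lim_seq_ext_loc with (fun n => exp (barnes_gap n)).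
    - exists 1%nat. intros n Hn.
      assert (Hb : 0 < INR (barnesG_succ n)) by apply lt_0_INR, barnesG_succ_pos.
      unfold barnes_gap, barnes_main0, lbarnes, Rpower, Rdiv at 1.
      rewrite <- (exp_ln (INR (barnesG_succ n))) at 2 by exact Hb.
      unfold Rdiv. rewrite <- exp_Ropp, <- !exp_plus. f_equal. field.
    - apply is_lim_seq_continuous; [|exact Hl]. apply derivable_continuous_pt, derivable_pt_exp. }
  rewrite E. split; [apply exp_pos | rewrite ln_exp; exact Hl].
Qed.

Definition barnes_main (x : R) : R := barnes_main0 x - ln Glaisher.

Lemma barnes_asymptotics : is_lim_seq (fun n => lbarnes n - barnes_main (INR n)) 0.
Proof.
  apply is_lim_seq_ext with (fun n => ln Glaisher - barnes_gap n).
  - intros n. unfold barnes_gap, barnes_main. ring.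
  - replace (Finite 0) with (Finite (ln Glaisher - ln Glaisher)) by (f_equal; ring).
    apply is_lim_seq_minus'; [apply is_lim_seq_const | apply Glaisher_spec].
Qed.

(** * Asymptotics of the ratio *)

Definition ln_nat (n : nat) : R := ln (INR n).

Lemma ln_nat_mul (a b : nat) : (0 < a)%nat -> (0 < b)%nat -> ln_nat (a * b) = ln_nat a + ln_nat b.
Proof. intros Ha Hb. unfold ln_nat. rewrite mult_INR. apply ln_mult; apply lt_0_INR; assumption. Qed.

Lemma ln_factprod (k n : nat) : ln_nat (factprod k n) = lbarnes (n + k) - lbarnes n.
Proof.
  unfold lbarnes. rewrite <- factprod_barnes. fold (ln_nat (factprod k n * barnesG_succ n)).
  rewrite ln_nat_mul; [unfold ln_nat; ring | apply factprod_gt0 | apply barnesG_succ_pos].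
Qed.

Lemma ln_ffprod (k d n : nat) :
  ln_nat (ffprod k d (d + n)) = lbarnes (d + n + k) - lbarnes (d + n) - (lbarnes (n + k) - lbarnes n).
Proof.
  assert (H : (d <= d + n)%nat) by lia.
  rewrite <- !ln_factprod, <- (@ffprod_factprod k d (d + n) H).
  replace (d + n - d)%nat with n by lia.
  rewrite ln_nat_mul; [ring | apply ffprod_gt0; lia | apply factprod_gt0].
Qed.

Definition lodd (th n : nat) : R := ln_nat (oddfactprod n th).

Lemma lodd_0 (n : nat) :
  lodd 0 n = (lbarnes (2 * n) + lfact (2 * n) - INR n * ln 2 - lfact n) / 2.
Proof.
  generalize (f_equal ln_nat (oddfactprod_square n)). unfold lodd, ssrnat.muln.
  assert (Hp : (0 < Nat.pow 2 n)%nat) by (apply Nat.neq_0_lt_0, Nat.pow_nonzero; lia).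
  assert (Ho := oddfactprod_gt0 n 0). assert (Hf := Factorial.lt_O_fact n).
  assert (Hf2 := Factorial.lt_O_fact (2 * n)). assert (Hb := barnesG_succ_pos (2 * n)).
  rewrite !ln_nat_mul; try assumption; try (apply Nat.mul_pos_pos; assumption).
  assert (E : ln_nat (Nat.pow 2 n) = INR n * ln 2).
  { unfold ln_nat. rewrite pow_INR, ln_pow by (simpl; lra). replace (INR 2) with 2 by (simpl; ring).
    reflexivity. }
  rewrite E. unfold lbarnes, lfact, ln_nat. intros Hs. lra.
Qed.

Lemma lodd_1 (n : nat) : lodd 1 n = INR n * ln 2 + lfact n + lodd 0 n.
Proof.
  unfold lodd. rewrite oddfactprod_1.
  assert (Hp : (0 < Nat.pow 2 n)%nat) by (apply Nat.neq_0_lt_0, Nat.pow_nonzero; lia).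
  assert (Ho := oddfactprod_gt0 n 0). assert (Hf := Factorial.lt_O_fact n).
  rewrite !ln_nat_mul; try assumption; try (apply Nat.mul_pos_pos; assumption).
  assert (E : ln_nat (Nat.pow 2 n) = INR n * ln 2).
  { unfold ln_nat. rewrite pow_INR, ln_pow by (simpl; lra). replace (INR 2) with 2 by (simpl; ring).
    reflexivity. }
  rewrite E. unfold lfact, ln_nat. ring.
Qed.

Lemma ln_triprod (m k th : nat) :
  ln_nat (triprod m (2 * k + th))
  = lodd th (k + m) - lodd th k - (lbarnes (2 * k + th + m) - lbarnes (2 * k + th)).
Proof.
  assert (H1 := oddfactprod_gt0 k th). assert (H2 := triprod_pos m (2 * k + th)).
  assert (H3 := factprod_gt0 m (2 * k + th)). assert (H4 := oddfactprod_gt0 m (2 * k + th)).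
  generalize (f_equal ln_nat (oddfactprod_add k m th)) (f_equal ln_nat (triprod_factprod m (2 * k + th))).
  rewrite !ln_nat_mul, ln_factprod by assumption. unfold lodd. lra.
Qed.

Ltac positive := repeat apply Nat.mul_pos_pos; try assumption;
  first [apply factprod_gt0 | apply triprod_pos | apply ffprod_gt0; lia].

(** Positivity of [M] follows from the product formula, whose other side is positive. The forms
    [d + 0] and [2 * 0 + th] are kept so that [ln_ffprod] and [ln_triprod] apply to these factors
    too. *)
Lemma ln_M (m th d u v w : nat) :
  (th <= 1)%nat -> (0 < m)%nat -> (0 < w)%nat -> (u + v = 2 * w)%nat ->
  (0 < M (hexd (2 * m + th) (d + u) (d + v) d))%nat /\
  ln_nat (M (hexd (2 * m + th) (d + u) (d + v) d)) =
    ln_nat (factprod (2 * m + th) (d + 2 * w)) + ln_nat (factprod (2 * m + th) (d + 0))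
    + ln_nat (ffprod (m + th) d (d + u)) + ln_nat (ffprod (m + th) d (d + v))
    + ln_nat (factprod m (2 * d + (m + th))) + ln_nat (factprod m 0) + ln_nat (triprod m (2 * 0 + th))
    + ln_nat (factprod m (2 * (d + w) + (m + th))) + ln_nat (factprod m 0) + ln_nat (triprod m (2 * w + th))
    - ln_nat (factprod (2 * m + th) (d + u)) - ln_nat (factprod (2 * m + th) (d + v))
    - ln_nat (ffprod (m + th) d (d + 2 * w)) - ln_nat (ffprod (m + th) d (d + 0))
    - ln_nat (factprod m (d + (m + th))) - ln_nat (factprod m (d + 0)) - ln_nat (triprod m (2 * d + th))
    - ln_nat (factprod m (d + 2 * w + (m + th))) - ln_nat (factprod m (d + 0))
    - ln_nat (triprod m (2 * (d + w) + th)).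
Proof.
  intros Hth Hm Hw Huv. rewrite Nat.add_0_r.
  assert (E := @M_product m th d u v w Hth Hm Hw Huv).
  unfold ssrnat.muln, ssrnat.addn in E.
  assert (HM : (0 < M (hexd (2 * m + th) (d + u) (d + v) d))%nat).
  { destruct (Nat.eq_0_gt_0_cases (M (hexd (2 * m + th) (d + u) (d + v) d))) as [H0|H0]; [|exact H0].
    exfalso. rewrite H0 in E.
    match type of E with _ = ?r => assert (Hr : (0 < r)%nat) by positive end.
    rewrite <- E in Hr. simpl in Hr. lia. }
  split; [exact HM|].
  apply (f_equal ln_nat) in E.
  rewrite !ln_nat_mul in E by positive. lra.
Qed.

Lemma lbarnes_0 : lbarnes 0 = 0.
Proof. unfold lbarnes. simpl. apply ln_1. Qed.

Lemma lfact_0 : lfact 0 = 0.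
Proof. unfold lfact. simpl. apply ln_1. Qed.

Lemma lbarnes_plus1 (n : nat) : lbarnes (n + 1) = lbarnes n + lfact n.
Proof. rewrite Nat.add_1_r. apply lbarnes_S. Qed.

Lemma lbarnes_1 : lbarnes 1 = 0.
Proof. rewrite lbarnes_S, lbarnes_0, lfact_0. ring. Qed.

(* Brings the arguments of [f] to ring normal form, renaming [f] to [g] on the way. *)
Ltac normalize_args f g Hg :=
  repeat match goal with
  | |- context [f ?x] =>
      let e := fresh "e" in let E := fresh "E" in
      evar (e : nat); assert (E : x = e) by (ring_simplify; unfold e; reflexivity);
      unfold e in E; clear e;
      match type of E with _ = ?y =>
        replace (f x) with (g y) by (rewrite Hg; f_equal; symmetry; exact E)
      end; clear E
  end.

(** Here [s], [u], [v], [w] stand for [(b + c) / 2], [b - d], [c - d], [s - d], and [m] for half the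
    vertical side, rounded down. The coefficients add up to [3 / 2], which yields the exponent
    [- 3 / 2] of [Glaisher], the factor [exp (1 / 8)] and the power [- 1 / 8] of [N]. *)
Definition barnes_comb (f : nat -> R) (m d b c s u v w : nat) : R :=
  f u + f v - f b - f c + f (b + m)%nat + f (c + m)%nat - f (u + m)%nat - f (v + m)%nat
  + 2 * f m + 2 * f d - 2 * f (d + m)%nat
  + (f (2 * s)%nat - f (2 * w)%nat + f (2 * (w + m))%nat - f (2 * (s + m))%nat
     - f (2 * d)%nat - f (2 * m)%nat + f (2 * (d + m))%nat) / 2.

(** In Stirling's formula for a doubling, [ln (2 PI) / 2] cancels and [ln 2 / 2] remains. This gives
    the constant power of 2 in the theorem: [1 / 4 + 1 / 24] for even and [- 1 / 4 + 1 / 24] for odd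
    vertical sides, the [1 / 24] coming from [barnes_comb]. *)
Definition doubling (f : nat -> R) (n : nat) : R := f (2 * n)%nat - f n.

Definition fact_comb_even (f : nat -> R) (m d s w : nat) : R :=
  (doubling f s - doubling f w + doubling f d + doubling f (w + m) + doubling f m
   - doubling f (s + m) - doubling f (d + m)) / 2.

Definition fact_comb_odd (f : nat -> R) (m d b c s u v w : nat) : R :=
  f (b + m)%nat + f (c + m)%nat - f (u + m)%nat - f (v + m)%nat
  + (doubling f w - doubling f s - doubling f d - doubling f m + doubling f (d + m)
     + f (w + m)%nat + f (2 * (w + m))%nat - f (s + m)%nat - f (2 * (s + m))%nat) / 2.

Lemma ln_ratio_even (m d u v w : nat) :
  (0 < m)%nat -> (0 < w)%nat -> (u + v = 2 * w)%nat ->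
  ln_nat (M (hexd (2 * m) (d + u) (d + v) d)) - ln_nat (M (hex (2 * m) (d + u) (d + v)))
  = barnes_comb lbarnes m d (d + u) (d + v) (d + w) u v w + fact_comb_even lfact m d (d + w) w.
Proof.
  intros Hm Hw Huv.
  destruct (ln_M m 0 d u v w) as [_ E1]; [lia..|].
  (* The whole hexagon is the instance [d = 0], with [u], [v], [w] replaced by [d + u], [d + v],
     [d + w] to keep the sides. *)
  destruct (ln_M m 0 0 (d + u) (d + v) (d + w)) as [_ E0]; [lia..|].
  rewrite !ln_triprod in E0. rewrite !ln_triprod in E1.
  rewrite !lodd_0, !ln_factprod, !ln_ffprod in E0.
  rewrite !lodd_0, !ln_factprod, !ln_ffprod in E1.
  change (0 + (d + u))%nat with (d + u)%nat in E0.
  change (0 + (d + v))%nat with (d + v)%nat in E0.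
  rewrite hexd0 in E0. rewrite Nat.add_0_r in E0, E1. rewrite E0, E1. clear E0 E1.
  unfold barnes_comb, fact_comb_even, doubling. rewrite !plus_INR. simpl (INR 0).
  (* [g] and [h] are opaque copies of [lbarnes] and [lfact]: a normalized argument no longer
     matches, so the renaming terminates. *)
  assert (Hg : exists g, forall n, g n = lbarnes n) by (exists lbarnes; reflexivity).
  destruct Hg as [g Hg].
  assert (Hh : exists h, forall n, h n = lfact n) by (exists lfact; reflexivity).
  destruct Hh as [h Hh].
  normalize_args lbarnes g Hg. normalize_args lfact h Hh.
  assert (g 0%nat = 0) by (rewrite Hg; apply lbarnes_0).
  assert (h 0%nat = 0) by (rewrite Hh; apply lfact_0).
  lra.
Qed.

Lemma ln_ratio_odd (m d u v w : nat) :
  (0 < m)%nat -> (0 < w)%nat -> (u + v = 2 * w)%nat ->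
  ln_nat (M (hexd (2 * m + 1) (d + u) (d + v) d)) - ln_nat (M (hex (2 * m + 1) (d + u) (d + v)))
  = barnes_comb lbarnes m d (d + u) (d + v) (d + w) u v w
    + fact_comb_odd lfact m d (d + u) (d + v) (d + w) u v w.
Proof.
  intros Hm Hw Huv.
  destruct (ln_M m 1 d u v w) as [_ E1]; [lia..|].
  destruct (ln_M m 1 0 (d + u) (d + v) (d + w)) as [_ E0]; [lia..|].
  rewrite !ln_triprod in E0. rewrite !ln_triprod in E1.
  rewrite !lodd_1, !lodd_0, !ln_factprod, !ln_ffprod in E0.
  rewrite !lodd_1, !lodd_0, !ln_factprod, !ln_ffprod in E1.
  change (0 + (d + u))%nat with (d + u)%nat in E0.
  change (0 + (d + v))%nat with (d + v)%nat in E0.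
  rewrite hexd0 in E0. rewrite E0, E1. clear E0 E1.
  unfold barnes_comb, fact_comb_odd, doubling. rewrite !plus_INR. simpl (INR 0).
  assert (Hg : exists g, forall n, g n = lbarnes n) by (exists lbarnes; reflexivity).
  destruct Hg as [g Hg].
  assert (Hh : exists h, forall n, h n = lfact n) by (exists lfact; reflexivity).
  destruct Hh as [h Hh].
  normalize_args lbarnes g Hg. normalize_args lfact h Hh.
  assert (g 0%nat = 0) by (rewrite Hg; apply lbarnes_0).
  assert (g 1%nat = 0) by (rewrite Hg; apply lbarnes_1).
  assert (h 0%nat = 0) by (rewrite Hh; apply lfact_0).
  (* For an odd side the superfactorials are taken one step further; the recursion moves these steps
     into the factorial terms of [fact_comb_odd]. *)
  assert (Hg1 : forall n, g (n + 1)%nat = g n + h n) by (intros n; rewrite !Hg, Hh; apply lbarnes_plus1).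
  rewrite !Hg1. lra.
Qed.

Lemma lim0_plus (f g : nat -> R) :
  is_lim_seq f 0 -> is_lim_seq g 0 -> is_lim_seq (fun n => f n + g n) 0.
Proof.
  intros Hf Hg. replace (Finite 0) with (Finite (0 + 0)) by (f_equal; ring).
  now apply is_lim_seq_plus'.
Qed.

Lemma lim0_minus (f g : nat -> R) :
  is_lim_seq f 0 -> is_lim_seq g 0 -> is_lim_seq (fun n => f n - g n) 0.
Proof.
  intros Hf Hg. replace (Finite 0) with (Finite (0 - 0)) by (f_equal; ring).
  now apply is_lim_seq_minus'.
Qed.

Lemma lim0_scal (k : R) (f : nat -> R) : is_lim_seq f 0 -> is_lim_seq (fun n => k * f n) 0.
Proof.
  intros Hf. replace (Finite 0) with (Finite (k * 0)) by (f_equal; ring).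
  apply (is_lim_seq_scal_l f k 0). exact Hf.
Qed.

Lemma lim0_div (k : R) (f : nat -> R) : is_lim_seq f 0 -> is_lim_seq (fun n => f n / k) 0.
Proof.
  intros Hf. apply is_lim_seq_ext with (fun n => / k * f n).
  - intros n. unfold Rdiv. ring.
  - now apply lim0_scal.
Qed.

Lemma lim0_along (f : nat -> R) (g : nat -> nat) :
  is_lim_seq f 0 -> (forall n, (n <= g n)%nat) -> is_lim_seq (fun n => f (g n)) 0.
Proof.
  intros Hf Hg. apply (is_lim_seq_subseq f 0 g); [|exact Hf].
  intros P [k HP]. exists k. intros n Hn. apply HP. generalize (Hg n). lia.
Qed.

Ltac lim0 Hf :=
  repeat first [apply lim0_minus | apply lim0_plus | apply lim0_div | apply lim0_scal];
  apply (lim0_along _ _ Hf); intros ?n; nia.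

Lemma barnes_comb_lim (f : nat -> R) (a d b c s u v w : nat) : is_lim_seq f 0 ->
  (0 < a)%nat -> (0 < d)%nat -> (0 < b)%nat -> (0 < c)%nat -> (0 < s)%nat ->
  (0 < u)%nat -> (0 < v)%nat -> (0 < w)%nat ->
  is_lim_seq (fun n => barnes_comb f (a * n) (d * n) (b * n) (c * n) (s * n) (u * n) (v * n) (w * n)) 0.
Proof. intros Hf; intros. unfold barnes_comb. lim0 Hf. Qed.

Lemma fact_comb_even_lim (f : nat -> R) (a d s w : nat) : is_lim_seq f 0 ->
  (0 < a)%nat -> (0 < d)%nat -> (0 < s)%nat -> (0 < w)%nat ->
  is_lim_seq (fun n => fact_comb_even f (a * n) (d * n) (s * n) (w * n)) 0.
Proof. intros Hf; intros. unfold fact_comb_even, doubling. lim0 Hf. Qed.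

Lemma fact_comb_odd_lim (f : nat -> R) (a d b c s u v w : nat) : is_lim_seq f 0 ->
  (0 < a)%nat -> (0 < d)%nat -> (0 < b)%nat -> (0 < c)%nat -> (0 < s)%nat ->
  (0 < u)%nat -> (0 < v)%nat -> (0 < w)%nat ->
  is_lim_seq (fun n => fact_comb_odd f (a * n) (d * n) (b * n) (c * n) (s * n) (u * n) (v * n) (w * n)) 0.
Proof. intros Hf; intros. unfold fact_comb_odd, doubling. lim0 Hf. Qed.

(** * Main terms *)

Section MainTerm.
Variables (A B C D x : R).
Hypotheses (HA : 0 < A) (HD : 0 < D) (HB : D < B) (HC : D < C) (Hx : 0 < x).
Let S := B / 2 + C / 2.

Definition log_target_even : R :=
  7 / 24 * ln 2 + 1 / 8 - 3 / 2 * ln Glaisher - 1 / 8 * ln x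
  + ln (K1 A B C D) + x / 2 * ln (K2 A B C D) + x ^ 2 / 2 * ln (K3 A B C D).

Definition log_target_odd : R :=
  - (5 / 24) * ln 2 + 1 / 8 - 3 / 2 * ln Glaisher - 1 / 8 * ln x
  + ln (L1 A B C D) + x / 2 * ln (L2 A B C D) + x ^ 2 / 2 * ln (K3 A B C D).

Lemma ln_Rpower (y z : R) : ln (Rpower y z) = z * ln y.
Proof. unfold Rpower. apply ln_exp. Qed.

Lemma Rpower_pos (y z : R) : 0 < Rpower y z.
Proof. apply exp_pos. Qed.

Ltac pos := unfold S in *; repeat first
  [ apply Rpower_pos | apply exp_pos | apply Rdiv_lt_0_compat | apply Rmult_lt_0_compat
  | apply pow_lt | lra ].

Ltac log_expand := repeat first [rewrite ln_Rpower | rewrite ln_mult by pos | rewrite ln_div by pos].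

Lemma ln_K1 : ln (K1 A B C D) =
  1 / 8 * (ln (A + D) - ln A - ln D)
  + 1 / 12 * (ln B + ln C + ln (A + B - D) + ln (A + C - D)
              - ln (A + B) - ln (A + C) - ln (B - D) - ln (C - D))
  + 1 / 24 * (ln (A + S) + ln (S - D) - ln S - ln (A + S - D)).
Proof. unfold K1. fold S. log_expand. ring. Qed.

Lemma ln_K2 : ln (K2 A B C D) =
  A * ln A + D * ln D + S * ln S + (A + S - D) * ln (A + S - D)
  - (A + D) * ln (A + D) - (A + S) * ln (A + S) - (S - D) * ln (S - D).
Proof. unfold K2, pp. fold S. log_expand. ring. Qed.

Lemma ln_K3 : ln (K3 A B C D) =
  2 * S ^ 2 * ln S - B ^ 2 * ln B - C ^ 2 * ln C
  + 2 * (A + S - D) ^ 2 * ln (A + S - D) - (A + B - D) ^ 2 * ln (A + B - D) - (A + C - D) ^ 2 * ln (A + C - D)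
  + (B - D) ^ 2 * ln (B - D) + (C - D) ^ 2 * ln (C - D) - 2 * (S - D) ^ 2 * ln (S - D)
  + (A + B) ^ 2 * ln (A + B) + (A + C) ^ 2 * ln (A + C) - 2 * (A + S) ^ 2 * ln (A + S).
Proof. unfold K3, qq. fold S. log_expand. ring. Qed.

Lemma ln_L1 : ln (L1 A B C D) =
  11 / 24 * (ln (A + S - D) - ln (A + S))
  + 5 / 12 * (ln (A + B) + ln (A + C) - ln (A + B - D) - ln (A + C - D))
  + 1 / 8 * (ln (A + D) - ln A - ln D)
  + 1 / 12 * (ln B + ln C - ln (B - D) - ln (C - D))
  + 1 / 24 * (ln (S - D) - ln S).
Proof. unfold L1. fold S. log_expand. ring. Qed.

Lemma ln_L2 : ln (L2 A B C D) =
  (A + D) * ln (A + D) - A * ln A - D * ln D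
  + (A + S) * ln (A + S) + (S - D) * ln (S - D) - (A + S - D) * ln (A + S - D) - S * ln S
  + 2 * (- D * (2 * ln 2) + (A + B) * ln (A + B) + (A + C) * ln (A + C) - 2 * (A + S) * ln (A + S)
         + 2 * (A + S - D) * ln (A + S - D)
         - (A + B - D) * ln (A + B - D) - (A + C - D) * ln (A + C - D)).
Proof.
  assert (E4 : ln 4 = 2 * ln 2).
  { replace 4 with (2 * 2) by ring. rewrite ln_mult by lra. ring. }
  unfold L2, pp. fold S. rewrite ln_mult by pos. rewrite ln_pow by pos. log_expand.
  rewrite ln_1, E4. simpl (INR 2). ring.
Qed.

Lemma barnes_main_at (y k : R) : y = k * x -> 0 < k ->
  barnes_main y = k * x / 2 * ln (2 * PI) + ((k * x) ^ 2 / 2 - 1 / 12) * (ln k + ln x)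
    - 3 / 4 * (k * x) ^ 2 + 1 / 12 - ln Glaisher.
Proof. intros -> Hk. unfold barnes_main, barnes_main0. rewrite (ln_mult k x) by assumption. ring. Qed.

Lemma stirling_main_at (y k : R) : y = k * x -> 0 < k ->
  stirling_main y = k * x * (ln k + ln x) - k * x + ln (2 * PI) / 2 + (ln k + ln x) / 2.
Proof. intros -> Hk. unfold stirling_main. rewrite (ln_mult k x) by assumption. ring. Qed.

Variables (a d b c s u v w n : nat).
Hypotheses (Ea : INR a = A) (Ed : INR d = D) (Eb : INR b = B) (Ec : INR c = C)
  (Es : INR s = S) (Eu : INR u = B - D) (Ev : INR v = C - D) (Ew : INR w = S - D)
  (En : INR n = x).

Ltac arg := repeat (rewrite mult_INR || rewrite plus_INR);
  rewrite ?Ea, ?Ed, ?Eb, ?Ec, ?Es, ?Eu, ?Ev, ?Ew, ?En; simpl (INR 2); ring.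

Ltac expand_at lem g k := rewrite (lem (INR g) k) by (try arg; pos).

(** Weighted by the coefficients of [barnes_comb], the sums of [k] and of [k ^ 2] over the arguments
    [k * x] vanish. This removes [ln (2 PI)] and [x ^ 2 * ln x]; the terms [k ^ 2 * ln k] form
    [K3]. *)
Lemma barnes_comb_main :
  barnes_comb (fun k => barnes_main (INR k)) (a * n) (d * n) (b * n) (c * n) (s * n) (u * n) (v * n) (w * n)
  = - (1 / 12 * (ln (B - D) + ln (C - D) - ln B - ln C + ln (A + B) + ln (A + C)
                 - ln (A + B - D) - ln (A + C - D) + 2 * ln A + 2 * ln D - 2 * ln (A + D)))
    - 1 / 24 * (ln S - ln (S - D) + ln (A + S - D) - ln (A + S) - ln D - ln A + ln (A + D))
    + 1 / 24 * ln 2 + 1 / 8 - 3 / 2 * ln Glaisher - 1 / 8 * ln x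
    + x ^ 2 / 2 * ln (K3 A B C D).
Proof.
  rewrite ln_K3. unfold barnes_comb.
  expand_at barnes_main_at (u * n)%nat (B - D).
  expand_at barnes_main_at (v * n)%nat (C - D).
  expand_at barnes_main_at (b * n)%nat B.
  expand_at barnes_main_at (c * n)%nat C.
  expand_at barnes_main_at (b * n + a * n)%nat (A + B).
  expand_at barnes_main_at (c * n + a * n)%nat (A + C).
  expand_at barnes_main_at (u * n + a * n)%nat (A + B - D).
  expand_at barnes_main_at (v * n + a * n)%nat (A + C - D).
  expand_at barnes_main_at (a * n)%nat A.
  expand_at barnes_main_at (d * n)%nat D.
  expand_at barnes_main_at (d * n + a * n)%nat (A + D).
  expand_at barnes_main_at (2 * (s * n))%nat (2 * S).
  expand_at barnes_main_at (2 * (w * n))%nat (2 * (S - D)).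
  expand_at barnes_main_at (2 * (w * n + a * n))%nat (2 * (A + S - D)).
  expand_at barnes_main_at (2 * (s * n + a * n))%nat (2 * (A + S)).
  expand_at barnes_main_at (2 * (d * n))%nat (2 * D).
  expand_at barnes_main_at (2 * (a * n))%nat (2 * A).
  expand_at barnes_main_at (2 * (d * n + a * n))%nat (2 * (A + D)).
  generalize (ln (2 * PI)). intros lp.
  rewrite !(ln_mult 2) by pos.
  (* [S] is an atom for [field], so its relation to [B] and [C] has to be supplied. *)
  replace C with (2 * S - B) by (unfold S; field).
  field.
Qed.

Lemma main_term_even :
  barnes_comb (fun k => barnes_main (INR k)) (a * n) (d * n) (b * n) (c * n) (s * n) (u * n) (v * n) (w * n)
  + fact_comb_even (fun k => stirling_main (INR k)) (a * n) (d * n) (s * n) (w * n)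
  = log_target_even.
Proof.
  rewrite barnes_comb_main. unfold log_target_even. rewrite ln_K1, ln_K2.
  unfold fact_comb_even, doubling.
  expand_at stirling_main_at (2 * (s * n))%nat (2 * S).
  expand_at stirling_main_at (s * n)%nat S.
  expand_at stirling_main_at (2 * (w * n))%nat (2 * (S - D)).
  expand_at stirling_main_at (w * n)%nat (S - D).
  expand_at stirling_main_at (2 * (w * n + a * n))%nat (2 * (A + S - D)).
  expand_at stirling_main_at (w * n + a * n)%nat (A + S - D).
  expand_at stirling_main_at (2 * (s * n + a * n))%nat (2 * (A + S)).
  expand_at stirling_main_at (s * n + a * n)%nat (A + S).
  expand_at stirling_main_at (2 * (d * n))%nat (2 * D).
  expand_at stirling_main_at (d * n)%nat D.
  expand_at stirling_main_at (2 * (a * n))%nat (2 * A).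
  expand_at stirling_main_at (a * n)%nat A.
  expand_at stirling_main_at (2 * (d * n + a * n))%nat (2 * (A + D)).
  expand_at stirling_main_at (d * n + a * n)%nat (A + D).
  generalize (ln (2 * PI)). intros lp.
  rewrite !(ln_mult 2) by pos.
  field.
Qed.

Lemma main_term_odd :
  barnes_comb (fun k => barnes_main (INR k)) (a * n) (d * n) (b * n) (c * n) (s * n) (u * n) (v * n) (w * n)
  + fact_comb_odd (fun k => stirling_main (INR k)) (a * n) (d * n) (b * n) (c * n) (s * n) (u * n) (v * n) (w * n)
  = log_target_odd.
Proof.
  rewrite barnes_comb_main. unfold log_target_odd. rewrite ln_L1, ln_L2.
  unfold fact_comb_odd, doubling.
  expand_at stirling_main_at (b * n + a * n)%nat (A + B).
  expand_at stirling_main_at (c * n + a * n)%nat (A + C).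
  expand_at stirling_main_at (u * n + a * n)%nat (A + B - D).
  expand_at stirling_main_at (v * n + a * n)%nat (A + C - D).
  expand_at stirling_main_at (2 * (s * n))%nat (2 * S).
  expand_at stirling_main_at (s * n)%nat S.
  expand_at stirling_main_at (2 * (w * n))%nat (2 * (S - D)).
  expand_at stirling_main_at (w * n)%nat (S - D).
  expand_at stirling_main_at (2 * (w * n + a * n))%nat (2 * (A + S - D)).
  expand_at stirling_main_at (w * n + a * n)%nat (A + S - D).
  expand_at stirling_main_at (2 * (s * n + a * n))%nat (2 * (A + S)).
  expand_at stirling_main_at (s * n + a * n)%nat (A + S).
  expand_at stirling_main_at (2 * (d * n))%nat (2 * D).
  expand_at stirling_main_at (d * n)%nat D.
  expand_at stirling_main_at (2 * (a * n))%nat (2 * A).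
  expand_at stirling_main_at (a * n)%nat A.
  expand_at stirling_main_at (2 * (d * n + a * n))%nat (2 * (A + D)).
  expand_at stirling_main_at (d * n + a * n)%nat (A + D).
  generalize (ln (2 * PI)). intros lp.
  rewrite !(ln_mult 2) by pos.
  field.
Qed.
End MainTerm.

Section Targets.
Variables (A B C D x : R).
Hypotheses (HA : 0 < A) (HD : 0 < D) (HB : D < B) (HC : D < C) (Hx : 0 < x).

Ltac pos := repeat first
  [ apply Rpower_pos | apply exp_pos | apply Rdiv_lt_0_compat | apply Rmult_lt_0_compat
  | apply pow_lt | assumption | lra ].

Lemma exp_target_even :
  Rpower 2 (7 / 24) * exp (1 / 8) / (Rpower Glaisher (3 / 2) * Rpower x (1 / 8))
  * K1 A B C D * Rpower (K2 A B C D) (x / 2) * Rpower (K3 A B C D) (x ^ 2 / 2)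
  = exp (log_target_even A B C D x).
Proof.
  assert (H1 : 0 < K1 A B C D) by (unfold K1; pos).
  rewrite <- (exp_ln (_ * _)) by pos. f_equal. unfold log_target_even.
  repeat first [rewrite ln_Rpower | rewrite ln_exp | rewrite ln_mult by pos | rewrite ln_div by pos].
  ring.
Qed.

Lemma exp_target_odd :
  exp (1 / 8) / (Rpower 2 (5 / 24) * Rpower Glaisher (3 / 2) * Rpower x (1 / 8))
  * L1 A B C D * Rpower (L2 A B C D) (x / 2) * Rpower (K3 A B C D) (x ^ 2 / 2)
  = exp (log_target_odd A B C D x).
Proof.
  assert (H1 : 0 < L1 A B C D) by (unfold L1; pos).
  rewrite <- (exp_ln (_ * _)) by pos. f_equal. unfold log_target_odd.
  repeat first [rewrite ln_Rpower | rewrite ln_exp | rewrite ln_mult by pos | rewrite ln_div by pos].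
  ring.
Qed.
End Targets.

(** * Passage to the limit *)

Lemma is_lim_seq_quotient (P Q T : nat -> R) (e : nat -> R) :
  (forall n, (0 < n)%nat -> 0 < P n /\ 0 < Q n /\ ln (P n) - ln (Q n) = ln (T n) + e n /\ 0 < T n) ->
  is_lim_seq e 0 -> is_lim_seq (fun n => P n / Q n / T n) 1.
Proof.
  intros H He. apply is_lim_seq_ext_loc with (fun n => exp (e n)).
  - exists 1%nat. intros n Hn. destruct (H n Hn) as (HP & HQ & E & HT).
    replace (e n) with (ln (P n) + - ln (Q n) + - ln (T n)) by lra.
    rewrite !exp_plus, !exp_Ropp, !exp_ln by assumption. reflexivity.
  - rewrite <- exp_0. apply is_lim_seq_continuous; [|exact He].
    apply derivable_continuous_pt, derivable_pt_exp.
Qed.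

Section Scaling.
Variables a b c d : nat.
Hypotheses (Ha : (0 < a)%nat) (Hd : (0 < d)%nat) (Hdb : (d < b)%nat) (Hbc : (b <= c)%nat)
  (Hpar : Nat.modulo b 2 = Nat.modulo c 2).

Lemma half_sum_exists : exists u v w, (b = d + u /\ c = d + v /\ u + v = 2 * w /\ 0 < u /\ 0 < v /\ 0 < w)%nat.
Proof.
  exists (b - d)%nat, (c - d)%nat, ((b + c) / 2 - d)%nat.
  generalize (Nat.div_mod_eq b 2) (Nat.div_mod_eq c 2) (Nat.div_mod_eq (b + c) 2)
    (Nat.mod_upper_bound (b + c) 2 ltac:(lia)) (Nat.mod_upper_bound b 2 ltac:(lia)). lia.
Qed.

Theorem ratio_limits :
  is_lim_seq (fun N : nat =>
    INR (M (hexd (2 * a * N) (b * N) (c * N) (d * N))) / INR (M (hex (2 * a * N) (b * N) (c * N)))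
    / exp (log_target_even (INR a) (INR b) (INR c) (INR d) (INR N))) 1
  /\
  is_lim_seq (fun N : nat =>
    INR (M (hexd (2 * a * N + 1) (b * N) (c * N) (d * N))) / INR (M (hex (2 * a * N + 1) (b * N) (c * N)))
    / exp (log_target_odd (INR a) (INR b) (INR c) (INR d) (INR N))) 1.
Proof.
  destruct half_sum_exists as (u & v & w & Eb & Ec & Ew & Hu & Hv & Hw).
  set (s := (d + w)%nat).
  assert (RA : 0 < INR a) by (apply lt_0_INR; lia).
  assert (RD : 0 < INR d) by (apply lt_0_INR; lia).
  assert (RB : INR d < INR b) by (apply lt_INR; lia).
  assert (RC : INR d < INR c) by (apply lt_INR; lia).
  assert (RU : INR u = INR b - INR d) by (rewrite Eb, plus_INR; ring).
  assert (RV : INR v = INR c - INR d) by (rewrite Ec, plus_INR; ring).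
  assert (RW : INR w = INR b / 2 + INR c / 2 - INR d).
  { generalize (f_equal INR Ew). rewrite mult_INR, plus_INR. simpl (INR 2). lra. }
  assert (RS : INR s = INR b / 2 + INR c / 2) by (unfold s; rewrite plus_INR; lra).
  pose proof (barnes_comb_lim _ a d b c s u v w barnes_asymptotics
    Ha Hd ltac:(lia) ltac:(lia) ltac:(unfold s; lia) Hu Hv Hw) as LB.
  split.
  - pose proof (fact_comb_even_lim _ a d s w stirling Ha Hd ltac:(unfold s; lia) Hw) as LF.
    (* Both combinations are linear in the function, so the error consists of the same combinations
       of [lbarnes - barnes_main] and [lfact - stirling_main]. *)
    refine (is_lim_seq_quotient _ _ _ _ _ (lim0_plus _ _ LB LF)).
    intros n Hn. assert (Rn : 0 < INR n) by (apply lt_0_INR; lia).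
    replace (2 * a * n)%nat with (2 * (a * n))%nat by lia.
    pose proof (ln_ratio_even (a * n) (d * n) (u * n) (v * n) (w * n) ltac:(nia) ltac:(nia) ltac:(nia)) as E.
    destruct (ln_M (a * n) 0 (d * n) (u * n) (v * n) (w * n)) as [P1 _]; [nia..|].
    destruct (ln_M (a * n) 0 0 (d * n + u * n) (d * n + v * n) (d * n + w * n)) as [P0 _]; [nia..|].
    change (0 + (d * n + u * n))%nat with (d * n + u * n)%nat in P0.
    change (0 + (d * n + v * n))%nat with (d * n + v * n)%nat in P0.
    rewrite hexd0 in P0. rewrite Nat.add_0_r in P0, P1.
    replace (d * n + u * n)%nat with (b * n)%nat in * by (rewrite Eb; lia).
    replace (d * n + v * n)%nat with (c * n)%nat in * by (rewrite Ec; lia).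
    replace (d * n + w * n)%nat with (s * n)%nat in * by (unfold s; lia).
    repeat split; [apply lt_0_INR; exact P1 | apply lt_0_INR; exact P0 | | apply exp_pos].
    fold (ln_nat (M (hexd (2 * (a * n)) (b * n) (c * n) (d * n)))).
    fold (ln_nat (M (hex (2 * (a * n)) (b * n) (c * n)))).
    rewrite E, ln_exp.
    rewrite <- (main_term_even (INR a) (INR b) (INR c) (INR d) (INR n) RA RD RB RC Rn
      a d b c s u v w n) by (assumption || reflexivity).
    unfold barnes_comb, fact_comb_even, doubling. field.
  - pose proof (fact_comb_odd_lim _ a d b c s u v w stirling
      Ha Hd ltac:(lia) ltac:(lia) ltac:(unfold s; lia) Hu Hv Hw) as LF.
    refine (is_lim_seq_quotient _ _ _ _ _ (lim0_plus _ _ LB LF)).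
    intros n Hn. assert (Rn : 0 < INR n) by (apply lt_0_INR; lia).
    replace (2 * a * n)%nat with (2 * (a * n))%nat by lia.
    pose proof (ln_ratio_odd (a * n) (d * n) (u * n) (v * n) (w * n) ltac:(nia) ltac:(nia) ltac:(nia)) as E.
    destruct (ln_M (a * n) 1 (d * n) (u * n) (v * n) (w * n)) as [P1 _]; [nia..|].
    destruct (ln_M (a * n) 1 0 (d * n + u * n) (d * n + v * n) (d * n + w * n)) as [P0 _]; [nia..|].
    change (0 + (d * n + u * n))%nat with (d * n + u * n)%nat in P0.
    change (0 + (d * n + v * n))%nat with (d * n + v * n)%nat in P0.
    rewrite hexd0 in P0.
    replace (d * n + u * n)%nat with (b * n)%nat in * by (rewrite Eb; lia).
    replace (d * n + v * n)%nat with (c * n)%nat in * by (rewrite Ec; lia).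
    replace (d * n + w * n)%nat with (s * n)%nat in * by (unfold s; lia).
    repeat split; [apply lt_0_INR; exact P1 | apply lt_0_INR; exact P0 | | apply exp_pos].
    fold (ln_nat (M (hexd (2 * (a * n) + 1) (b * n) (c * n) (d * n)))).
    fold (ln_nat (M (hex (2 * (a * n) + 1) (b * n) (c * n)))).
    rewrite E, ln_exp.
    rewrite <- (main_term_odd (INR a) (INR b) (INR c) (INR d) (INR n) RA RD RB RC Rn
      a d b c s u v w n) by (assumption || reflexivity).
    unfold barnes_comb, fact_comb_odd, doubling. field.
Qed.
End Scaling.

Theorem theorem2p3 (a b c d : nat) :
  (0 < a)%nat -> (0 < d)%nat -> (d < b)%nat -> (b <= c)%nat ->
  Nat.modulo b 2 = Nat.modulo c 2 ->
  let aR := INR a in let bR := INR b in let cR := INR c in let dR := INR d in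
  is_lim_seq (fun N : nat =>
    (INR (M (hexd (2 * a * N) (b * N) (c * N) (d * N)))
     / INR (M (hex (2 * a * N) (b * N) (c * N))))
    / (Rpower 2 (7 / 24) * exp (1 / 8) / (Rpower Glaisher (3 / 2) * Rpower (INR N) (1 / 8))
       * K1 aR bR cR dR * Rpower (K2 aR bR cR dR) (INR N / 2)
       * Rpower (K3 aR bR cR dR) (INR N ^ 2 / 2))) 1
  /\
  is_lim_seq (fun N : nat =>
    (INR (M (hexd (2 * a * N + 1) (b * N) (c * N) (d * N)))
     / INR (M (hex (2 * a * N + 1) (b * N) (c * N))))
    / (exp (1 / 8) / (Rpower 2 (5 / 24) * Rpower Glaisher (3 / 2) * Rpower (INR N) (1 / 8))
       * L1 aR bR cR dR * Rpower (L2 aR bR cR dR) (INR N / 2)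
       * Rpower (K3 aR bR cR dR) (INR N ^ 2 / 2))) 1.
Proof.
  intros Ha Hd Hdb Hbc Hpar aR bR cR dR.
  assert (RA : 0 < aR) by (apply lt_0_INR; exact Ha).
  assert (RD : 0 < dR) by (apply lt_0_INR; exact Hd).
  assert (RB : dR < bR) by (apply lt_INR; exact Hdb).
  assert (RC : dR < cR) by (apply lt_INR; lia).
  destruct (ratio_limits a b c d Ha Hd Hdb Hbc Hpar) as [H0 H1].
  split.
  (* The logarithmic form of the target requires [INR N] to be positive, so [N = 0] is left out. *)
  - eapply is_lim_seq_ext_loc; [|exact H0]. exists 1%nat. intros n Hn. cbv beta.
    rewrite exp_target_even; [reflexivity | try assumption; apply lt_0_INR; lia..].
  - eapply is_lim_seq_ext_loc; [|exact H1]. exists 1%nat. intros n Hn. cbv beta.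
    rewrite exp_target_odd; [reflexivity | try assumption; apply lt_0_INR; lia..].
Qed.
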